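(* Let $N\ge 2$ be an integer, $\alpha\in(0,\frac{\pi}{2}]$, $c_0>0$ and $c=c_0/\sin\alpha$. Let $A$ be a finite subset of the sphere $\mathbb S^{N-2}\subset\mathbb R^{N-1}$ of cardinality $k\ge 1$, let $(\gamma_\nu)_{\nu\in A}$ be given real numbers, and define, for $x\in\mathbb R^{N-1}$, $$\phi^*(x)=\inf_{\nu\in A}\left(-(\cot\alpha)\,x\cdot\nu+\gamma_\nu\right),\qquad \phi_\infty(x)=\inf_{\nu\in A}\left(-(\cot\alpha)\,x\cdot\nu\right)$$ (so that $\phi^*$ is a viscosity solution of $|D\phi^*|=\cot\alpha$ in $\mathbb R^{N-1}$). Let $$E_\infty=\{x\in\mathbb R^{N-1}\;:\;\phi_\infty\text{ is not }C^1\text{ at }x\}.$$ Then there exists a unique smooth concave solution $\phi\in C^\infty(\mathbb R^{N-1})$ of $$-\operatorname{div}\left(\frac{D\phi}{\sqrt{1+|D\phi|^2}}\right)+c_0-\frac{c}{\sqrt{1+|D\phi|^2}}=0,\qquad x\in\mathbb R^{N-1},$$ such that $$-\frac{2\ln k}{c_0\sin\alpha}\le\phi(x)-\phi^*(x)\le 0\quad\text{for all }x\in\mathbb R^{N-1},$$ and $$\lim_{l\to+\infty}\ \sup_{\operatorname{dist}(x,E_\infty)\ge l}|\phi(x)-\phi^*(x)|=0.$$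
   Context: $\mathbb S^{N-2}$ is the Euclidean unit sphere of $\mathbb R^{N-1}$ (for $N=2$, $\mathbb S^0=\{-1,1\}$). $\operatorname{dist}$ is the Euclidean distance, with the usual convention $\operatorname{dist}(x,\emptyset)=+\infty$. *)

(* Defs.v *)
From HB Require Import structures.
From mathcomp Require Import all_boot all_order all_algebra.
From mathcomp Require Import all_classical all_reals all_analysis.

Set Implicit Arguments.
Unset Strict Implicit.
Unset Printing Implicit Defensive.

Import Order.TTheory GRing.Theory Num.Theory.
Import numFieldNormedType.Exports.

Local Open Scope classical_set_scope.
Local Open Scope ring_scope.

Definition cot {R : realType} (a : R) : R := cos a / sin a.

(* The library norm on ['rV[R]_n] is the sup norm, hence the explicit Euclidean
   inner product and norm. Both norms induce the same topology. *)
Definition dotv {R : realType} {n : nat} (x y : 'rV[R]_n) : R :=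
  \sum_(i < n) x 0 i * y 0 i.

Definition enorm {R : realType} {n : nat} (x : 'rV[R]_n) : R :=
  Num.sqrt (dotv x x).

Definition unit_sphere {R : realType} {n : nat} : set 'rV[R]_n :=
  [set x | enorm x = 1].

(* Since [ereal_inf set0 = +oo], the distance to the empty set is [+oo]. *)
Definition edistv {R : realType} {n : nat} (x : 'rV[R]_n) (E : set 'rV[R]_n) :
    \bar R :=
  ereal_inf [set (enorm (x - y))%:E | y in E].

Definition partial {R : realType} {n : nat} (i : 'I_n) (f : 'rV[R]_n -> R) :
    'rV[R]_n -> R :=
  fun x => 'D_(delta_mx 0 i) f x.

Definition has_partial {R : realType} {n : nat} (i : 'I_n) (f : 'rV[R]_n -> R)
    (x : 'rV[R]_n) : Prop :=
  derivable f x (delta_mx 0 i).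

Definition grad {R : realType} {n : nat} (f : 'rV[R]_n -> R) (x : 'rV[R]_n) :
    'rV[R]_n :=
  \row_i partial i f x.

Definition divergence {R : realType} {n : nat} (F : 'rV[R]_n -> 'rV[R]_n)
    (x : 'rV[R]_n) : R :=
  \sum_(i < n) partial i (fun y => F y 0 i) x.

(* [f] is of class C^1 on some neighbourhood of [x]. *)
Definition C1_at {R : realType} {n : nat} (f : 'rV[R]_n -> R) (x : 'rV[R]_n) :
    Prop :=
  \forall y \near x, forall i : 'I_n,
    has_partial i f y /\ {for y, continuous (partial i f)}.

(* For [n = 0] the successor case would be void; [n] is positive in all uses. *)
Fixpoint class_C {R : realType} {n : nat} (k : nat) (f : 'rV[R]_n -> R) : Prop :=
  match k with
  | 0 => continuous f
  | k'.+1 => forall i : 'I_n,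
      (forall x, has_partial i f x) /\ class_C k' (partial i f)
  end.

Definition smooth {R : realType} {n : nat} (f : 'rV[R]_n -> R) : Prop :=
  forall k, class_C k f.

Definition concave {R : realType} {n : nat} (f : 'rV[R]_n -> R) : Prop :=
  convex_function [set: 'rV[R]_n] (fun x => - f x).

(* [A] being finite and nonempty in all uses, the infimum is a minimum; the
   values of [gamma] outside [A] are irrelevant. *)
Definition phi_star {R : realType} {n : nat} (alpha : R) (A : set 'rV[R]_n)
    (gamma : 'rV[R]_n -> R) (x : 'rV[R]_n) : R :=
  inf [set - cot alpha * dotv x nu + gamma nu | nu in A].

Definition phi_infty {R : realType} {n : nat} (alpha : R) (A : set 'rV[R]_n)
    (x : 'rV[R]_n) : R :=
  inf [set - cot alpha * dotv x nu | nu in A].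

Definition E_infty {R : realType} {n : nat} (alpha : R) (A : set 'rV[R]_n) :
    set 'rV[R]_n :=
  [set x | ~ C1_at (phi_infty alpha A) x].

Definition forced_mc_equation {R : realType} {n : nat} (c0 c : R)
    (phi : 'rV[R]_n -> R) : Prop :=
  forall x : 'rV[R]_n,
    - divergence
        (fun y => (Num.sqrt (1 + enorm (grad phi y) ^+ 2))^-1 *: grad phi y) x
      + c0 - c / Num.sqrt (1 + enorm (grad phi x) ^+ 2) = 0.

(* Main.v *)
(* Write [n = N - 1] and [v = sqrt (1 + |Du|^2)]. After multiplication by [v^3]
   the equation becomes [sum_s D^2 u (zeta_s, zeta_s) + c v^2 - c0 v^3 = 0], where
   the directions [zeta_s] depend linearly on [Du] and satisfy
   [sum_s zeta_s zeta_s^T = v^2 I - Du Du^T].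

   Existence. The planes [- cot alpha x.nu + gamma_nu] solve the equation, and
   their soft minimum [u0 = - ln (sum_nu exp (- lam l_nu)) / lam] with
   [lam = c0 sin alpha / 2] is a smooth concave subsolution with
   [phi* - ln k / lam <= u0 <= phi*]. The parabolic flow started at [u0] is
   produced by an explicit finite difference scheme in the directions [zeta_s].
   Discrete estimates bound the derivatives of every order uniformly in
   the mesh and in time: the comparison principle bounds the first derivatives,
   concavity and the monotonicity in time bound the second ones, and an energy
   inequality for [sum |D^j u|^2] bounds the others by induction. Along an
   ultrafilter the scheme converges to a flow which increases in time and stays
   between [u0] and the planes; its limit is a stationary solution [phi].

   Decay. If [dist (x, E_infty) >= l], then one plane is lower than the others by
   [cot alpha * l * const] up to a constant, so that [phi* - u0], which dominates
   [phi* - phi], is exponentially small.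

   Uniqueness. If [M = sup |psi - phi| > 0], every [x] lies on a sphere of fixed
   radius about a point [z] whose unit ball is so far from [E_infty] that
   [|psi - phi| <= M / 2] on it. The barrier [exp (- K |x - z|^2)] then makes
   [|psi - phi|] smaller than [M] by a fixed amount at [x]: at an interior maximum
   the gradients of [psi] and [phi] differ by that of the barrier, so only bounds
   on the derivatives of [phi] are needed. *)

Require Import Defs.
From HB Require Import structures.
From mathcomp Require Import all_boot all_order all_algebra.
From mathcomp Require Import all_classical all_reals all_analysis.
From mathcomp Require Import ring lra zify.

Set Implicit Arguments.
Unset Strict Implicit.
Unset Printing Implicit Defensive.

Import Order.TTheory GRing.Theory Num.Theory.
Import numFieldNormedType.Exports.

Local Open Scope classical_set_scope.
Local Open Scope ring_scope.

(** * Quantitative differential calculus *)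

Section calculus.
Context {R : realType} {n : nat}.
Notation V := 'rV[R]_n.
Implicit Types (x y z : V) (f g : V -> R) (df dg : 'I_n -> V -> R).

(** The scheme acts on functions of a continuous variable, not on a lattice. It can therefore be
    differentiated exactly in [x], and every derivative of an iterate is one component of a jet that
    the step updates as a whole. The obstacle is a circular dependence of the bounds: at order [k]
    the energy inequality gains squares of increments, and these control order [k + 1] only up to
    [h^2] times the square of a bound on order [k + 2]. Each order is therefore treated by an
    invariant whose constant is fixed beforehand, while the bound on the next order restricts the
    mesh alone. The chain is cut at a top order by a bound that grows exponentially in time, which
    is harmless because the mesh is chosen after the time horizon. Third derivatives enter the bound
    on second ones in the same way, through the mesh only. The value [c = c0 / sin alpha] is
    [c0 * sqrt (1 + cot^2 alpha)], for which planes of slope [cot alpha] are stationary. For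
    [alpha = pi / 2] the slope is zero, [E_infty] is empty and the solution is a constant; this case
    is separated because the description of [E_infty] by ties between planes requires a positive
    slope. *)

Definition nm x : R := \sum_i `|x 0 i|.

Lemma nm_ge0 x : 0 <= nm x.
Proof. by apply: sumr_ge0 => i _. Qed.

Lemma nmD x y : nm (x + y) <= nm x + nm y.
Proof. by rewrite /nm -big_split; apply: ler_sum => i _; rewrite mxE ler_normD. Qed.

Lemma nmZ a x : nm (a *: x) = `|a| * nm x.
Proof. by rewrite /nm mulr_sumr; apply: eq_bigr => i _; rewrite mxE normrM. Qed.

Lemma nmN x : nm (- x) = nm x.
Proof. by rewrite -scaleN1r nmZ normrN1 mul1r. Qed.

Lemma nm_delta i (t : R) : nm (t *: delta_mx 0 i) = `|t|.
Proof.
rewrite nmZ /nm (bigD1 i) //= big1 ?addr0 => [|j ji]; rewrite mxE ?eqxx ?normr1 ?mulr1 //.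
by rewrite (negbTE ji) andbF normr0.
Qed.

Lemma ler_sum_nm (a : 'I_n -> R) b z :
  (forall i, `|a i| <= b) -> `|\sum_i a i * z 0 i| <= b * nm z.
Proof.
move=> ab; apply: le_trans (ler_norm_sum _ _ _) _; rewrite /nm mulr_sumr.
by apply: ler_sum => i _; rewrite normrM ler_wpM2r.
Qed.

(** [df] plays the role of the gradient of [f], with a quadratic remainder uniform in [x]. Such an
    inequality survives pointwise limits, which is how derivatives are carried through the limit of
    the scheme. The l^1 norm [nm] is dual to bounds on each component of [df]. *)
Definition tay f df (C : R) :=
  forall x z, `|f (x + z) - f x - \sum_i df i x * z 0 i| <= C * nm z ^+ 2.

Definition bdd f (b : R) := forall x, `|f x| <= b.

(** Summing over [N] equal steps turns the quadratic error into [C / N], which vanishes as [N]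
    grows. This stands in for the mean value theorem when only [tay] is known. *)
Lemma telescope_le (phi : R -> R) (a C : R) :
  (forall s t, 0 <= s -> s <= t -> t <= 1 ->
     `|phi t - phi s| <= a * (t - s) + C * (t - s) ^+ 2) ->
  `|phi 1 - phi 0| <= a.
Proof.
move=> H.
have step (N : nat) : (0 < N)%N -> `|phi 1 - phi 0| <= a + C / N%:R.
  move=> N0; have NR : 0 < N%:R :> R by rewrite ltr0n.
  pose p (m : nat) := phi (m%:R / N%:R).
  have -> : phi 1 - phi 0 = \sum_(0 <= m < N) (p m.+1 - p m).
    by rewrite telescope_sumr // /p divff ?gt_eqF // mul0r.
  have -> : a + C / N%:R = \sum_(0 <= m < N) (a / N%:R + C / N%:R ^+ 2).
    rewrite sumr_const_nat subn0 -mulr_natr; field; exact: lt0r_neq0.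
  apply: le_trans (ler_norm_sum _ _ _) _; rewrite !big_mkord.
  apply: ler_sum => m _; rewrite /p.
  have -> : a / N%:R + C / N%:R ^+ 2 = a * (m.+1%:R / N%:R - m%:R / N%:R)
     + C * (m.+1%:R / N%:R - m%:R / N%:R) ^+ 2 :> R.
    rewrite -!mulrBl -natrB // subSnn; field; exact: lt0r_neq0.
  apply: H; first by rewrite divr_ge0.
    by rewrite ler_pM2r ?invr_gt0 // ler_nat.
  by rewrite ler_pdivrMr // mul1r ler_nat.
have C0 : 0 <= a + C by have := step 1%N isT; rewrite divr1; apply: le_trans.
rewrite leNgt; apply/negP => lt.
set d := `|phi 1 - phi 0| in step lt.
have [N [N0 HN]] : exists N : nat, (0 < N)%N /\ C < (d - a) * N%:R.
  exists (Num.truncn (`|C| / (d - a))).+1; split=> //.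
  rewrite -ltr_pdivrMl ?subr_gt0 //.
  apply: le_lt_trans (truncnS_gt _) => //.
  by rewrite mulrC ler_pM2r ?invr_gt0 ?subr_gt0 // ler_norm.
have := step N N0; rewrite -lerBlDl ler_pdivlMr ?ltr0n //; lra.
Qed.

Lemma tay_lip f df C b x z : tay f df C -> (forall i, bdd (df i) b) ->
  `|f (x + z) - f x| <= b * nm z.
Proof.
move=> fC dfb; pose phi t := f (x + t *: z).
suff : `|phi 1 - phi 0| <= b * nm z by rewrite /phi scale1r scale0r addr0.
apply: (telescope_le (C := C * nm z ^+ 2)) => s t s0 st t1; rewrite /phi.
have -> : x + t *: z = (x + s *: z) + (t - s) *: z.
  by rewrite -addrA -scalerDl subrKC.
set w := (t - s) *: z; set x' := x + s *: z.
have nw : nm w = (t - s) * nm z by rewrite /w nmZ ger0_norm ?subr_ge0.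
have := fC x' w; have := @ler_sum_nm (fun i => df i x') b w (fun i => dfb i x').
rewrite nw; set S := \sum_i _ => h1 h2.
have -> : f (x' + w) - f x' = (f (x' + w) - f x' - S) + S by ring.
apply: le_trans (ler_normD _ _) _; nra.
Qed.

(** The Taylor constant of a jet is only known to exist. Here it is traded for the Lipschitz
    constant of the gradient, so that uniform bounds on second derivatives become uniform Taylor
    bounds. *)
Lemma tay_sharp f df C L : tay f df C ->
  (forall i x z, `|df i (x + z) - df i x| <= L * nm z) -> tay f df L.
Proof.
move=> fC dfL x z.
pose phi t := f (x + t *: z) - t * \sum_i df i x * z 0 i.
suff : `|phi 1 - phi 0| <= L * nm z ^+ 2.
  by rewrite /phi scale1r scale0r addr0 mul1r mul0r subr0 addrAC.
apply: (telescope_le (C := C * nm z ^+ 2)) => s t s0 st t1; rewrite /phi.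
have -> : x + t *: z = (x + s *: z) + (t - s) *: z.
  by rewrite -addrA -scalerDl subrKC.
set w := (t - s) *: z; set x' := x + s *: z.
have nw : nm w = (t - s) * nm z by rewrite /w nmZ ger0_norm ?subr_ge0.
have := fC x' w; rewrite nw; set S := \sum_i df i x' * w 0 i => h2.
have -> : f (x' + w) - t * (\sum_i df i x * z 0 i) - (f x' - s * \sum_i df i x * z 0 i)
   = (f (x' + w) - f x' - S) + \sum_i (df i x' - df i x) * w 0 i.
  under [in RHS]eq_bigr do rewrite mulrBl.
  rewrite sumrB -/S.
  have -> : \sum_i df i x * w 0 i = (t - s) * \sum_i df i x * z 0 i.
    by rewrite mulr_sumr; apply: eq_bigr => i _; rewrite mxE; ring.
  ring.
apply: le_trans (ler_normD _ _) _.
have h3 i : `|df i x' - df i x| <= L * nm z.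
  apply: le_trans (dfL i x (s *: z)) _; rewrite nmZ ger0_norm //.
  have L0 : 0 <= L * nm z by apply: le_trans (dfL i x z).
  have s1 : s <= 1 by lra.
  nra.
have := @ler_sum_nm (fun i => df i x' - df i x) (L * nm z) w h3.
rewrite nw; nra.
Qed.

Definition quad (Q : 'I_n -> 'I_n -> R) z := \sum_i \sum_j Q j i * z 0 j * z 0 i.

(** The path function [phi] subtracts the second order Taylor polynomial. Its increments are
    governed by the remainders [r] of the gradient, and whatever is quadratic in the step disappears
    in [telescope_le]. *)
Lemma tay2 f df (ddf : 'I_n -> 'I_n -> V -> R) C L x z : tay f df C ->
  (forall i, tay (df i) (fun j => ddf j i) L) ->
  `|f (x + z) - f x - \sum_i df i x * z 0 i - 2^-1 * quad (fun j i => ddf j i x) z|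
    <= L * nm z ^+ 3.
Proof.
move=> fC dfL; set Q := quad _ _.
pose phi t := f (x + t *: z) - t * (\sum_i df i x * z 0 i) - 2^-1 * t ^+ 2 * Q.
have L0 : 0 <= L * nm z ^+ 3.
  case: (pickP (fun i : 'I_n => true)) => [i _|noi].
    have := le_trans (normr_ge0 _) (dfL i x z); have := nm_ge0 z => a b.
    by rewrite exprS mulrCA mulr_ge0.
  by rewrite /nm big_pred0 // expr0n mulr0.
suff : `|phi 1 - phi 0| <= L * nm z ^+ 3.
  rewrite /phi scale1r scale0r addr0 mul1r mul0r !subr0 expr1n mulr1 expr0n mulr0 mul0r subr0.
  by congr (`|_| <= _); ring.
apply: (telescope_le (C := C * nm z ^+ 2 + 2^-1 * `|Q|)) => s t s0 st t1; rewrite /phi.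
have -> : x + t *: z = (x + s *: z) + (t - s) *: z.
  by rewrite -addrA -scalerDl subrKC.
set w := (t - s) *: z; set x' := x + s *: z.
have nw : nm w = (t - s) * nm z by rewrite /w nmZ ger0_norm ?subr_ge0.
have := fC x' w; rewrite nw; set S := \sum_i df i x' * w 0 i => h2.
pose r i := df i x' - df i x - \sum_j ddf j i x * (s *: z) 0 j.
have rb i : `|r i| <= L * nm z ^+ 2.
  have := dfL i x (s *: z); rewrite -/x' -/(r i) nmZ (ger0_norm s0) => h.
  apply: le_trans h _; rewrite exprMn mulrCA.
  have L1 := le_trans (normr_ge0 _) (dfL i x z).
  have s1 : s <= 1 by lra.
  have : s ^+ 2 <= 1 by rewrite expr_le1.
  nra.
have -> : f (x' + w) - t * (\sum_i df i x * z 0 i) - 2^-1 * t ^+ 2 * Q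
     - (f x' - s * (\sum_i df i x * z 0 i) - 2^-1 * s ^+ 2 * Q)
   = (f (x' + w) - f x' - S) + (\sum_i r i * w 0 i) - 2^-1 * (t - s) ^+ 2 * Q.
  have -> : \sum_i r i * w 0 i = S - (t - s) * (\sum_i df i x * z 0 i) - s * (t - s) * Q.
    rewrite /S /Q /quad !mulr_sumr -!sumrB; apply: eq_bigr => i _.
    rewrite /r !mulrBl; congr (_ - _ - _); first by rewrite mxE; ring.
    by rewrite mulr_suml mulr_sumr; apply: eq_bigr => j _; rewrite /w !mxE; ring.
  by field.
have := @ler_sum_nm r (L * nm z ^+ 2) w rb; rewrite nw => h3.
have h4 : `|2^-1 * (t - s) ^+ 2 * Q| <= 2^-1 * `|Q| * (t - s) ^+ 2.
  have a0 : 0 <= 2^-1 * (t - s) ^+ 2 by rewrite mulr_ge0 ?sqr_ge0 ?invr_ge0.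
  by rewrite normrM (ger0_norm a0) mulrAC.
apply: (le_trans (ler_normB _ _)).
have := ler_normD (f (x' + w) - f x' - S) (\sum_i r i * w 0 i).
have -> : L * nm z ^+ 3 * (t - s) = L * nm z ^+ 2 * ((t - s) * nm z) by ring.
nra.
Qed.

Lemma tay_sdiff f df C x z : tay f df C ->
  `|f (x + z) + f (x - z) - 2 * f x| <= 2 * C * nm z ^+ 2.
Proof.
move=> fC; have h1 := fC x z; have h2 := fC x (- z); rewrite nmN in h2.
have e : \sum_i df i x * (- z) 0 i = - \sum_i df i x * z 0 i.
  by rewrite -sumrN; apply: eq_bigr => i _; rewrite mxE mulrN.
rewrite e in h2; set S := \sum_i _ in h1 h2.
have -> : f (x + z) + f (x - z) - 2 * f x
  = (f (x + z) - f x - S) + (f (x - z) - f x - - S) by ring.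
apply: le_trans (ler_normD _ _) _; lra.
Qed.

Lemma tay2_sdiff f df (ddf : 'I_n -> 'I_n -> V -> R) C L x z : tay f df C ->
  (forall i, tay (df i) (fun j => ddf j i) L) ->
  `|f (x + z) + f (x - z) - 2 * f x - quad (fun j i => ddf j i x) z|
    <= 2 * L * nm z ^+ 3.
Proof.
move=> fC dfL; have h1 := tay2 x z fC dfL; have h2 := tay2 x (- z) fC dfL; rewrite nmN in h2.
have e : \sum_i df i x * (- z) 0 i = - \sum_i df i x * z 0 i.
  by rewrite -sumrN; apply: eq_bigr => i _; rewrite mxE mulrN.
have e2 : quad (fun j i => ddf j i x) (- z) = quad (fun j i => ddf j i x) z.
  by apply: eq_bigr => i _; apply: eq_bigr => j _; rewrite !mxE; ring.
rewrite e e2 in h2; set S := \sum_i _ in h1 h2; set Q := quad _ _ in h1 h2 *.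
have -> : f (x + z) + f (x - z) - 2 * f x - Q
  = (f (x + z) - f x - S - 2^-1 * Q) + (f (x - z) - f x - - S - 2^-1 * Q) by field.
apply: le_trans (ler_normD _ _) _; lra.
Qed.

(* The steps [a], [a'] move while the base point is fixed: this is what makes
   the dependence of the scheme on the discrete gradient Lipschitz. *)
Lemma tay_sdiff_move f df b x a a' : tay f df b ->
  (forall i x z, `|df i (x + z) - df i x| <= b * nm z) ->
  `|(f (x + a') + f (x - a')) - (f (x + a) + f (x - a))|
    <= 2 * b * (nm a + nm (a' - a)) * nm (a' - a).
Proof.
move=> fb dfb; set d := a' - a.
have h1 := fb (x + a) d; have h2 := fb (x - a) (- d).
rewrite nmN in h2.
have e1 : x + a + d = x + a' by rewrite -addrA /d subrKC.
have e2 : x - a - d = x - a' by rewrite /d -addrA -opprD subrKC.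
rewrite e1 in h1; rewrite e2 in h2.
have -> : f (x + a') + f (x - a') - (f (x + a) + f (x - a)) =
  (f (x + a') - f (x + a) - \sum_i df i (x + a) * d 0 i) +
  (f (x - a') - f (x - a) - \sum_i df i (x - a) * (- d) 0 i) +
  \sum_i (df i (x + a) - df i (x - a)) * d 0 i.
  have -> : \sum_i (df i (x + a) - df i (x - a)) * d 0 i =
    \sum_i df i (x + a) * d 0 i + \sum_i df i (x - a) * (- d) 0 i.
    by rewrite -big_split; apply: eq_bigr => i _ /=; rewrite !mxE; ring.
  ring.
have h3 i : `|df i (x + a) - df i (x - a)| <= b * (2 * nm a).
  have := dfb i (x - a) (a + a).
  have -> : x - a + (a + a) = x + a by rewrite addrA subrK.
  by rewrite -mulr2n -scaler_nat nmZ normr_nat.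
have h4 := @ler_sum_nm (fun i => df i (x + a) - df i (x - a)) _ d h3.
apply: le_trans (ler_normD _ _) _.
have := ler_normD (f (x + a') - f (x + a) - \sum_i df i (x + a) * d 0 i)
  (f (x - a') - f (x - a) - \sum_i df i (x - a) * (- d) 0 i).
nra.
Qed.

Lemma sum_delta (a : 'I_n -> R) j t :
  \sum_k a k * (t *: delta_mx 0 j : V) 0 k = t * a j.
Proof.
rewrite (bigD1 j) //= big1 => [|k kj]; first by rewrite !mxE !eqxx mulr1 addr0 mulrC.
by rewrite !mxE (negbTE kj) andbF !mulr0.
Qed.

Lemma quad_delta Q j t : quad Q (t *: delta_mx 0 j) = t ^+ 2 * Q j j.
Proof.
rewrite /quad; under eq_bigr => i _ do rewrite -mulr_suml (sum_delta (Q^~ i)).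
by rewrite (sum_delta (fun i => t * Q j i)) mulrA -expr2.
Qed.

Lemma tay_mixed f df (ddf : 'I_n -> 'I_n -> V -> R) C L x i j t : 0 < t ->
  tay f df C -> (forall i, tay (df i) (fun j => ddf j i) L) ->
  (forall i j x z, `|ddf j i (x + z) - ddf j i x| <= L * nm z) ->
  `|f (x + t *: delta_mx 0 i + t *: delta_mx 0 j) - f (x + t *: delta_mx 0 i)
    - f (x + t *: delta_mx 0 j) + f x - t ^+ 2 * ddf i j x| <= 4 * L * t ^+ 3.
Proof.
move=> t0 fC dfL ddfL; set a := t *: delta_mx 0 i; set b := t *: delta_mx 0 j.
have na k : nm (t *: delta_mx 0 k) = t by rewrite nm_delta gtr0_norm.
have := tay2 (x + a) b fC dfL; have := tay2 x b fC dfL.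
rewrite !quad_delta !sum_delta na.
have := dfL j x a; rewrite sum_delta na; have := ddfL j j x a; rewrite na.
set D0 := ddf j j x; set D1 := ddf j j _; set d0 := df j x; set d1 := df j _; set E := ddf i j x.
move=> h1 h2 h3 h4.
have -> : f (x + a + b) - f (x + a) - f (x + b) + f x - t ^+ 2 * E =
  (f (x + a + b) - f (x + a) - t * d1 - 2^-1 * (t ^+ 2 * D1))
  - (f (x + b) - f x - t * d0 - 2^-1 * (t ^+ 2 * D0))
  + t * (d1 - d0 - t * E) + 2^-1 * t ^+ 2 * (D1 - D0) by field.
have h5 : `|t * (d1 - d0 - t * E)| <= L * t ^+ 3.
  by rewrite normrM (gtr0_norm t0) exprS mulrCA ler_pM2l.
have h6 : `|2^-1 * t ^+ 2 * (D1 - D0)| <= L * t ^+ 3.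
  have a0 : 0 <= 2^-1 * t ^+ 2 :> R by apply: mulr_ge0; [rewrite invr_ge0|exact: sqr_ge0].
  rewrite normrM (ger0_norm a0).
  have L0 := le_trans (normr_ge0 _) h1.
  have : 0 <= t ^+ 2 by exact: sqr_ge0.
  have -> : L * t ^+ 3 = t ^+ 2 * (L * t) by ring.
  nra.
apply: le_trans (ler_normD _ _) _; apply: (le_trans (lerD (ler_normD _ _) (lexx _))).
apply: (le_trans (lerD (lerD (ler_normB _ _) (lexx _)) (lexx _))); lra.
Qed.

(** Schwarz's theorem: the mixed second difference is symmetric in [i] and [j], and it equals [t^2]
    times either mixed derivative up to [O(t^3)]. *)
Lemma tay_sym f df (ddf : 'I_n -> 'I_n -> V -> R) C L x i j : tay f df C ->
  (forall i, tay (df i) (fun j => ddf j i) L) ->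
  (forall i j x z, `|ddf j i (x + z) - ddf j i x| <= L * nm z) ->
  ddf i j x = ddf j i x.
Proof.
move=> fC dfL ddfL; apply/eqP; rewrite -subr_eq0 -normr_eq0 eq_le normr_ge0 andbT.
rewrite leNgt; apply/negP => lt; set d := `|_| in lt.
have L0 : 0 <= L.
  by have := le_trans (normr_ge0 _) (ddfL i j x (delta_mx 0 i)); rewrite -[delta_mx _ _]scale1r nm_delta normr1 mulr1.
have [t [t0 ht]] : exists t, 0 < t /\ 8 * L * t < d.
  exists (d / (8 * L + 1)); split; first by rewrite divr_gt0 //; lra.
  by rewrite mulrA ltr_pdivrMr; [nra|lra].
have h1 := tay_mixed x i j t0 fC dfL ddfL; have h2 := tay_mixed x j i t0 fC dfL ddfL.
have e : x + t *: delta_mx 0 i + t *: delta_mx 0 j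
   = x + t *: delta_mx 0 j + t *: delta_mx 0 i :> V by rewrite addrAC.
rewrite e in h1; set A := f _ in h1; set B := f (x + t *: delta_mx 0 i) in h1.
set D := f (x + t *: delta_mx 0 j) in h1.
have : t ^+ 2 * d <= 8 * L * t ^+ 3.
  rewrite /d -[t ^+ 2]ger0_norm ?sqr_ge0 // -normrM.
  have -> : t ^+ 2 * (ddf i j x - ddf j i x) =
    (f (x + t *: delta_mx 0 j + t *: delta_mx 0 i) - D - B + f x - t ^+ 2 * ddf j i x)
    - (A - B - D + f x - t ^+ 2 * ddf i j x) by rewrite /A; ring.
  apply: (le_trans (ler_normB _ _)); rewrite /A in h1 *; lra.
have -> : 8 * L * t ^+ 3 = t ^+ 2 * (8 * L * t) by ring.
by rewrite ler_pM2l ?exprn_gt0 // leNgt ht.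
Qed.

End calculus.

(** * An algebra of bounded functions with a uniform first order expansion *)

Section good_functions.
Context {R : realType} {n : nat}.
Notation V := 'rV[R]_n.
Implicit Types (x y z : V) (f g : V -> R) (df dg : 'I_n -> V -> R).

Definition good f df :=
  [/\ exists b, bdd f b, exists b, forall i, bdd (df i) b & exists C, tay f df C].

Lemma bdd_ge0 f b : bdd f b -> 0 <= b.
Proof. by move=> fb; apply: le_trans (fb 0). Qed.

Lemma bdd_le f b b' : b <= b' -> bdd f b -> bdd f b'.
Proof. by move=> bb fb x; apply: le_trans (fb x) bb. Qed.

Lemma bdd_norm f b : bdd f b -> bdd f `|b|.
Proof. by move=> fb x; apply: le_trans (fb x) (ler_norm _). Qed.

Lemma bdd_fin (I : finType) (F : I -> V -> R) :
  (forall i, exists b, bdd (F i) b) -> exists b, forall i, bdd (F i) b.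
Proof.
move=> /choice[b Hb]; exists (\sum_i `|b i|) => i; apply: bdd_le (Hb i).
rewrite (bigD1 i) //= -[X in X <= _]addr0 lerD ?ler_norm //.
exact: sumr_ge0.
Qed.

Lemma tay_ge f df C C' : C <= C' -> tay f df C -> tay f df C'.
Proof.
by move=> CC fC x z; apply: le_trans (fC x z) _; rewrite ler_wpM2r ?sqr_ge0.
Qed.

Lemma tay_pos f df C : tay f df C -> exists2 C', 0 <= C' & tay f df C'.
Proof. by move=> fC; exists `|C| => //; apply: tay_ge fC; exact: ler_norm. Qed.

Lemma tay_ext f df dg C : (forall i x, df i x = dg i x) -> tay f df C -> tay f dg C.
Proof.
move=> e fC x z; rewrite (_ : \sum_i _ = \sum_i df i x * z 0 i) //.
by apply: eq_bigr => i _; rewrite e.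
Qed.

Lemma good_ext f df dg : (forall i x, df i x = dg i x) -> good f df -> good f dg.
Proof.
move=> e [fb [b dfb] [C fC]]; split=> //; last by exists C; exact: tay_ext fC.
by exists b => i x; rewrite -e; exact: dfb.
Qed.

Lemma good_extl f g df : f =1 g -> good f df -> good g df.
Proof. by move=> /funext ->. Qed.

Lemma good_lip f df : good f df ->
  exists2 L, 0 <= L & forall x z, `|f (x + z) - f x| <= L * nm z.
Proof.
case=> _ [b dfb] [C fC]; exists `|b| => // x z; apply: (tay_lip _ _ fC) => i.
exact: bdd_norm.
Qed.

Lemma tayD f df g dg C D : tay f df C -> tay g dg D ->
  tay (fun x => f x + g x) (fun i x => df i x + dg i x) (C + D).
Proof.
move=> fC gD x z; under eq_bigr do rewrite mulrDl.
rewrite big_split /= mulrDl; apply: le_trans (lerD (fC x z) (gD x z)).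
apply: le_trans (ler_normD _ _); rewrite le_eqVlt; apply/orP; left; apply/eqP.
by congr (`|_|); ring.
Qed.

Lemma tayZ a f df C : tay f df C ->
  tay (fun x => a * f x) (fun i x => a * df i x) (`|a| * C).
Proof.
move=> fC x z; under eq_bigr do rewrite -mulrA.
rewrite -mulr_sumr -!mulrBr normrM -[_ * C * _]mulrA.
by apply: ler_wpM2l => //; exact: fC.
Qed.

Lemma tay_shift f df C (a : V) : tay f df C ->
  tay (fun x => f (x + a)) (fun i x => df i (x + a)) C.
Proof. by move=> fC x z; rewrite (addrAC x z a); exact: fC. Qed.

Lemma bddD f g b b' : bdd f b -> bdd g b' -> bdd (fun x => f x + g x) (b + b').
Proof. by move=> fb gb x; apply: le_trans (ler_normD _ _) (lerD (fb x) (gb x)). Qed.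

Lemma bddM f g b b' : bdd f b -> bdd g b' -> bdd (fun x => f x * g x) (b * b').
Proof. by move=> fb gb x; rewrite normrM ler_pM. Qed.

Lemma good_cst (a : R) : good (fun=> a) (fun _ _ => 0).
Proof.
split; [by exists `|a| | by exists 0 => i x; rewrite normr0|].
exists 0 => x z; rewrite subrr sub0r big1 => [|i _]; last by rewrite mul0r.
by rewrite oppr0 normr0 mul0r.
Qed.

Lemma goodD f df g dg : good f df -> good g dg ->
  good (fun x => f x + g x) (fun i x => df i x + dg i x).
Proof.
move=> [[b1 f1] [b2 f2] [C fC]] [[b3 g1] [b4 g2] [D gD]]; split.
- by exists (b1 + b3); exact: bddD.
- by exists (b2 + b4) => i; exact: bddD.
- by exists (C + D); exact: tayD.
Qed.

Lemma goodZ a f df : good f df -> good (fun x => a * f x) (fun i x => a * df i x).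
Proof.
move=> [[b1 f1] [b2 f2] [C fC]]; split.
- exists (`|a| * b1); apply: (@bddM (fun=> a)) => // x.
- exists (`|a| * b2) => i; apply: (@bddM (fun=> a)) => // x.
- by exists (`|a| * C); exact: tayZ.
Qed.

Lemma good_sum (I : Type) (r : seq I) (F : I -> V -> R) (dF : I -> 'I_n -> V -> R) :
  (forall i, good (F i) (dF i)) ->
  good (fun x => \sum_(i <- r) F i x) (fun k x => \sum_(i <- r) dF i k x).
Proof.
move=> H; elim: r => [|a r IH].
  apply: good_extl (_ : (fun=> 0) =1 _) _ => [x|]; first by rewrite big_nil.
  by apply: good_ext (good_cst 0) => i x; rewrite big_nil.
apply: good_extl (_ : (fun x => F a x + \sum_(i <- r) F i x) =1 _) _ => [x|].
  by rewrite big_cons.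
by apply: good_ext (goodD (H a) IH) => i x; rewrite big_cons.
Qed.

Lemma goodM f df g dg : good f df -> good g dg ->
  good (fun x => f x * g x) (fun i x => df i x * g x + f x * dg i x).
Proof.
move=> gf gg; have [L1 L10 lf] := good_lip gf; have [L2 L20 lg] := good_lip gg.
case: gf gg => [[b1 f1] [b2 f2] [C fC]] [[b3 g1] [b4 g2] [D gD]]; split.
- by exists (b1 * b3); exact: bddM.
- by exists (b2 * b3 + b1 * b4) => i; apply: bddD; apply: bddM.
exists (C * b3 + b1 * D + L1 * L2) => x z.
have -> : \sum_i (df i x * g x + f x * dg i x) * z 0 i =
  (\sum_i df i x * z 0 i) * g x + f x * \sum_i dg i x * z 0 i.
  by rewrite mulr_suml mulr_sumr -big_split; apply: eq_bigr => i _ /=; ring.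
set S := \sum_i _; set T := \sum_i _.
have -> : f (x + z) * g (x + z) - f x * g x - (S * g x + f x * T) =
  (f (x + z) - f x - S) * g x + f x * (g (x + z) - g x - T)
  + (f (x + z) - f x) * (g (x + z) - g x) by ring.
have h1 : `|(f (x + z) - f x - S) * g x| <= C * nm z ^+ 2 * b3.
  by rewrite normrM ler_pM.
have h2 : `|f x * (g (x + z) - g x - T)| <= b1 * (D * nm z ^+ 2).
  by rewrite normrM ler_pM.
have h3 : `|(f (x + z) - f x) * (g (x + z) - g x)| <= (L1 * nm z) * (L2 * nm z).
  by rewrite normrM ler_pM.
apply: le_trans (ler_normD _ _) _; apply: (le_trans (lerD (ler_normD _ _) (lexx _))).
apply: (le_trans (lerD (lerD h1 h2) h3)); rewrite le_eqVlt; apply/orP; left; apply/eqP; ring.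
Qed.

(** [P] describes a range of values on which [F] has a quadratic remainder. It serves for the square
    root and the inverse on [[1, +oo)], where their derivatives are bounded. *)
Lemma good_comp (F dF : R -> R) (P : R -> Prop) K b f df :
  good f df -> (forall x, P (f x)) ->
  (forall s, P s -> `|dF s| <= b) ->
  (exists b', forall s, P s -> (exists x, s = f x) -> `|F s| <= b') ->
  0 <= K ->
  (forall s t, P s -> P t -> `|F t - F s - dF s * (t - s)| <= K * (t - s) ^+ 2) ->
  good (fun x => F (f x)) (fun i x => dF (f x) * df i x).
Proof.
move=> gf Pf dFb [b' Fb] K0 FK; have [L L0 lf] := good_lip gf.
case: gf => _ [b2 f2] [C fC].
split.
- by exists b' => x; apply: Fb => //; exists x.
- by exists (b * b2) => i; apply: (@bddM (fun x => dF (f x))) => // x; apply: dFb.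
exists (K * L ^+ 2 + b * C) => x z.
under eq_bigr do rewrite -mulrA.
rewrite -mulr_sumr; set S := \sum_i _.
have -> : F (f (x + z)) - F (f x) - dF (f x) * S =
  (F (f (x + z)) - F (f x) - dF (f x) * (f (x + z) - f x))
  + dF (f x) * (f (x + z) - f x - S) by ring.
have h1 := FK _ _ (Pf x) (Pf (x + z)).
have h2 : `|dF (f x) * (f (x + z) - f x - S)| <= b * (C * nm z ^+ 2).
  by rewrite normrM ler_pM // dFb.
have h3 : (f (x + z) - f x) ^+ 2 <= (L * nm z) ^+ 2.
  by rewrite -[X in X <= _]real_normK ?num_real // lerXn2r ?nnegrE // mulr_ge0 ?nm_ge0.
apply: le_trans (ler_normD _ _) _; apply: (le_trans (lerD h1 h2)).
have := ler_wpM2l K0 h3; rewrite exprMn; lra.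
Qed.

(** Chain rule for evaluation at a point displaced by a field: this is where the scheme meets
    directions that vary with [x]. Only the gradient of [f] is taken bounded, so the lemma applies
    to [u] itself, which grows linearly. *)
Lemma good_move f df (w : 'I_n -> V -> R) (dw : 'I_n -> 'I_n -> V -> R) (h : R) C b :
  tay f df C -> (forall i, bdd (df i) b) -> (forall l, good (w l) (dw l)) ->
  exists D, tay (fun x => f (x + h *: \row_l w l x))
    (fun k x => df k (x + h *: \row_l w l x)
        + h * \sum_l dw l k x * df l (x + h *: \row_l w l x)) D.
Proof.
move=> /tay_pos[{}C C0 fC] dfb gw.
have [L Lw] : exists L, forall l x z, `|w l (x + z) - w l x| <= L * nm z.
  have /choice[L HL] : forall l, exists L, forall x z, `|w l (x + z) - w l x| <= L * nm z.
    by move=> l; have [L _ HL] := good_lip (gw l); exists L.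
  exists (\sum_l `|L l|) => l x z; apply: le_trans (HL l x z) _.
  rewrite ler_wpM2r ?nm_ge0 // (bigD1 l) //= -[X in X <= _]addr0 lerD ?ler_norm //.
  exact: sumr_ge0.
have [E wE] : exists E, forall l, tay (w l) (dw l) E.
  have /choice[E HE] : forall l, exists E, tay (w l) (dw l) E by move=> l; case: (gw l).
  exists (\sum_l `|E l|) => l; apply: tay_ge (HE l).
  rewrite (bigD1 l) //= -[X in X <= _]addr0 lerD ?ler_norm //; exact: sumr_ge0.
exists (C * (1 + `|h| * (n%:R * L)) ^+ 2 + `|h| * (n%:R * (b * E))) => x z.
set Y := x + z + h *: \row_l w l (x + z); set X := x + h *: \row_l w l x.
pose d : V := Y - X.
have -> : Y = X + d by rewrite /d subrKC.
have dE i : d 0 i = z 0 i + h * (w i (x + z) - w i x).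
  by rewrite /d /Y /X !mxE; ring.
have nd : nm d <= (1 + `|h| * (n%:R * L)) * nm z.
  have -> : (1 + `|h| * (n%:R * L)) * nm z = \sum_i (`|z 0 i| + `|h| * (L * nm z)).
    by rewrite big_split /= sumr_const card_ord -[_ *+ n]mulr_natr -/(nm z); ring.
  apply: ler_sum => i _; rewrite dE; apply: le_trans (ler_normD _ _) _.
  by rewrite lerD2l normrM ler_wpM2l.
have h1 := fC X d; set S := \sum_i df i X * d 0 i in h1.
set T := \sum_i (_ + _) * _.
have -> : f (X + d) - f X - T = (f (X + d) - f X - S) + (S - T) by ring.
have -> : S - T = h * \sum_l df l X * (w l (x + z) - w l x - \sum_k dw l k x * z 0 k).
  have -> : S = \sum_i df i X * z 0 i + h * \sum_l df l X * (w l (x + z) - w l x).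
    rewrite /S mulr_sumr -big_split; apply: eq_bigr => i _ /=; rewrite dE; ring.
  have -> : T = \sum_i df i X * z 0 i + h * \sum_l df l X * \sum_k dw l k x * z 0 k.
    rewrite /T; under eq_bigr do rewrite mulrDl.
    rewrite big_split /=; congr (_ + _).
    under eq_bigr do rewrite -mulrA mulr_suml.
    rewrite -mulr_sumr exchange_big; congr (_ * _); apply: eq_bigr => l _ /=.
    by rewrite mulr_sumr; apply: eq_bigr => k _; ring.
  under [X in _ = h * X]eq_bigr do rewrite mulrBr.
  by rewrite sumrB; ring.
apply: le_trans (ler_normD _ _) _; rewrite mulrDl; apply: lerD.
  apply: le_trans h1 _; rewrite -mulrA ler_wpM2l // -exprMn lerXn2r ?nnegrE ?nm_ge0 //.
  by apply: le_trans nd; exact: nm_ge0.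
rewrite normrM -mulrA ler_wpM2l //; apply: le_trans (ler_norm_sum _ _ _) _.
apply: (@le_trans _ _ (\sum_(l < n) b * (E * nm z ^+ 2))).
  by apply: ler_sum => l _; rewrite normrM ler_pM // ?dfb // wE.
by rewrite sumr_const card_ord -[X in X <= _]mulr_natl; rewrite !mulrA.
Qed.

End good_functions.

(** * The explicit scheme and its derivatives *)

(* Each derivative of the discrete operator is encoded as an expression in the
   values and first differences of the derivatives of [u] at the points
   [x +- h zeta_s(x)]; [Ed1 s J] stands for a first difference of [d_J u] and
   [Ept b s J] for a value. *)
Inductive expr (T : Type) (n : nat) :=
| Ec of T
| Ev
| Evi
| Ed1 of ('I_n + 'I_n * 'I_n)%type & seq 'I_n
| Ept of bool & ('I_n + 'I_n * 'I_n)%type & seq 'I_n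
| Eadd of expr T n & expr T n
| Emul of expr T n & expr T n.
Arguments Ec {T n}.
Arguments Ev {T n}.
Arguments Evi {T n}.
Arguments Ed1 {T n}.
Arguments Ept {T n}.

Section scheme.
Context {R : realType} {n : nat}.
Notation V := 'rV[R]_n.
Notation St := ('I_n + 'I_n * 'I_n)%type.
Notation expr := (expr R n).
Notation jets := (seq 'I_n -> V -> R).
Implicit Types (x y z : V) (f g : V -> R) (s : St) (J : seq 'I_n) (U : jets) (h : R).

(* For [p = Du], the directions [e_i] and [(p_i e_j - p_j e_i) / sqrt 2] satisfy
   [sum_s zeta_s zeta_s^T = (1 + |p|^2) I - p p^T]. *)
Definition dirA s (l : 'I_n) : R := if s is inl i then (l == i)%:R else 0.
Definition dirB s (l m : 'I_n) : R :=
  if s is inr (i, j) then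
    (Num.sqrt 2)^-1 * ((l == j)%:R * (m == i)%:R - (l == i)%:R * (m == j)%:R)
  else 0.
Definition dir s (p : 'I_n -> R) : V := \row_l (dirA s l + \sum_m dirB s l m * p m).

Lemma dir_inl i p : dir (inl i) p = delta_mx 0 i.
Proof.
apply/rowP => l; rewrite !mxE /= big1 => [|m _]; last by rewrite mul0r.
by rewrite addr0.
Qed.

Definition cdiff f h (i : 'I_n) x : R :=
  (2 * h)^-1 * (f (x + h *: delta_mx 0 i) - f (x - h *: delta_mx 0 i)).
Definition dgr f h x : 'I_n -> R := fun i => cdiff f h i x.
Definition zeta f h s x : V := dir s (dgr f h x).
Definition vel (p : 'I_n -> R) : R := Num.sqrt (1 + \sum_i p i ^+ 2).

Fixpoint eval U h (e : expr) x : R :=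
  match e with
  | Ec a => a
  | Ev => vel (dgr (U [::]) h x)
  | Evi => (vel (dgr (U [::]) h x))^-1
  | Ed1 s J => h^-1 * (U J (x + h *: zeta (U [::]) h s x) - U J (x - h *: zeta (U [::]) h s x))
  | Ept b s J => U J (x + (if b then h else - h) *: zeta (U [::]) h s x)
  | Eadd a b => eval U h a x + eval U h b x
  | Emul a b => eval U h a x * eval U h b x
  end.

Definition Esum (I : finType) (f : I -> expr) : expr :=
  foldr (fun l a => Eadd (f l) a) (Ec 0) (enum I).
Definition Edp i (J : seq 'I_n) : expr := Emul (Ec 2^-1) (Ed1 (inl i) J).
(** [h] times the central difference, written with values so that no [h] appears: the constants of
    an expression must not depend on the mesh. With [J = [:: k]] these values have weight zero,
    which keeps the weight count of [ded] sharp. *)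
Definition Ehp i (J : seq 'I_n) : expr :=
  Emul (Ec 2^-1) (Eadd (Ept true (inl i) J) (Emul (Ec (-1)) (Ept false (inl i) J))).
Definition Edz k s l : expr := Esum (fun m => Emul (Ec (dirB s l m)) (Edp m [:: k])).
Definition Ehdz k s l : expr := Esum (fun m => Emul (Ec (dirB s l m)) (Ehp m [:: k])).
Definition Edv k : expr := Emul Evi (Esum (fun m => Emul (Edp m [::]) (Edp m [:: k]))).

(** The exact derivative in [x_k] of the function denoted by an expression; a displaced value also
    contributes the derivative of the displacement. In the case of [Ed1] the factor [h] of the
    displacement cancels the quotient, which leaves a sum of two values. *)
Fixpoint ded (k : 'I_n) (e : expr) : expr :=
  match e with
  | Ec a => Ec 0
  | Ev => Edv k
  | Evi => Emul (Ec (-1)) (Emul (Emul Evi Evi) (Edv k))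
  | Ed1 s J => Eadd (Ed1 s (k :: J))
      (Esum (fun l => Emul (Edz k s l) (Eadd (Ept true s (l :: J)) (Ept false s (l :: J)))))
  | Ept b s J => Eadd (Ept b s (k :: J))
      (Esum (fun l => Emul (Emul (Ec (if b then 1 else -1)) (Ehdz k s l)) (Ept b s (l :: J))))
  | Eadd a b => Eadd (ded k a) (ded k b)
  | Emul a b => Eadd (Emul (ded k a) b) (Emul a (ded k b))
  end.

(** Excludes the values of [u] itself, which may be unbounded. *)
Fixpoint okE (e : expr) : bool :=
  match e with
  | Ept _ _ J => J != [::]
  | Eadd a b | Emul a b => okE a && okE b
  | _ => true
  end.

Lemma eval_Esum (I : finType) U h (F : I -> expr) x : eval U h (Esum F) x = \sum_l eval U h (F l) x.
Proof.
rewrite -[RHS]big_enum /= /Esum; elim: (enum I) => [|a r IH] /=; first by rewrite big_nil.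
by rewrite big_cons IH.
Qed.

Lemma eval_mul U h a b x : eval U h (Emul a b) x = eval U h a x * eval U h b x.
Proof. by []. Qed.

Lemma eval_add U h a b x : eval U h (Eadd a b) x = eval U h a x + eval U h b x.
Proof. by []. Qed.

Lemma okE_Esum (I : finType) (F : I -> expr) : (forall l, okE (F l)) -> okE (Esum F).
Proof. by move=> FP; rewrite /Esum; elim: (enum I) => //= a r ->; rewrite FP. Qed.

Lemma okE_ded k e : okE e -> okE (ded k e).
Proof.
elim: e => //= [||s J|b s J|a ha b hb /andP[oa ob]|a ha b hb /andP[oa ob]].
- by move=> _; apply: okE_Esum.
- by move=> _; apply: okE_Esum.
- by move=> _; apply: okE_Esum => l /=; rewrite andbT; exact: okE_Esum.
- by move=> _; apply: okE_Esum => l /=; rewrite andbT; exact: okE_Esum.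
- by rewrite ha ?hb.
- by rewrite ha ?hb ?oa ?ob.
Qed.

(** [U J] stands for the derivative of [U [::]] along the word [J]. The constants are merely
    asserted to exist, which every step preserves for trivial reasons; the uniform bounds are a
    separate matter, recorded by [ordb]. *)
Definition isjet U :=
  (forall J, J != [::] -> exists b, bdd (U J) b) /\
  (forall J, exists C, tay (U J) (fun i => U (i :: J)) C).

Lemma jet_dbdd U J : isjet U -> exists b, forall i, bdd (U (i :: J)) b.
Proof. by move=> [jb _]; apply: bdd_fin => i; exact: jb. Qed.

Lemma eval_Edp U h i J x : h != 0 -> eval U h (Edp i J) x = cdiff (U J) h i x.
Proof.
move=> h0; rewrite /= /zeta dir_inl /cdiff invfM; ring.
Qed.

Lemma eval_Ehp U h i J x : h != 0 -> eval U h (Ehp i J) x = h * cdiff (U J) h i x.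
Proof.
move=> h0; rewrite /= /zeta dir_inl /cdiff scaleNr; by field.
Qed.

Lemma good_cdiff U h i J : isjet U -> h != 0 ->
  good (cdiff (U J) h i) (fun k => cdiff (U (k :: J)) h i).
Proof.
move=> ju h0; set a := h *: (delta_mx 0 i : V).
have [b Hb] := jet_dbdd J ju; have [C HC] := ju.2 J.
have t : tay (cdiff (U J) h i) (fun k => cdiff (U (k :: J)) h i)
   (`|(2 * h)^-1| * (C + `|-1| * C)).
  have e J' : cdiff (U J') h i = fun x => (2 * h)^-1 * (U J' (x + a) + -1 * U J' (x + - a)).
    by apply/funext => x; rewrite /cdiff mulN1r.
  rewrite e; under [X in tay _ X]eq_fun do rewrite e.
  exact: tayZ _ (tayD (tay_shift a HC) (tayZ (-1) (tay_shift (- a) HC))).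
have bd J' c : bdd (U J') c -> bdd (cdiff (U J') h i) (`|(2 * h)^-1| * (c + c)).
  move=> Uc x; rewrite normrM ler_wpM2l //; apply: (le_trans (ler_normB _ _)).
  by apply: lerD; exact: Uc.
split; last by eexists; exact: t.
  exists (`|(2 * h)^-1| * (b * nm (a + a))) => x; rewrite normrM ler_wpM2l //.
  have -> : x + h *: delta_mx 0 i = (x - a) + (a + a) by rewrite addrA subrK.
  exact: tay_lip HC Hb.
by exists (`|(2 * h)^-1| * (b + b)) => k; exact: bd.
Qed.

Lemma vel_ge1 p : 1 <= vel p.
Proof.
rewrite -[X in X <= _]sqrtr1 ler_sqrt ?addr_ge0 ?ler01 //.
  by rewrite lerDl sumr_ge0 // => i _; exact: sqr_ge0.
by apply: sumr_ge0 => i _; exact: sqr_ge0.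
Qed.

Lemma vel_gt0 p : 0 < vel p.
Proof. exact: lt_le_trans ltr01 (vel_ge1 p). Qed.

Lemma sqr_vel p : vel p ^+ 2 = 1 + \sum_i p i ^+ 2.
Proof.
rewrite sqr_sqrtr // addr_ge0 ?ler01 //; by apply: sumr_ge0 => i _; exact: sqr_ge0.
Qed.

Lemma eval_Edv U h k x : h != 0 -> eval U h (ded k Ev) x =
  (vel (dgr (U [::]) h x))^-1 * \sum_m cdiff (U [::]) h m x * cdiff (U [:: k]) h m x.
Proof.
move=> h0; rewrite eval_mul eval_Esum; congr (_ * _).
by apply: eq_bigr => m _; rewrite eval_mul !eval_Edp.
Qed.

Lemma good_Ev U h : isjet U -> h != 0 ->
  good (eval U h Ev) (fun k => eval U h (ded k Ev)).
Proof.
move=> ju h0; pose q x := 1 + \sum_i dgr (U [::]) h x i ^+ 2.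
have gq : good q (fun k x => 0 + \sum_i (cdiff (U [:: k]) h i x * cdiff (U [::]) h i x
     + cdiff (U [::]) h i x * cdiff (U [:: k]) h i x)).
  apply: goodD (good_cst 1) _; apply: good_extl (good_sum _ (fun i => goodM (good_cdiff i [::] ju h0) (good_cdiff i [::] ju h0))) => x.
  by [].
have q1 x : 1 <= q x.
  by rewrite /q lerDl sumr_ge0 // => i _; exact: sqr_ge0.
have [[bq Hq] _ _] := gq.
have H := @good_comp _ _ Num.sqrt (fun t => (2 * Num.sqrt t)^-1) (fun t => 1 <= t) 1 1 q _ gq q1.
have s1 (s : R) : 1 <= s -> 1 <= Num.sqrt s.
  by move=> s1; rewrite -[X in X <= _]sqrtr1 ler_sqrt // ; lra.
apply: good_ext; last first.
  apply: H => //.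
  - move=> s /s1 ss; rewrite ger0_norm ?invr_ge0 ?invf_le1; [lra|lra|].
    by apply: mulr_ge0 => //; lra.
  - exists (bq + 1) => s _ [x ->]; rewrite ger0_norm ?sqrtr_ge0 //.
    have := Hq x; rewrite ger0_norm; last by have := q1 x; lra.
    have := s1 _ (q1 x); have := sqr_sqrtr (le_trans ler01 (q1 x)); nra.
  - move=> s t ss tt; have s0 := s1 _ ss; have t0 := s1 _ tt.
    have := sqr_sqrtr (le_trans ler01 ss); have := sqr_sqrtr (le_trans ler01 tt).
    set a := Num.sqrt s in s0 *; set b := Num.sqrt t in t0 * => <- <-.
    have a0 : a != 0 by apply: lt0r_neq0; lra.
    have -> : b - a - (2 * a)^-1 * (b ^+ 2 - a ^+ 2) = - ((2 * a)^-1 * (b - a) ^+ 2).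
      by field.
    rewrite normrN normrM ger0_norm ?invr_ge0 ?mulr_ge0 //; last by lra.
    rewrite [`|_ ^+ 2|]ger0_norm ?sqr_ge0 //.
    have i1 : (2 * a)^-1 <= 1 by rewrite invf_le1; lra.
    have -> : b ^+ 2 - a ^+ 2 = (b - a) * (b + a) by ring.
    have j1 : 1 <= (b + a) ^+ 2 by nra.
    rewrite exprMn mul1r [X in _ <= X]mulrC ler_wpM2r ?sqr_ge0 //; lra.
move=> k x; rewrite eval_Edv // add0r -/(q x) /vel -/(q x).
under eq_bigr do rewrite (mulrC (cdiff (U [:: k]) h _ x)) -mulr2n -mulr_natl.
by rewrite -mulr_sumr invfM mulrCA mulrA mulrA mulfV ?mul1r.
Qed.

Lemma good_Evi U h : isjet U -> h != 0 ->
  good (eval U h Evi) (fun k => eval U h (ded k Evi)).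
Proof.
move=> ju h0; have gv := good_Ev ju h0.
have H := @good_comp _ _ (fun t : R => t^-1) (fun t => - (t * t)^-1) (fun t => 1 <= t) 1 1
   _ _ gv (fun x => vel_ge1 _).
apply: good_ext; last first.
  apply: H => //.
  - move=> s s1; rewrite normrN ger0_norm ?invr_ge0 ?invf_le1; nra.
  - exists 1 => s s1 _; rewrite ger0_norm ?invr_ge0 ?invf_le1; lra.
  - move=> s t s1 t1; have s0 : s != 0 by apply: lt0r_neq0; lra.
    have t0 : t != 0 by apply: lt0r_neq0; lra.
    have -> : t^-1 - s^-1 - - (s * s)^-1 * (t - s) = (t * s ^+ 2)^-1 * (t - s) ^+ 2.
      by field; rewrite s0 t0.
    have p0 : 1 <= t * s ^+ 2 by nra.
    rewrite normrM [`|_ ^+ 2|]ger0_norm ?sqr_ge0 // ler_wpM2r ?sqr_ge0 //.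
    rewrite ger0_norm ?invr_ge0 ?invf_le1; lra.
move=> k x; rewrite [ded k Evi]/= eval_mul eval_mul -/(ded k Ev) eval_mul.
rewrite [eval U h (Ec _) x]/= [eval U h Evi x]/= [eval U h Ev x]/= invfM; ring.
Qed.

Lemma good_zeta U h s l : isjet U -> h != 0 ->
  good (fun x => zeta (U [::]) h s x 0 l) (fun k => eval U h (Edz k s l)).
Proof.
move=> ju h0.
apply: good_extl (_ : (fun x => dirA s l + \sum_m dirB s l m * cdiff (U [::]) h m x) =1 _) _.
  by move=> x; rewrite /zeta /dir mxE.
apply: good_ext (goodD (good_cst _) (good_sum _ (fun m => goodZ (dirB s l m) (good_cdiff m [::] ju h0)))).
by move=> k x; rewrite add0r eval_Esum; apply: eq_bigr => m _; rewrite eval_mul eval_Edp.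
Qed.

Lemma eval_Ehdz U h k s l x : h != 0 -> eval U h (Ehdz k s l) x = h * eval U h (Edz k s l) x.
Proof.
move=> h0; rewrite !eval_Esum mulr_sumr; apply: eq_bigr => m _.
by rewrite eval_mul eval_Ehp // [in RHS]eval_mul eval_Edp //= mulrCA.
Qed.

Lemma tay_pt U h a s J : isjet U -> h != 0 ->
  exists C, tay (fun x => U J (x + a *: zeta (U [::]) h s x))
   (fun k x => U (k :: J) (x + a *: zeta (U [::]) h s x)
      + a * \sum_l eval U h (Edz k s l) x * U (l :: J) (x + a *: zeta (U [::]) h s x)) C.
Proof.
move=> ju h0; have [b Hb] := jet_dbdd J ju; have [C HC] := ju.2 J.
have [D HD] := good_move a HC Hb (fun l => good_zeta s l ju h0).
exists D; have e x : \row_l zeta (U [::]) h s x 0 l = zeta (U [::]) h s x.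
  by apply/rowP => l; rewrite mxE.
by move=> x z; have := HD x z; rewrite !e.
Qed.

Lemma bdd_pt U h a s J : J != [::] -> isjet U ->
  exists b, bdd (fun x => U J (x + a *: zeta (U [::]) h s x)) b.
Proof. by move=> J0 ju; have [b Hb] := ju.1 J J0; exists b => x; exact: Hb. Qed.

Lemma good_Ept U h b s J : J != [::] -> isjet U -> h != 0 ->
  good (eval U h (Ept b s J)) (fun k => eval U h (ded k (Ept b s J))).
Proof.
move=> J0 ju h0; set a := if b then h else - h.
have [C HC] := tay_pt a s J ju h0.
have e k x : eval U h (ded k (Ept b s J)) x = U (k :: J) (x + a *: zeta (U [::]) h s x)
      + a * \sum_l eval U h (Edz k s l) x * U (l :: J) (x + a *: zeta (U [::]) h s x).
  rewrite [ded _ _]/= eval_add; congr (_ + _); rewrite eval_Esum mulr_sumr.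
  apply: eq_bigr => l _; rewrite !eval_mul eval_Ehdz // /= -/a /a; case: b {a HC} => /=; ring.
split; first exact: bdd_pt.
- apply: bdd_fin => k.
  have [b1 H1] := bdd_pt h a s (isT : k :: J != [::]) ju.
  have /bdd_fin[b2 H2] : forall l, exists b, bdd (eval U h (Edz k s l)) b.
    by move=> l; have [_ [b2 H2] _] := good_zeta s l ju h0; exists b2; exact: H2.
  have /bdd_fin[b3 H3] : forall l, exists b, bdd (fun x => U (l :: J) (x + a *: zeta (U [::]) h s x)) b.
    by move=> l; exact: bdd_pt.
  exists (b1 + `|a| * \sum_(l < n) b2 * b3) => x; rewrite e.
  apply: le_trans (ler_normD _ _) _; apply: lerD; first exact: H1.
  rewrite normrM ler_wpM2l //; apply: le_trans (ler_norm_sum _ _ _) _.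
  by apply: ler_sum => l _; rewrite normrM ler_pM // ?H2 // H3.
- by exists C; apply: tay_ext HC => k x; rewrite e.
Qed.

Lemma bdd_Ed1 U h s J : isjet U -> h != 0 -> exists b, bdd (eval U h (Ed1 s J)) b.
Proof.
move=> ju h0; set Z := zeta (U [::]) h s.
have [b Hb'] := jet_dbdd J ju; have Hb i : bdd (U (i :: J)) `|b| by exact: bdd_norm.
have [c Hc] := ju.2 J.
have [d Hd] : exists d, forall x, nm (Z x) <= d.
  have /bdd_fin[d Hd] : forall l, exists b, bdd (fun x => Z x 0 l) b.
    by move=> l; have [[d Hd] _ _] := good_zeta s l ju h0; exists d.
  exists (\sum_(l < n) d) => x; apply: ler_sum => l _; exact: Hd.
exists (`|h^-1| * (`|b| * (2 * `|h| * d))) => x.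
rewrite /= normrM ler_wpM2l // -/(Z x).
have -> : x + h *: Z x = (x - h *: Z x) + (2 * h) *: Z x.
  by rewrite -addrA -scaleNr -scalerDl; congr (_ + _ *: _); ring.
apply: le_trans (tay_lip _ _ Hc Hb) _; rewrite ler_wpM2l //.
by rewrite nmZ normrM normr_nat ler_wpM2l ?mulr_ge0.
Qed.

Lemma good_Ed1 U h s J : isjet U -> h != 0 ->
  good (eval U h (Ed1 s J)) (fun k => eval U h (ded k (Ed1 s J))).
Proof.
move=> ju h0; have [C HC] := tay_pt h s J ju h0; have [D HD] := tay_pt (- h) s J ju h0.
set Z := zeta (U [::]) h s in HC HD *.
have t : tay (eval U h (Ed1 s J)) (fun k => eval U h (ded k (Ed1 s J)))
    (`|h^-1| * (C + `|-1| * D)).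
  have -> : eval U h (Ed1 s J) = fun x => h^-1 * (U J (x + h *: Z x) + -1 * U J (x + - h *: Z x)).
    by apply/funext => x; rewrite /= mulN1r scaleNr.
  apply: tay_ext (tayZ _ (tayD HC (tayZ (-1) HD))) => k x.
  rewrite [ded _ _]/= eval_add eval_Esum /= -/(Z x) scaleNr.
  under [X in _ = _ + X]eq_bigr do rewrite mulrDr.
  rewrite big_split /=; set S1 := \sum_l _; set S2 := \sum_l _.
  by field.
split; [exact: bdd_Ed1| |by eexists; exact: t].
apply: bdd_fin => k; have [b1 H1] := bdd_Ed1 s (k :: J) ju h0.
have /bdd_fin[b2 H2] : forall l, exists b, bdd (eval U h (Edz k s l)) b.
  by move=> l; have [_ [b2 H2] _] := good_zeta s l ju h0; exists b2; exact: H2.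
have /bdd_fin[b3 H3] : forall l, exists b, bdd (eval U h (Ept true s (l :: J))) b.
  by move=> l; exact: bdd_pt.
have /bdd_fin[b4 H4] : forall l, exists b, bdd (eval U h (Ept false s (l :: J))) b.
  by move=> l; exact: bdd_pt.
exists (b1 + \sum_(l < n) b2 * (b3 + b4)) => x.
rewrite [ded _ _]/= eval_add eval_Esum.
apply: le_trans (ler_normD _ _) _; apply: lerD; first exact: H1.
apply: le_trans (ler_norm_sum _ _ _) _.
apply: ler_sum => l _; rewrite eval_mul eval_add normrM ler_pM // ?H2 //.
by apply: le_trans (ler_normD _ _) _; apply: lerD; [exact: H3|exact: H4].
Qed.

Lemma good_eval U h e : isjet U -> h != 0 -> okE e ->
  good (eval U h e) (fun k => eval U h (ded k e)).
Proof.
move=> ju h0; elim: e => [a|||s J|b s J|a ha b hb /andP[oa ob]|a ha b hb /andP[oa ob]].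
- by move=> _; exact: good_cst.
- by move=> _; exact: good_Ev.
- by move=> _; exact: good_Evi.
- by move=> _; exact: good_Ed1.
- by move=> /= J0; exact: good_Ept.
- by apply: goodD; [exact: ha|exact: hb].
- by apply: goodM; [exact: ha|exact: hb].
Qed.

End scheme.

(** * The step on all derivatives, and the weight of its lower order terms *)

Section step.
Context {R : realType} {n : nat}.
Notation V := 'rV[R]_n.
Notation St := ('I_n + 'I_n * 'I_n)%type.
Notation expr := (expr R n).
Notation jets := (seq 'I_n -> V -> R).
Implicit Types (x y z : V) (f g : V -> R) (s : St) (J : seq 'I_n) (U : jets) (h : R).

Definition sdiff f z x : R := f (x + z) + f (x - z) - 2 * f x.
Definition Mop U h J x : R :=
  h ^- 2 * \sum_s sdiff (U J) (h *: zeta (U [::]) h s x) x.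
(** What is left when [d_k] passes through the second differences: the derivative of the moving
    direction times a first difference of one order more. *)
Definition Ecomm k J : expr :=
  Esum (fun s => Esum (fun l => Emul (Edz k s l) (Ed1 s (l :: J)))).
Definition EH (c c0 : R) : expr := Emul (Emul Ev Ev) (Eadd (Ec c) (Emul (Ec (- c0)) Ev)).
(** The terms of the scheme for [d_J u] other than its own second differences: one more derivative
    differentiates the previous terms and adds a commutator. *)
Fixpoint EF c c0 J : expr :=
  if J is k :: J' then Eadd (ded k (EF c c0 J')) (Ecomm k J') else EH c c0.

Definition rhs c c0 h U J x : R := Mop U h J x + eval U h (EF c c0 J) x.
(** One explicit Euler step, taken simultaneously by all derivatives; by [isjet_next] they remain
    derivatives of one another. *)
Definition next c c0 h (t : R) U : jets := fun J x => U J x + t * rhs c c0 h U J x.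

Lemma okE_EF c c0 J : okE (EF c c0 J).
Proof.
elim: J => //= k J IH; rewrite okE_ded //=; apply: okE_Esum => s; apply: okE_Esum => l /=.
by rewrite andbT; apply: okE_Esum.
Qed.

Lemma tay_sum (I : Type) (r : seq I) (F : I -> V -> R) (dF : I -> 'I_n -> V -> R) :
  (forall i, exists C, tay (F i) (dF i) C) ->
  exists C, tay (fun x => \sum_(i <- r) F i x) (fun k x => \sum_(i <- r) dF i k x) C.
Proof.
move=> H; elim: r => [|a r [C IH]].
  exists 0 => x z; rewrite !big_nil subrr big1 ?subrr ?normr0 ?mul0r // => i _.
  by rewrite big_nil mul0r.
have [D HD] := H a; exists (D + C).
have -> : (fun x => \sum_(i <- a :: r) F i x) = (fun x => F a x + \sum_(i <- r) F i x).
  by apply/funext => x; rewrite big_cons.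
by apply: tay_ext (tayD HD IH) => k x; rewrite big_cons.
Qed.

Lemma tay_Mop U h J : isjet U -> h != 0 ->
  exists C, tay (Mop U h J) (fun k x => Mop U h (k :: J) x + eval U h (Ecomm k J) x) C.
Proof.
move=> ju h0.
have H s : exists C, tay (fun x => sdiff (U J) (h *: zeta (U [::]) h s x) x)
  (fun k x => sdiff (U (k :: J)) (h *: zeta (U [::]) h s x) x
     + h ^+ 2 * \sum_l eval U h (Emul (Edz k s l) (Ed1 s (l :: J))) x) C.
  have [C HC] := tay_pt h s J ju h0; have [D HD] := tay_pt (- h) s J ju h0.
  have [E HE] := ju.2 J.
  exists (C + D + `|-2| * E) => x z.
  have := tayD (tayD HC HD) (tayZ (-2) HE) x z; rewrite /sdiff !mulNr !scaleNr.
  set T := \sum_i _; set T' := \sum_i _; suff -> : T = T' by [].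
  apply: eq_bigr => k _; congr (_ * _).
  have -> : h ^+ 2 * \sum_l eval U h (Emul (Edz k s l) (Ed1 s (l :: J))) x =
    h * (\sum_l eval U h (Edz k s l) x * U (l :: J) (x + h *: zeta (U [::]) h s x))
    - h * (\sum_l eval U h (Edz k s l) x * U (l :: J) (x - h *: zeta (U [::]) h s x)).
    rewrite -mulrBr -sumrB expr2 -mulrA; congr (_ * _); rewrite mulr_sumr.
    by apply: eq_bigr => l _; rewrite eval_mul /=; field.
  rewrite ?mulNr; ring.
have [C HC] := tay_sum (index_enum _) H.
exists (`|h ^- 2| * C); apply: tay_ext (tayZ _ HC) => k x.
rewrite big_split /= mulrDr; congr (_ + _); rewrite -mulr_sumr mulKf ?expf_neq0 //.
by rewrite eval_Esum; apply: eq_bigr => s _; rewrite eval_Esum.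
Qed.

Lemma bdd_sdiff U (Z : V -> V) J b : bdd (U J) b -> bdd (fun x => sdiff (U J) (Z x) x) (4 * b).
Proof.
move=> Ub x; rewrite /sdiff; apply: (le_trans (ler_normB _ _)).
have := ler_normD (U J (x + Z x)) (U J (x - Z x)); rewrite normrM normr_nat.
have := Ub x; have := Ub (x + Z x); have := Ub (x - Z x); lra.
Qed.

Lemma isjet_next c c0 h t U : isjet U -> h != 0 -> isjet (next c c0 h t U).
Proof.
move=> ju h0; split=> J.
- move=> J0; have [b Hb] := ju.1 J J0.
  have [[d Hd] _ _] := good_eval ju h0 (okE_EF c c0 J).
  exists (b + `|t| * (`|h ^- 2| * (\sum_(s : St) 4 * b) + d)) => x.
  apply: le_trans (ler_normD _ _) _; apply: lerD; first exact: Hb.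
  rewrite normrM ler_wpM2l //; apply: le_trans (ler_normD _ _) _; apply: lerD; last exact: Hd.
  rewrite normrM ler_wpM2l //; apply: le_trans (ler_norm_sum _ _ _) _; apply: ler_sum => s _.
  exact: (bdd_sdiff (fun x => h *: zeta (U [::]) h s x) Hb).
have [C HC] := ju.2 J; have [D HD] := tay_Mop J ju h0.
have [_ _ [E HE]] := good_eval ju h0 (okE_EF c c0 J).
exists (C + `|t| * (D + E)); apply: tay_ext (tayD HC (tayZ t (tayD HD HE))) => k x.
by rewrite /next /rhs [EF _ _ (_ :: _)]/= eval_add; ring.
Qed.

(** Counts the derivatives beyond the first in each factor: [Ed1 s J] behaves like a derivative of
    order [size J + 1], and [Ept] like one of order [size J]. As first derivatives are bounded a
    priori, this is the homogeneity that matters. Every term of the scheme for [d_J u] has weight at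
    most [size J + 1]. *)
Fixpoint wt (e : expr) : nat :=
  match e with
  | Ed1 _ J => size J
  | Ept _ _ J => (size J).-1
  | Eadd a b => maxn (wt a) (wt b)
  | Emul a b => (wt a + wt b)%N
  | _ => 0%N
  end.

Fixpoint msz (e : expr) : nat :=
  match e with
  | Ed1 _ J | Ept _ _ J => size J
  | Eadd a b | Emul a b => maxn (msz a) (msz b)
  | _ => 0%N
  end.

Lemma wt_Esum (I : finType) (F : I -> expr) m : (forall i, wt (F i) <= m)%N -> (wt (Esum F) <= m)%N.
Proof. by move=> H; rewrite /Esum; elim: (enum I) => //= a r; rewrite geq_max H. Qed.

Lemma msz_Esum (I : finType) (F : I -> expr) m : (forall i, msz (F i) <= m)%N -> (msz (Esum F) <= m)%N.
Proof. by move=> H; rewrite /Esum; elim: (enum I) => //= a r; rewrite geq_max H. Qed.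

Lemma wt_Edz k s l : (wt (Edz k s l) <= 1)%N.
Proof. exact: wt_Esum. Qed.

Lemma wt_ded k e : okE e -> (wt (ded k e) <= (wt e).+1)%N.
Proof.
elim: e => //= [||s J|b s J|a ha b hb /andP[oa ob]|a ha b hb /andP[oa ob]].
- by move=> _; rewrite wt_Esum.
- by move=> _; rewrite wt_Esum.
- move=> _; rewrite geq_max leqnn wt_Esum //= => l.
  by rewrite maxnn -add1n leq_add // wt_Edz.
- move=> J0; rewrite prednK ?lt0n ?size_eq0 // geq_max leqnn wt_Esum //= => l.
  by rewrite -[X in (_ <= X)%N]add0n leq_add // wt_Esum.
- by rewrite -maxnSS geq_max !leq_max ha // hb // orbT.
- by rewrite geq_max -addSn leq_add2r ha //= addSn -addnS leq_add2l hb.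
Qed.

Lemma msz_Edz k s l : (msz (Edz k s l) <= 1)%N.
Proof. exact: msz_Esum. Qed.

Lemma msz_ded k e : (msz (ded k e) <= (msz e).+1)%N.
Proof.
elim: e => //= [||s J|b s J|a ha b hb|a ha b hb].
- by rewrite !max0n msz_Esum.
- by rewrite !max0n msz_Esum.
- rewrite geq_max leqnn msz_Esum //= => l; rewrite maxnn geq_max leqnn andbT.
  exact: leq_trans (msz_Edz _ _ _) _.
- rewrite geq_max leqnn msz_Esum //= => l; rewrite geq_max leqnn andbT max0n.
  by rewrite msz_Esum.
- by rewrite -maxnSS geq_max !leq_max ha hb orbT.
- by rewrite -maxnSS !geq_max !leq_max ha hb !leqnSn !orbT.
Qed.

Lemma wt_EF c c0 J : (wt (EF c c0 J) <= (size J).+1)%N.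
Proof.
elim: J => //= k J IH; rewrite geq_max (leq_trans (wt_ded _ _)) ?ltnS ?okE_EF //=.
apply: wt_Esum => s; apply: wt_Esum => l /=.
exact: (leq_add (wt_Edz k s l) (leqnn (size J).+1)).
Qed.

Lemma msz_EF c c0 J : (msz (EF c c0 J) <= size J)%N.
Proof.
elim: J => //= k J IH; rewrite geq_max (leq_trans (msz_ded _ _)) ?ltnS //=.
by apply: msz_Esum => s; apply: msz_Esum => l /=; rewrite geq_max leqnn andbT (leq_trans (msz_Edz _ _ _)).
Qed.

Fixpoint bnd (b : R) (e : expr) : R :=
  match e with
  | Ec a => `|a|
  | Eadd e1 e2 => bnd b e1 + bnd b e2
  | Emul e1 e2 => bnd b e1 * bnd b e2
  | _ => b
  end.

Lemma bnd_ge0 b e : 0 <= b -> 0 <= bnd b e.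
Proof.
by move=> b0; elim: e => //= e1 h1 e2 h2; [rewrite addr_ge0|rewrite mulr_ge0].
Qed.

(* Factors of weight at most [m] are known, those of weight between [m] and [k]
   are bounded by [S], and the first differences of order [k] by [g]. *)
Definition env U h x (m k : nat) (b S g : R) :=
  [/\ vel (dgr (U [::]) h x) <= b,
      forall s J, (size J <= m)%N -> `|eval U h (Ed1 s J) x| <= b,
      forall s J, (m < size J < k)%N -> `|eval U h (Ed1 s J) x| <= S,
      forall o s J, J != [::] -> ((size J).-1 <= m)%N -> `|eval U h (Ept o s J) x| <= b
    & (forall o s J, J != [::] -> (m < (size J).-1 < k)%N -> `|eval U h (Ept o s J) x| <= S)
      /\ (forall s J, size J = k -> `|eval U h (Ed1 s J) x| <= g)].

(** A factor bounded only by [S] uses up at least [m + 1] units of weight, so a product of weight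
    [w] contains at most [w %/ m.+1] of them. A factor bounded by [g] has weight [k] and leaves
    weight at most 1 to the others, which are then known because [0 < m]. Hence [g] enters linearly
    and is never multiplied by a power of [S]. *)
Lemma evalB U h x m k b S (g : R) e : 1 <= b -> 1 <= S -> 0 <= g -> (0 < m < k)%N ->
  env U h x m k b S g -> okE e -> (msz e <= k)%N -> (wt e <= k.+1)%N ->
  `|eval U h e x| <= bnd b e * (S ^+ (wt e %/ m.+1) + (k <= wt e)%N%:R * g).
Proof.
move=> b1 S1 g0 /andP[m0 mk] [ev e1 e2 e3 [e4 e5]].
have b0 : 0 <= b by lra.
have Sn j : 1 <= S ^+ j by rewrite exprn_ege1.
have low (a : R) w : `|a| <= b -> `|a| <= b * (S ^+ (w %/ m.+1) + (k <= w)%N%:R * g).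
  move=> ab; have := Sn (w %/ m.+1)%N; have : 0 <= (k <= w)%N%:R * g by rewrite mulr_ge0.
  nra.
have mid (a : R) w : (m < w)%N -> `|a| <= S -> `|a| <= b * (S ^+ (w %/ m.+1) + (k <= w)%N%:R * g).
  move=> mw aS; have : S <= S ^+ (w %/ m.+1).
    by rewrite -[X in X <= _]expr1 ler_weXn2l // divn_gt0.
  have : 0 <= (k <= w)%N%:R * g by rewrite mulr_ge0.
  nra.
elim: e => /= [a|||s J|o s J|p h1 q h2 /andP[u1 u2]|p h1 q h2 /andP[u1 u2]].
- move=> _ _ _; rewrite div0n expr0 leqn0 (negbTE (lt0n_neq0 (ltn_trans m0 mk))) mul0r addr0.
  by rewrite mulr1.
- by move=> _ _ _; apply: low; rewrite ger0_norm // ltW // vel_gt0.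
- move=> _ _ _; apply: low; rewrite ger0_norm ?invr_ge0 ?(ltW (vel_gt0 _)) //.
  by apply: le_trans b1; rewrite invf_le1 ?vel_gt0 ?vel_ge1.
- move=> _ Jk _; have [Jm|mJ] := leqP (size J) m; first by apply: low; exact: e1.
  have [Jk'|kJ] := boolP (size J < k)%N; first by apply: mid => //; apply: e2; rewrite mJ.
  have {}Jk : size J = k by apply/eqP; rewrite eqn_leq Jk leqNgt.
  have := e5 s J Jk; rewrite Jk leqnn mul1r /=; have := Sn (k %/ m.+1)%N; nra.
- move=> J0 Jk _; have [Jm|mJ] := leqP (size J).-1 m; first by apply: low; exact: e3.
  by apply: mid => //; apply: e4; rewrite // mJ /= prednK ?lt0n ?size_eq0.
- rewrite !geq_max => /andP[m1 m2] /andP[w1 w2].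
  have := h1 u1 m1 w1; have := h2 u2 m2 w2; have B1 := bnd_ge0 p b0; have B2 := bnd_ge0 q b0.
  have mono w w' : (w <= w')%N -> S ^+ (w %/ m.+1) + (k <= w)%N%:R * g <= S ^+ (w' %/ m.+1) + (k <= w')%N%:R * g.
    move=> ww; apply: lerD; first by rewrite ler_weXn2l // leq_div2r.
    rewrite ler_wpM2r // ler_nat; have [kw|//] := boolP (k <= w)%N.
    by rewrite (leq_trans kw ww).
  have := mono _ _ (leq_maxl (wt p) (wt q)); have := mono _ _ (leq_maxr (wt p) (wt q)).
  set X := S ^+ _ + _; set Y := S ^+ _ + _; set Z := S ^+ _ + _ => YZ XZ q1 q2.
  apply: le_trans (ler_normD _ _) _; rewrite mulrDl; apply: lerD.
    by apply: le_trans q2 _; rewrite ler_wpM2l.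
  by apply: le_trans q1 _; rewrite ler_wpM2l.
rewrite geq_max => /andP[m1 m2] w12.
have w1 := leq_trans (leq_addr (wt q) (wt p)) w12.
have w2 := leq_trans (leq_addl (wt p) (wt q)) w12.
have := h1 u1 m1 w1; have := h2 u2 m2 w2; have B1 := bnd_ge0 p b0; have B2 := bnd_ge0 q b0.
rewrite normrM => q2 q1; apply: le_trans (ler_pM _ _ q1 q2) _ => //.
rewrite [X in X <= _]mulrACA ler_wpM2l ?mulr_ge0 //.
have Sd : S ^+ (wt p %/ m.+1) * S ^+ (wt q %/ m.+1) <= S ^+ ((wt p + wt q) %/ m.+1).
  by rewrite -exprD ler_weXn2l // leq_divRL // mulnDl leq_add // leq_trunc_div.
have [k1|k1] := boolP (k <= wt p)%N.
  have w41 : (wt q <= 1)%N by rewrite -(leq_add2l k) addn1 (leq_trans _ w12) // leq_add2r.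
  have -> : (k <= wt q)%N = false.
    by apply/negbTE; rewrite -ltnNge (leq_ltn_trans w41 (leq_ltn_trans m0 mk)).
  rewrite (leq_trans k1 (leq_addr _ _)) !mul1r mul0r addr0.
  rewrite [(wt q %/ _)%N]divn_small ?ltnS ?(leq_trans w41) // expr0 mulr1 lerD2r.
  by rewrite ler_weXn2l // leq_div2r // leq_addr.
have [k2|k2] := boolP (k <= wt q)%N.
  have w31 : (wt p <= 1)%N by rewrite -(leq_add2r k) add1n (leq_trans _ w12) // leq_add2l.
  rewrite (leq_trans k2 (leq_addl _ _)) !mul1r mul0r addr0.
  rewrite [(wt p %/ _)%N]divn_small ?ltnS ?(leq_trans w31) // expr0 mul1r lerD2r.
  by rewrite ler_weXn2l // leq_div2r // leq_addl.
rewrite !mul0r !addr0; apply: le_trans Sd _; rewrite lerDl mulr_ge0 //.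
Qed.

End step.

(** * A priori bounds *)

Section energy.
Context {R : realType} {n : nat}.
Notation V := 'rV[R]_n.
Notation St := ('I_n + 'I_n * 'I_n)%type.
Notation jets := (seq 'I_n -> V -> R).
Implicit Types (x y z : V) (f : V -> R) (s : St) (J : seq 'I_n) (U : jets) (h : R).

Fixpoint words (k : nat) : seq (seq 'I_n) :=
  if k is k'.+1 then [seq i :: J | J <- words k', i <- enum 'I_n] else [:: [::]].

Lemma mem_words k J : (J \in words k) = (size J == k).
Proof.
elim: k J => [|k IH] [|i J] //=; first by apply/allpairsP => -[[a b]] /= [].
rewrite eqSS -IH; apply/allpairsP/idP => [[[a b] /= [aw _ [_ ->]]]//|Jw].
by exists (J, i); rewrite /= mem_enum.
Qed.

Lemma big_words k (F : seq 'I_n -> R) :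
  \sum_(J <- words k.+1) F J = \sum_(J <- words k) \sum_i F (i :: J).
Proof. by rewrite big_allpairs_dep; apply: eq_bigr => J _; rewrite big_enum. Qed.

Definition ordb U k (b : R) := forall J, size J = k -> bdd (U J) b.
Definition vsq U k x : R := \sum_(J <- words k) U J x ^+ 2.
Definition stp h f (p : St * bool) x : V := (if p.2 then h else - h) *: zeta f h p.1 x.
(** A discrete version of the squared gradient of [D^k u] along the directions of the scheme; it is
    the quantity gained in the energy inequality. *)
Definition gam2 U h k x : R :=
  h ^- 2 * \sum_(J <- words k) \sum_p (U J (x + stp h (U [::]) p x) - U J x) ^+ 2.

Lemma vsq_ge0 U k x : 0 <= vsq U k x.
Proof. by apply: sumr_ge0 => J _; exact: sqr_ge0. Qed.

Lemma gam2_ge0 U h k x : 0 <= gam2 U h k x.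
Proof.
apply: mulr_ge0; first by rewrite invr_ge0 sqr_ge0.
by apply: sumr_ge0 => J _; apply: sumr_ge0 => p _; exact: sqr_ge0.
Qed.

Lemma ler_sum_mem (r : seq (seq 'I_n)) (F : seq 'I_n -> R) J :
  J \in r -> (forall J, 0 <= F J) -> F J <= \sum_(J <- r) F J.
Proof.
move=> Jr F0; rewrite (big_rem J) //= -[X in X <= _]addr0 lerD2l.
by apply: sumr_ge0.
Qed.

Lemma ordb_vsq U k (b : R) : 0 <= b -> (forall x, vsq U k x <= b ^+ 2) -> ordb U k b.
Proof.
move=> b0 H J Jk x; rewrite -(@ler_pXn2r _ 2) ?nnegrE // real_normK ?num_real //.
apply: le_trans (H x); apply: (@ler_sum_mem _ (fun J => U J x ^+ 2)) => [|K].
  by rewrite mem_words Jk.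
exact: sqr_ge0.
Qed.

Lemma vsq_ordb U k (b : R) x : ordb U k b -> vsq U k x <= (size (words k))%:R * b ^+ 2.
Proof.
move=> H; rewrite /vsq big_seq; apply: (@le_trans _ _ (\sum_(J <- words k | J \in words k) b ^+ 2)).
  apply: ler_sum => J; rewrite mem_words => /eqP Jk.
  by rewrite -[X in X <= _]real_normK ?num_real // lerXn2r ?nnegrE ?(bdd_ge0 (H J Jk)) // H.
by rewrite -big_seq big_const_seq count_predT iter_addr_0 mulr_natl.
Qed.

Lemma ordb_le U k (b b' : R) : b <= b' -> ordb U k b -> ordb U k b'.
Proof. by move=> bb H J Jk; apply: bdd_le (H J Jk). Qed.

Lemma mulrn_sum (a : R) : n%:R * a = \sum_(i < n) a.
Proof. by rewrite sumr_const card_ord mulr_natl. Qed.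

Definition Zc (B1 : R) : R := n%:R * (1 + n%:R * B1).

Lemma Zc_ge0 B1 : 0 <= B1 -> 0 <= Zc B1.
Proof. by move=> B10; rewrite mulr_ge0 ?addr_ge0 ?mulr_ge0. Qed.

Lemma dirA_le1 s l : `|dirA s l| <= 1 :> R.
Proof. by case: s => [i|p] /=; rewrite ?normr0 //; case: (l == i); rewrite ?normr1 ?normr0. Qed.

Lemma dirB_le1 s l m : `|dirB s l m| <= 1 :> R.
Proof.
case: s => [i|[i j]] /=; first by rewrite normr0.
have s2 : `|(Num.sqrt 2)^-1| <= 1 :> R.
  rewrite ger0_norm ?invr_ge0 ?sqrtr_ge0 // invf_le1 ?sqrtr_gt0 //.
  by rewrite -[X in X <= _]sqrtr1 ler_sqrt // ler1n.
rewrite normrM -[X in _ <= X]mulr1 ler_pM //.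
by do !case: (_ == _); rewrite ?mulr0 ?mul0r ?mulr1 ?subrr ?subr0 ?sub0r ?normrN ?normr1 ?normr0.
Qed.

Lemma nm_dir s (p : 'I_n -> R) B1 : (forall i, `|p i| <= B1) -> nm (dir s p) <= Zc B1.
Proof.
move=> pB; rewrite /nm /Zc mulrn_sum; apply: ler_sum => l _.
rewrite mxE; apply: le_trans (ler_normD _ _) _; apply: lerD; first exact: dirA_le1.
rewrite mulrn_sum; apply: le_trans (ler_norm_sum _ _ _) _.
apply: ler_sum => m _; rewrite normrM -[X in _ <= X]mul1r ler_pM //.
exact: dirB_le1.
Qed.

Lemma nm_dirB s (p q : 'I_n -> R) : nm (dir s p - dir s q) <= n%:R * \sum_i `|p i - q i|.
Proof.
rewrite /nm mulrn_sum; apply: ler_sum => l _.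
rewrite !mxE opprD addrACA subrr add0r.
rewrite -sumrB; apply: le_trans (ler_norm_sum _ _ _) _; apply: ler_sum => m _.
by rewrite -mulrBr normrM -[X in _ <= X]mul1r ler_wpM2r // dirB_le1.
Qed.

Lemma dgr_bdd U h (B1 : R) x i : isjet U -> 0 < h -> ordb U 1 B1 -> `|dgr (U [::]) h x i| <= B1.
Proof.
move=> ju h0 U1; have [C HC] := ju.2 [::].
have -> : dgr (U [::]) h x i = (2 * h)^-1 * (U [::] (x + h *: delta_mx 0 i) - U [::] (x - h *: delta_mx 0 i)) by [].
rewrite normrM gtr0_norm ?invr_gt0 ?mulr_gt0 // ler_pdivrMl ?mulr_gt0 //.
have -> : x + h *: delta_mx 0 i = (x - h *: delta_mx 0 i) + (2 * h) *: delta_mx 0 i.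
  by rewrite -addrA -scaleNr -scalerDl; congr (_ + _ *: _); ring.
apply: le_trans (tay_lip _ _ HC (b := B1) _) _ => [j|]; first exact: U1.
by rewrite nm_delta gtr0_norm ?mulr_gt0 // mulrC.
Qed.

Lemma vel_bdd (p : 'I_n -> R) B1 : (forall i, `|p i| <= B1) -> vel p <= 1 + n%:R * B1 ^+ 2.
Proof.
move=> pB; apply: (@le_trans _ _ (vel p ^+ 2)).
  by rewrite expr2 ler_peMl ?vel_ge1 // (le_trans ler01) ?vel_ge1.
rewrite sqr_vel lerD2l mulrn_sum; apply: ler_sum => i _.
rewrite -[X in X <= _]real_normK ?num_real // lerXn2r ?nnegrE //.
exact: le_trans (pB i).
Qed.

(** Passage from orders of derivatives to weights of factors, with a shift by one: a factor of
    weight [j] is a derivative of order [j + 1]. First differences of order [k] are split at [x]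
    into two increments, both of which occur in [gam2]. *)
Lemma env_of_ordb U h x m k (B1 b S : R) : isjet U -> 0 < h -> 0 <= B1 -> 0 <= b -> 0 <= S ->
  ordb U 1 B1 -> (forall j, (0 < j <= m.+1)%N -> ordb U j b) ->
  (forall j, (m.+1 < j <= k)%N -> ordb U j S) ->
  env U h x m k (1 + n%:R * B1 ^+ 2 + (1 + 2 * Zc B1) * b) (1 + (1 + 2 * Zc B1) * S)
    (2 * Num.sqrt (gam2 U h k x)).
Proof.
move=> ju h0 B10 b0 S0 U1 Ub US; have Z0 := Zc_ge0 B10.
have pB i := dgr_bdd x i ju h0 U1.
have Zs s : nm (zeta (U [::]) h s x) <= Zc B1 by exact: nm_dir.
have q0 : 0 <= n%:R * B1 ^+ 2 by rewrite mulr_ge0 ?sqr_ge0.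
have d1 s J (a : R) : 0 <= a -> ordb U (size J).+1 a -> `|eval U h (Ed1 s J) x| <= 2 * Zc B1 * a.
  move=> a0 Ua; have [C HC] := ju.2 J; set Z := zeta (U [::]) h s x in Zs *.
  rewrite /= -/Z normrM gtr0_norm ?invr_gt0 // ler_pdivrMl //.
  have -> : x + h *: Z = (x - h *: Z) + (2 * h) *: Z.
    by rewrite -addrA -scaleNr -scalerDl; congr (_ + _ *: _); ring.
  apply: le_trans (tay_lip _ _ HC (b := a) _) _ => [j|]; first exact: Ua.
  rewrite nmZ gtr0_norm ?mulr_gt0 //; have := Zs s; rewrite -/Z => ZZ.
  have : a * nm Z <= a * Zc B1 by rewrite ler_wpM2l.
  nra.
have pt o s J (a : R) : ordb U (size J) a -> `|eval U h (Ept o s J) x| <= a by move=> Ua; exact: Ua.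
split.
- apply: le_trans (vel_bdd pB) _; rewrite lerDl; nra.
- move=> s J Jm; apply: le_trans (d1 s J b b0 (Ub _ _)) _; rewrite ?ltnS //; nra.
- move=> s J /andP[Jm Jk]; apply: le_trans (d1 s J S S0 (US _ _)) _; rewrite ?ltnS ?Jm //; nra.
- move=> o s J J0 Jm; apply: le_trans (pt o s J b (Ub _ _)) _; last by nra.
  by rewrite lt0n size_eq0 J0 -[X in (X <= _)%N]prednK ?lt0n ?size_eq0 // ltnS.
split.
- move=> o s J J0 /andP[Jm Jk]; apply: le_trans (pt o s J S (US _ _)) _; last by nra.
  by rewrite -[size J]prednK ?lt0n ?size_eq0 // ltnS Jm.
move=> s J Jk; rewrite -(@ler_pXn2r _ 2) ?nnegrE ?mulr_ge0 ?sqrtr_ge0 //.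
rewrite exprMn sqr_sqrtr ?gam2_ge0 // real_normK ?num_real // /= exprMn.
set Z := zeta _ _ _ _; set a := U J (x + _); set c := U J (x - _).
have : (a - U J x) ^+ 2 + (c - U J x) ^+ 2 <= \sum_p (U J (x + stp h (U [::]) p x) - U J x) ^+ 2.
  rewrite (bigD1 (s, true)) //= (bigD1 (s, false)) /=; last by rewrite xpair_eqE andbF.
  apply: lerD => //; rewrite -[X in X <= _]addr0; apply: lerD; first by rewrite /c -scaleNr.
  by apply: sumr_ge0 => p _; exact: sqr_ge0.
have := @ler_sum_mem (words k) (fun J => \sum_p (U J (x + stp h (U [::]) p x) - U J x) ^+ 2) J.
rewrite mem_words Jk eqxx => /(_ isT) H H'.
have {H} := le_trans H' (H (fun K => sumr_ge0 _ (fun p _ => sqr_ge0 _))).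
rewrite /gam2; set G := \sum_(_ <- _) _ => HG.
have hp : 0 < h ^- 2 by rewrite invr_gt0 exprn_gt0.
rewrite exprVn; have -> : 2 ^+ 2 * (h ^- 2 * G) = h ^- 2 * (4 * G) by ring.
rewrite ler_pM2l //; have := sqr_ge0 (a + c - 2 * U J x).
have := sqr_ge0 (a - U J x); have := sqr_ge0 (c - U J x); nra.
Qed.

Definition cF (c c0 b : R) k : R := \sum_(J <- words k) bnd b (EF c c0 J).

Lemma cF_ge0 c c0 b k : 0 <= b -> 0 <= cF c c0 b k.
Proof. by move=> b0; apply: sumr_ge0 => J _; exact: bnd_ge0. Qed.

Lemma EF_bound c c0 U h x m k b S (g : R) J : 1 <= b -> 1 <= S -> 0 <= g -> (0 < m < k)%N ->
  env U h x m k b S g -> size J = k ->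
  `|eval U h (EF c c0 J) x| <= cF c c0 b k * (S ^+ (k.+1 %/ m.+1) + g).
Proof.
move=> b1 S1 g0 mk ee Jk; have b0 : 0 <= b by lra.
apply: le_trans (evalB b1 S1 g0 mk ee (okE_EF _ _ _) _ _) _.
- by rewrite -Jk msz_EF.
- by rewrite -Jk wt_EF.
apply: ler_pM; rewrite ?bnd_ge0 ?addr_ge0 ?mulr_ge0 ?exprn_ge0 //; first by lra.
  apply: (@ler_sum_mem _ (fun J => bnd b (EF c c0 J))) => [|K]; first by rewrite mem_words Jk.
  exact: bnd_ge0.
apply: lerD; first by rewrite ler_weXn2l // leq_div2r // -Jk wt_EF.
by rewrite -[X in _ <= X]mul1r ler_wpM2r // lern1 leq_b1.
Qed.

(** Since [2 a d = (a + d)^2 - a^2 - d^2], the linear term is an average minus a sum of squares. By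
    Cauchy-Schwarz and the smallness of [th], the square of the sum of increments consumes only half
    of this gain. *)
Lemma sq_step (I : finType) (a th t F : R) (d : I -> R) :
  0 <= th -> #|I|%:R * th <= 4^-1 ->
  (a + th * (\sum_i d i) + t * F) ^+ 2 <=
    a ^+ 2 + th * (\sum_i ((a + d i) ^+ 2 - a ^+ 2)) - 2^-1 * th * (\sum_i d i ^+ 2)
    + 2 * t * (a * F) + 2 * t ^+ 2 * F ^+ 2.
Proof.
move=> th0 thI; set D := \sum_i d i; set Q := \sum_i d i ^+ 2.
have -> : \sum_i ((a + d i) ^+ 2 - a ^+ 2) = 2 * a * D + Q.
  by rewrite mulr_sumr -big_split; apply: eq_bigr => i _ /=; ring.
have Q0 : 0 <= Q by apply: sumr_ge0 => i _; exact: sqr_ge0.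
have DQ : D ^+ 2 <= #|I|%:R * Q.
  have : 0 <= \sum_i \sum_j (d i - d j) ^+ 2.
    by apply: sumr_ge0 => i _; apply: sumr_ge0 => j _; exact: sqr_ge0.
  have -> : \sum_i \sum_j (d i - d j) ^+ 2 = 2 * (#|I|%:R * Q) - 2 * D ^+ 2.
    have e : \sum_i \sum_j (d i ^+ 2 + d j ^+ 2) = 2 * (#|I|%:R * Q).
      under eq_bigr do rewrite big_split /= sumr_const -mulr_natl.
      rewrite big_split /= -mulr_sumr sumr_const -mulr_natl -/Q; ring.
    have e2 : \sum_i \sum_j (2 * (d i * d j)) = 2 * D ^+ 2.
      rewrite expr2 /D mulr_suml mulr_sumr; apply: eq_bigr => i _.
      by rewrite -mulr_sumr -mulr_sumr.
    rewrite -e -e2 -sumrB; apply: eq_bigr => i _; rewrite -sumrB; apply: eq_bigr => j _; ring.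
  lra.
have h1 : th ^+ 2 * D ^+ 2 <= 4^-1 * th * Q.
  apply: (@le_trans _ _ (th ^+ 2 * (#|I|%:R * Q))); first by rewrite ler_wpM2l ?sqr_ge0.
  have -> : th ^+ 2 * (#|I|%:R * Q) = (#|I|%:R * th) * (th * Q) by ring.
  by rewrite -[4^-1 * th * Q]mulrA ler_wpM2r ?mulr_ge0.
have h2 := sqr_ge0 (th * D - t * F).
have -> : (a + th * D + t * F) ^+ 2 = a ^+ 2 + 2 * th * a * D + 2 * t * (a * F)
  + 2 * (th ^+ 2 * D ^+ 2) + 2 * t ^+ 2 * F ^+ 2 - (th * D - t * F) ^+ 2 by ring.
have : th * (2 * a * D + Q) = 2 * th * a * D + th * Q by ring.
lra.
Qed.

(** The ratio of the time step to [h^2]. The neighbours then carry a total weight of at most 1/8,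
    and the second order part of the step is a convex combination that leaves at least 7/8 at the
    centre. *)
Definition theta : R := (8 * (#|{: St * bool}|%:R + 1))^-1.
Definition sig h : R := theta * h ^+ 2.

Lemma theta_gt0 : 0 < theta.
Proof. by rewrite invr_gt0 mulr_gt0 // ltr_wpDl. Qed.

Lemma card_theta : #|{: St * bool}|%:R * theta <= 8^-1.
Proof.
rewrite /theta invfM mulrCA -[X in _ <= X]mulr1 ler_wpM2l ?invr_ge0 //.
by rewrite ler_pdivrMr ?mul1r ?lerDl // ltr_wpDl.
Qed.

Definition nxt c c0 h U : jets := next c c0 h (sig h) U.

Definition avg h U f x : R :=
  f x + theta * \sum_p (f (x + stp h (U [::]) p x) - f x).

Lemma avg_le h U f x a b : f x <= a -> (forall y, f y <= b) ->
  avg h U f x <= (1 - #|{: St * bool}|%:R * theta) * a + #|{: St * bool}|%:R * theta * b.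
Proof.
move=> fa fb; rewrite /avg sumrB sumr_const -mulr_natl mulrBr.
have t0 := theta_gt0; have ct := card_theta.
have : \sum_p f (x + stp h (U [::]) p x) <= #|{: St * bool}|%:R * b.
  by rewrite mulr_natl -sumr_const; apply: ler_sum.
move=> /(ler_wpM2l (ltW t0)); set N := _%:R in ct *; move: (\sum_p _) => T; nra.
Qed.

Lemma Mop_stp U h J x : Mop U h J x = h ^- 2 * \sum_p (U J (x + stp h (U [::]) p x) - U J x).
Proof.
congr (_ * _); rewrite (eq_bigr (fun p => (fun s b => U J (x + stp h (U [::]) (s, b) x) - U J x) p.1 p.2)); last by case.
rewrite -(pair_bigA _ (fun s b => U J (x + stp h (U [::]) (s, b) x) - U J x)) /=.
apply: eq_bigr => s _; rewrite big_bool /stp /sdiff /= scaleNr; ring.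
Qed.

(** [sq_step] summed over the words of length [k] gains [gam2 / 2]. The forcing is linear in
    [sqrt gam2]: Young's inequality costs a quarter of [gam2] and the term quadratic in the time
    step an eighth, so an eighth remains. *)
Lemma energy c c0 U h k x (C L r : R) : 0 < h -> 0 <= C -> 0 <= L -> 0 <= r ->
  (forall J, size J = k -> `|eval U h (EF c c0 J) x| <= C * (L + 2 * Num.sqrt (gam2 U h k x))) ->
  vsq U k x <= r ^+ 2 ->
  128 * sig h * (size (words k))%:R * C ^+ 2 <= 1 ->
  4 * sig h * (size (words k))%:R * C ^+ 2 * L ^+ 2 <= 1 ->
  vsq (nxt c c0 h U) k x <= avg h U (vsq U k) x + sig h * (- (8^-1 * gam2 U h k x)
    + 2 * (size (words k))%:R * C * r * L + 16 * (size (words k))%:R ^+ 2 * C ^+ 2 * r ^+ 2 + 1).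
Proof.
move=> h0 C0 L0 r0 HF Hr s1 s2.
have t0 := theta_gt0; have sg0 : 0 < sig h by rewrite mulr_gt0 // exprn_gt0.
set N : R := (size (words k))%:R in s1 s2 *; have N0 : 0 <= N by exact: ler0n.
set g := Num.sqrt _ in HF; have g0 : 0 <= g by exact: sqrtr_ge0.
have gg : g ^+ 2 = gam2 U h k x by rewrite sqr_sqrtr // gam2_ge0.
pose F J := eval U h (EF c c0 J) x; pose d J p := U J (x + stp h (U [::]) p x) - U J x.
have nE J : nxt c c0 h U J x = U J x + theta * (\sum_p d J p) + sig h * F J.
  rewrite /nxt /next /rhs Mop_stp -/(F J) /d mulrDr addrA /sig; congr (_ + _ + _).
  by rewrite mulrA mulfK // expf_neq0 // gt_eqF.
have st J : J \in words k -> nxt c c0 h U J x ^+ 2 <= U J x ^+ 2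
     + theta * (\sum_p ((U J x + d J p) ^+ 2 - U J x ^+ 2))
     - 2^-1 * theta * (\sum_p d J p ^+ 2) + 2 * sig h * (r * (C * (L + 2 * g)))
     + 2 * sig h ^+ 2 * (C ^+ 2 * (2 * L ^+ 2 + 8 * g ^+ 2)).
  rewrite mem_words => /eqP Jk; rewrite nE.
  have ct : #|{: St * bool}|%:R * theta <= 4^-1 by have := card_theta; lra.
  apply: (le_trans (@sq_step _ (U J x) theta (sig h) (F J) (d J) (ltW t0) ct)).
  have hF := HF J Jk; rewrite -/(F J) -/g in hF.
  have hU : `|U J x| <= r.
    have Hr' := Hr; rewrite -(@ler_pXn2r _ 2) ?nnegrE // real_normK ?num_real //.
    apply: le_trans Hr'; apply: (@ler_sum_mem _ (fun J => U J x ^+ 2)) => [|K].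
      by rewrite mem_words Jk.
    exact: sqr_ge0.
  have h1 : U J x * F J <= r * (C * (L + 2 * g)).
    by apply: le_trans (ler_norm _) _; rewrite normrM ler_pM.
  have h2 : F J ^+ 2 <= C ^+ 2 * (2 * L ^+ 2 + 8 * g ^+ 2).
    apply: (@le_trans _ _ ((C * (L + 2 * g)) ^+ 2)).
      by rewrite -[X in X <= _]real_normK ?num_real // lerXn2r ?nnegrE ?mulr_ge0 ?addr_ge0 ?mulr_ge0.
    rewrite exprMn ler_wpM2l ?sqr_ge0 //; have := sqr_ge0 (L - 2 * g); nra.
  apply: lerD; last by apply: ler_wpM2l h2; apply: mulr_ge0 => //; exact: sqr_ge0.
  by rewrite lerD2l; apply: ler_wpM2l h1; rewrite mulr_ge0 // ltW.
have hA : avg h U (vsq U k) x = vsq U k x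
    + theta * \sum_(J <- words k) \sum_p ((U J x + d J p) ^+ 2 - U J x ^+ 2).
  rewrite /avg; congr (_ + _ * _); rewrite exchange_big; apply: eq_bigr => p _.
  by rewrite /vsq -sumrB; apply: eq_bigr => J _; rewrite /d subrKC.
have hG : h ^+ 2 * gam2 U h k x = \sum_(J <- words k) \sum_p d J p ^+ 2.
  by rewrite /gam2 mulVKf // expf_neq0 // gt_eqF.
set c1 := 2 * sig h * (r * (C * (L + 2 * g))) in st.
set c2 := 2 * sig h ^+ 2 * (C ^+ 2 * (2 * L ^+ 2 + 8 * g ^+ 2)) in st.
have : vsq (nxt c c0 h U) k x <= \sum_(J <- words k) (U J x ^+ 2
     + theta * (\sum_p ((U J x + d J p) ^+ 2 - U J x ^+ 2))
     - 2^-1 * theta * (\sum_p d J p ^+ 2) + c1 + c2).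
  by rewrite /vsq !big_seq; exact: ler_sum.
have csum (a : R) : \sum_(J <- words k) a = N * a.
  by rewrite big_const_seq count_predT iter_addr_0 mulr_natl.
rewrite !big_split /= !csum sumrN -!mulr_sumr -hG.
rewrite -/(vsq U k x) -hA; set A := avg _ _ _ _; set G := gam2 _ _ _ _ in gg *.
have e0 : 2^-1 * theta * (h ^+ 2 * G) = sig h * (2^-1 * G) by rewrite /sig; ring.
have e1 : N * c1 = sig h * (2 * N * C * r * L + 4 * (N * r * C) * g) by rewrite /c1; ring.
have e2 : N * c2 = sig h * (2^-1 * (4 * sig h * N * C ^+ 2 * L ^+ 2 * 2)
   + 8^-1 * (128 * sig h * N * C ^+ 2 * g ^+ 2)) by rewrite /c2; field.
move=> h1; apply: le_trans h1 _; rewrite e0 e1 e2.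
have g20 : 0 <= g ^+ 2 by exact: sqr_ge0.
have h2 : 128 * sig h * N * C ^+ 2 * g ^+ 2 <= g ^+ 2.
  by rewrite -[X in _ <= X]mul1r ler_wpM2r.
have h3 : 4 * (N * r * C) * g <= 16 * N ^+ 2 * C ^+ 2 * r ^+ 2 + 4^-1 * g ^+ 2.
  have := sqr_ge0 (4 * (N * r * C) - 2^-1 * g); nra.
set X1 := 2 * N * C * r * L in e1 *; set X2 := 4 * (N * r * C) * g in h3 *.
set X3 := 4 * sig h * N * C ^+ 2 * L ^+ 2 in s2 *; set X4 := 128 * _ * _ * _ * _ in h2 *.
set X5 := 16 * _ * _ * _ in h3 *.
have : - (2^-1 * G) + (X1 + X2) + (2^-1 * (X3 * 2) + 8^-1 * X4) <= - (8^-1 * G) + X1 + X5 + 1.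
  by rewrite -gg; lra.
move=> /(ler_wpM2l (ltW sg0)); rewrite !mulrDr !mulrN; lra.
Qed.

End energy.

Ltac nneg := repeat first [ assumption | exact: ler01 | exact: ler0n | exact: sqr_ge0
  | exact: normr_ge0 | apply: mulr_ge0 | apply: addr_ge0 | apply: exprn_ge0
  | by rewrite invr_ge0 ].

(** * Bounds on higher derivatives, uniform in the mesh and in time *)

Section refined.
Context {R : realType} {n : nat}.
Notation V := 'rV[R]_n.
Notation St := ('I_n + 'I_n * 'I_n)%type.
Notation jets := (seq 'I_n -> V -> R).
Implicit Types (x y z : V) (f : V -> R) (s : St) (J : seq 'I_n) (U : jets) (h : R).
Notation N k := ((size (words (n := n) k))%:R : R).

Lemma jet_lip U J (b : R) x z : isjet U -> ordb U (size J).+1 b ->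
  `|U J (x + z) - U J x| <= b * nm z.
Proof.
move=> ju Ub; have [C HC] := ju.2 J; apply: tay_lip HC _ => i; exact: Ub.
Qed.

Lemma jet_tay U J (b : R) : isjet U -> ordb U (size J).+2 b ->
  tay (U J) (fun i => U (i :: J)) b.
Proof.
move=> ju Ub; have [C HC] := ju.2 J; apply: tay_sharp HC _ => i x z.
exact: jet_lip.
Qed.

(** The coordinate vectors are among the directions, and the increments along them are [h] times the
    derivatives of order [k + 1] up to the Taylor remainder. In this way the gain at order [k]
    becomes a damping of order [k + 1]. *)
Lemma gam2_lower U h k x (e : R) : isjet U -> 0 < h -> ordb U k.+2 e ->
  vsq U k.+1 x <= gam2 U h k x + 2 * h ^+ 2 * (N k * n%:R) * e ^+ 2.
Proof.
move=> ju h0 Ue; rewrite /vsq big_words /gam2 mulr_sumr.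
have -> : 2 * h ^+ 2 * (N k * n%:R) * e ^+ 2
    = \sum_(J <- words (n := n) k) \sum_(i < n) (2 * h ^+ 2 * e ^+ 2) :> R.
  rewrite big_const_seq count_predT iter_addr_0 -mulrn_sum -[RHS]mulr_natl; ring.
rewrite -big_split /= big_seq [X in _ <= X]big_seq; apply: ler_sum => J.
rewrite mem_words => /eqP Jk.
rewrite (eq_bigr (fun p => (fun s b => (U J (x + stp h (U [::]) (s, b) x) - U J x) ^+ 2) p.1 p.2)); last by case.
rewrite -(pair_bigA _ (fun s b => (U J (x + stp h (U [::]) (s, b) x) - U J x) ^+ 2)) /=.
rewrite big_sumType /= mulrDr -addrA addrCA.
apply: ler_wpDl.
  apply: mulr_ge0; first by rewrite invr_ge0 sqr_ge0.
  by apply: sumr_ge0 => i _; apply: sumr_ge0 => j _; exact: sqr_ge0.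
rewrite mulr_sumr -big_split; apply: ler_sum => i _ /=.
have t := jet_tay (J := J) ju; rewrite Jk in t; have {}t := t e Ue.
rewrite big_bool /stp /= /zeta dir_inl.
have t1 := t x (h *: delta_mx 0 i); have t2 := t x (- h *: delta_mx 0 i).
rewrite (sum_delta (fun i => U (i :: J) x)) nm_delta (gtr0_norm h0) in t1.
rewrite (sum_delta (fun i => U (i :: J) x)) nm_delta normrN (gtr0_norm h0) mulNr opprK in t2.
set a := U J _ - U J x in t1 *; set b := U J _ - U J x in t2 *; set u := U (i :: J) x in t1 t2 *.
have h2 : 0 < h ^+ 2 by rewrite exprn_gt0.
rewrite -(ler_pM2l h2) mulrDr mulVKf ?gt_eqF //.
have e0 : 0 <= e * h ^+ 2 by apply: le_trans t1.
have p1 : (a - h * u) ^+ 2 <= (e * h ^+ 2) ^+ 2.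
  by rewrite -[X in X <= _]real_normK ?num_real // lerXn2r ?nnegrE.
have p2 : (b + h * u) ^+ 2 <= (e * h ^+ 2) ^+ 2.
  by rewrite -[X in X <= _]real_normK ?num_real // lerXn2r ?nnegrE.
have := sqr_ge0 (h * u + ((a - h * u) - (b + h * u))).
have := sqr_ge0 ((a - h * u) + (b + h * u)).
have -> : h ^+ 2 * (2 * h ^+ 2 * e ^+ 2) = 2 * (e * h ^+ 2) ^+ 2 by ring.
nra.
Qed.

Definition b1 (B1 b : R) : R := 1 + n%:R * B1 ^+ 2 + (1 + 2 * Zc (n := n) B1) * b.

Lemma b1_ge1 B1 b : 0 <= B1 -> 0 <= b -> 1 <= b1 B1 b.
Proof.
move=> B10 b0; have := Zc_ge0 (n := n) B10; have : 0 <= n%:R * B1 ^+ 2 by rewrite mulr_ge0 ?sqr_ge0.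
rewrite /b1; nra.
Qed.

(** The count of [evalB] with the orders up to [k] known. The exponent [k.+2 %/ k] is 2 for [k = 2]
    and 1 for larger [k]: the forcing is at worst quadratic in the order to be bounded. *)
Lemma EF_lower c c0 U h k x (B1 b q : R) J : isjet U -> 0 < h -> 0 <= B1 -> 0 <= b -> 0 <= q ->
  (1 < k)%N -> ordb U 1 B1 -> (forall j, (0 < j <= k)%N -> ordb U j b) -> ordb U k.+1 q ->
  size J = k.+1 ->
  `|eval U h (EF c c0 J) x| <= cF (n := n) c c0 (b1 B1 b) k.+1 *
     ((1 + (1 + 2 * Zc (n := n) B1) * q) ^+ (k.+2 %/ k) + 2 * Num.sqrt (gam2 U h k.+1 x)).
Proof.
move=> ju h0 B10 b0 q0 k1 U1 Ub Uq Jk; have Z0 := Zc_ge0 (n := n) B10.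
have km : (k = k.-1.+1)%N by rewrite prednK // (ltn_trans _ k1).
have ee : env U h x k.-1 k.+1 (b1 B1 b) (1 + (1 + 2 * Zc (n := n) B1) * q)
   (2 * Num.sqrt (gam2 U h k.+1 x)).
  apply: env_of_ordb => //; first by move=> j; rewrite -km; exact: Ub.
  move=> j; rewrite -km => /andP[kj jk].
  by have -> : j = k.+1 by apply/eqP; rewrite eqn_leq jk.
have -> : (k.+2 %/ k = k.+2 %/ k.-1.+1)%N by rewrite -km.
apply: (EF_bound c c0 _ _ _ _ ee Jk).
- exact: b1_ge1.
- nra.
- by rewrite mulr_ge0 ?sqrtr_ge0.
- by rewrite ltnS leq_pred andbT -subn1 subn_gt0.
Qed.

Lemma EF_known c c0 U h k x (B1 b : R) J : isjet U -> 0 < h -> 0 <= B1 -> 0 <= b ->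
  (1 < k)%N -> ordb U 1 B1 -> (forall j, (0 < j <= k)%N -> ordb U j b) -> size J = k ->
  `|eval U h (EF c c0 J) x| <= cF (n := n) c c0 (b1 B1 b) k * (1 + 2 * Num.sqrt (gam2 U h k x)).
Proof.
move=> ju h0 B10 b0 k1 U1 Ub Jk.
have km : (k = k.-1.+1)%N by rewrite prednK // (ltn_trans _ k1).
have ee : env U h x k.-1 k (b1 B1 b) (1 + (1 + 2 * Zc (n := n) B1) * 0)
   (2 * Num.sqrt (gam2 U h k x)).
  apply: env_of_ordb => //; first by move=> j; rewrite -km; exact: Ub.
  move=> j; rewrite -km => /andP[kj jk].
  by move: kj; rewrite ltnNge jk.
rewrite mulr0 addr0 in ee.
have := @EF_bound _ _ c c0 U h x _ _ _ _ _ J (b1_ge1 B10 b0) (lexx 1) _ _ ee Jk.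
rewrite expr1n; apply; first by rewrite mulr_ge0 ?sqrtr_ge0.
by rewrite -subn1 subn_gt0 k1 ltn_subrL (ltn_trans _ k1).
Qed.

Lemma small_steps (Xs : seq R) : exists2 h1 : R, 0 < h1 &
  forall h, 0 < h < h1 -> h <= 1 /\ forall X, X \in Xs -> h ^+ 2 * X <= 1.
Proof.
set Y := \sum_(X <- Xs) `|X|; have Y0 : 0 <= Y by exact: sumr_ge0.
exists (1 + Y)^-1; first by rewrite invr_gt0; lra.
move=> h /andP[h0 h1].
have h2 : h * (1 + Y) < 1 by rewrite -ltr_pdivlMr ?div1r //; lra.
have h3 : h <= 1 by nra.
split=> // X XX; have XY : X <= Y.
  by rewrite /Y (big_rem X) //= (le_trans (ler_norm X)) // lerDl sumr_ge0.
have : h ^+ 2 * X <= h ^+ 2 * Y by rewrite ler_wpM2l ?sqr_ge0.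
nra.
Qed.

Lemma theta_le1 : theta (R := R) (n := n) <= 1.
Proof.
rewrite /theta invf_le1.
  by have : (0 : R) <= #|{: St * bool}|%:R by []; lra.
by rewrite mulr_gt0 // ltr_wpDl.
Qed.

Lemma sig_le h X : 0 <= X -> h ^+ 2 * X <= 1 -> sig (n := n) h * X <= 1.
Proof.
move=> X0 hX; rewrite /sig -mulrA; apply: le_trans hX.
by rewrite ler_piMl ?theta_le1 // mulr_ge0 ?sqr_ge0.
Qed.

Lemma avg_lin h U f g (a : R) x :
  avg h U f x + a * avg h U g x = avg h U (fun y => f y + a * g y) x.
Proof.
rewrite /avg mulrDr addrACA; congr (_ + _); rewrite mulrCA -mulrDr; congr (_ * _).
rewrite mulr_sumr -big_split; apply: eq_bigr => p _ /=; ring.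
Qed.

Lemma exp_le2 k : (1 < k)%N -> (k.+2 %/ k <= 2)%N.
Proof. move=> k1; rewrite -ltnS ltn_divLR; lia. Qed.

Lemma exp_eq1 k : (2 < k)%N -> (k.+2 %/ k = 1)%N.
Proof.
move=> k2; apply/eqP; rewrite eqn_leq divn_gt0; last lia.
rewrite -ltnS ltn_divLR; lia.
Qed.

(** With [L] quadratic in [q] the forcing is cubic in [q], so the damping [a q^2 / 32] has to be
    cubic as well and [a] is taken proportional to [q]. The requirement [a r2 <= q^2 / 4] is then
    linear against quadratic and holds for large [q]. *)
Lemma refined_consts (M C a1 D' r2 e2 : R) : 0 <= M -> 0 <= C -> 0 <= a1 -> 0 <= D' ->
  0 <= r2 -> 0 <= e2 ->
  exists q a : R, [/\ 1 <= q, 0 <= a, a * r2 <= 4^-1 * q ^+ 2, M * e2 <= 2^-1 * q ^+ 2 &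
    forall L, 0 <= L <= (1 + a1) ^+ 2 * q ^+ 2 ->
      0 <= 2 * M * C * q * L + 16 * M ^+ 2 * C ^+ 2 * q ^+ 2 + 1 + a * (D' + 1) <=
      a * (32^-1 * q ^+ 2)].
Proof.
move=> M0 C0 a10 D'0 r20 e20.
pose A := 2 * M * C * (1 + a1) ^+ 2 + 16 * M ^+ 2 * C ^+ 2 + 1.
have u0 : 0 <= 2 * M * C * (1 + a1) ^+ 2 by nneg.
have v0 : 0 <= 16 * M ^+ 2 * C ^+ 2 by nneg.
have A1 : 1 <= A by rewrite /A; lra.
have ee : 0 <= M * e2 by rewrite mulr_ge0.
have Ar : 0 <= A * r2 by rewrite mulr_ge0 //; lra.
pose q := 1 + 64 * (D' + 1) + 256 * (A * r2) + 2 * (M * e2).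
have q1 : 1 <= q by rewrite /q; lra.
have qq : q <= q ^+ 2 by nra.
have qD : 64 * (D' + 1) <= q by rewrite /q; lra.
have qr : 256 * (A * r2) <= q by rewrite /q; lra.
have qe : 2 * (M * e2) <= q by rewrite /q; lra.
move: q q1 qq qD qr qe => q q1 qq qD qr qe.
have Aq : 0 <= A * q by rewrite mulr_ge0 //; lra.
exists q, (64 * (A * q)); split=> //.
- by rewrite mulr_ge0.
- have -> : 64 * (A * q) * r2 = 4^-1 * (q * (256 * (A * r2))) by field.
  by rewrite expr2 ler_pM2l // ler_wpM2l //; lra.
- lra.
move=> L /andP[L0 LL].
have MC : 0 <= 2 * M * C * q by apply: mulr_ge0; [nneg|lra].
have h1 := ler_wpM2l MC LL; have h0 := mulr_ge0 MC L0.
have q3 : 1 <= q ^+ 3 by rewrite exprn_ege1.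
have q23 : q ^+ 2 <= q ^+ 3 by rewrite ler_weXn2l.
have h2 := ler_wpM2l v0 q23; have h20 := mulr_ge0 v0 (sqr_ge0 q).
have h3 := ler_wpM2l Aq qD.
have h4 := ler_wpM2l Aq qq.
have h5 : 0 <= 64 * (A * q) * (D' + 1) by rewrite mulr_ge0 ?mulr_ge0 //; lra.
have e1 : 64 * (A * q) * (32^-1 * q ^+ 2) = 2 * M * C * q * ((1 + a1) ^+ 2 * q ^+ 2)
  + 16 * M ^+ 2 * C ^+ 2 * q ^+ 3 + q ^+ 3 + A * q * q ^+ 2 by rewrite /A; field.
apply/andP; split; first by lra.
rewrite e1; lra.
Qed.

Lemma energy_comb (A1 A2 s g1 g2 t1 t2 t1' t2' a v v1 v2 : R) :
  v1 <= A1 + s * (- (8^-1 * g1) + t1 + t2 + 1) ->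
  v2 <= A2 + s * (- (8^-1 * g2) + t1' + t2' + 1) ->
  0 <= g1 -> v <= g2 + 2 -> 0 <= a -> 0 <= s ->
  v1 + a * v2 <= A1 + a * A2 +
    s * (t1 + t2 + 1 + a * (t1' + t2' + 1 + 1) - 8^-1 * (a * v)).
Proof.
move=> n1 n2 g10 vg a0 s0; have m2 := ler_wpM2l a0 n2.
have m3 := ler_wpM2l a0 vg.
have m4 : 0 <= s * g1 by rewrite mulr_ge0.
have m5 := ler_wpM2l s0 m3.
have m6 : 0 <= s * a by rewrite mulr_ge0.
lra.
Qed.

(** Used where the top order part is at least a quarter of the threshold: there the damping exceeds
    the forcing. *)
Lemma fin_big (cth Q A s E a v : R) : A <= (1 - cth) * Q + cth * Q -> 0 <= s ->
  E <= a * (32^-1 * Q) -> 4^-1 * Q <= v -> 0 <= a -> A + s * (E - 8^-1 * (a * v)) <= Q.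
Proof.
move=> A1 s0 E1 v1 a0; have m := ler_wpM2l a0 v1.
have : s * (E - 8^-1 * (a * v)) <= 0 by rewrite mulr_ge0_le0 //; lra.
lra.
Qed.

(** Used where the functional is below half of the threshold: averaging adds at most 1/8 of the
    threshold, and a short time step cannot make up the rest. *)
Lemma fin_small (cth Q A s E w : R) : A <= (1 - cth) * (2^-1 * Q) + cth * Q ->
  0 <= cth <= 8^-1 -> s * (8 * E) <= 1 -> 0 <= s -> 0 <= w -> 1 <= Q ->
  A + s * (E - 8^-1 * w) <= Q.
Proof.
move=> A1 /andP[c0 c1] sE s0 w0 Q1; have m := mulr_ge0 s0 w0.
have : cth * Q <= 8^-1 * Q by rewrite ler_wpM2r //; lra.
lra.
Qed.

(** Bernstein's device: the dissipation of [a |D^k u|^2] damps [|D^(k+1) u|^2], and the sum is kept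
    below [q^2] at every point. The constants [q] and [a] come from the lower orders and the initial
    datum; the bound [e] on order [k + 2] appears after them and affects only [h1]. *)
Lemma refined_exists c c0 k (B1 b e0 : R) : 0 <= B1 -> 0 <= b -> 0 <= e0 -> (1 < k)%N ->
  exists q a : R, [/\ 1 <= q, 0 <= a,
    forall U, ordb U k b -> ordb U k.+1 e0 -> forall x, vsq U k.+1 x + a * vsq U k x <= q ^+ 2
  & forall e, 0 <= e -> exists2 h1, 0 < h1 & forall h, 0 < h < h1 -> forall U,
      isjet U -> ordb U 1 B1 -> (forall j, (0 < j <= k)%N -> ordb U j b) ->
      ordb U k.+2 e -> (forall x, vsq U k.+1 x + a * vsq U k x <= q ^+ 2) ->
      forall x, vsq (nxt c c0 h U) k.+1 x + a * vsq (nxt c c0 h U) k x <= q ^+ 2].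
Proof.
move=> B10 b0 e00 k1; have Z0 := Zc_ge0 (n := n) B10.
have bb0 : 0 <= b1 B1 b := le_trans ler01 (b1_ge1 B10 b0).
set a1 := 1 + 2 * Zc (n := n) B1; have a10 : 0 <= a1 by rewrite /a1; nneg.
set C := cF (n := n) c c0 (b1 B1 b) k.+1; set C' := cF (n := n) c c0 (b1 B1 b) k.
have C0 : 0 <= C by exact: cF_ge0.
have C'0 : 0 <= C' by exact: cF_ge0.
pose M := N k.+1; pose M' := N k; have M0 : 0 <= M by []. have M'0 : 0 <= M' by [].
pose r' := (M' + 1) * b; have r'0 : 0 <= r' by rewrite /r'; nneg.
have Mr : M' * b ^+ 2 <= r' ^+ 2.
  rewrite /r' exprMn ler_wpM2r ?sqr_ge0 // expr2 (le_trans (_ : _ <= M' + 1)) ?lerDl //.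
  by rewrite ler_peMl ?lerDr // addr_ge0.
pose D' := 2 * M' * C' * r' * 1 + 16 * M' ^+ 2 * C' ^+ 2 * r' ^+ 2 + 1.
have D'0 : 0 <= D' by rewrite /D'; nneg.
have [q [a [q1 a0 ar qe key]]] :=
  refined_consts M0 C0 a10 D'0 (sqr_ge0 r') (sqr_ge0 e0).
have q0 : 0 <= q := le_trans ler01 q1.
exists q, a; split=> //.
- move=> U Uk Uk1 x.
  have v1 := vsq_ordb x Uk1; have v2 := vsq_ordb x Uk.
  have v3 : a * vsq U k x <= 4^-1 * q ^+ 2.
    by apply: le_trans ar; rewrite ler_wpM2l // (le_trans v2).
  apply: (le_trans (lerD (le_trans v1 qe) v3)).
  rewrite -mulrDl ler_piMl ?sqr_ge0 //; clear; lra.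
move=> e e0'.
pose L := (1 + a1 * q) ^+ (k.+2 %/ k).
have S1 : 1 <= 1 + a1 * q by rewrite lerDl; nneg.
have L0 : 0 <= L by rewrite exprn_ge0 // (le_trans ler01).
have LL : L <= (1 + a1) ^+ 2 * q ^+ 2.
  apply: (@le_trans _ _ ((1 + a1 * q) ^+ 2)); first by rewrite ler_weXn2l // exp_le2.
  have Lq : 1 + a1 * q <= (1 + a1) * q by rewrite [(1 + a1) * q]mulrDl mul1r lerD2r.
  by rewrite -exprMn lerXn2r // nnegrE; nneg.
have {key} := key L ltac:(by rewrite L0 LL).
set D := 2 * M * C * q * L + 16 * M ^+ 2 * C ^+ 2 * q ^+ 2 + 1; set E := D + a * (D' + 1).
move=> /andP[E0 key].
pose X1 := 128 * M * C ^+ 2; pose X2 := 4 * M * C ^+ 2 * L ^+ 2.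
pose X3 := 128 * M' * C' ^+ 2; pose X4 := 4 * M' * C' ^+ 2 * 1 ^+ 2.
pose X5 := M' * n%:R * e ^+ 2; pose X6 := 8 * E.
have P1 : 0 <= X1 by rewrite /X1; nneg.
have P2 : 0 <= X2 by rewrite /X2; nneg.
have P3 : 0 <= X3 by rewrite /X3; nneg.
have P4 : 0 <= X4 by rewrite /X4; nneg.
have P6 : 0 <= X6 by rewrite /X6 mulr_ge0.
have [h1 h10 H1] := small_steps [:: X1; X2; X3; X4; X5; X6].
exists h1 => // h hh U ju U1 Ub Ue UP x; have [hle1 hX] := H1 h hh; have h0 : 0 < h by case/andP: hh.
have s1 := sig_le P1 (hX X1 ltac:(by rewrite !inE eqxx ?orbT)).
have s2 := sig_le P2 (hX X2 ltac:(by rewrite !inE eqxx ?orbT)).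
have s3 := sig_le P3 (hX X3 ltac:(by rewrite !inE eqxx ?orbT)).
have s4 := sig_le P4 (hX X4 ltac:(by rewrite !inE eqxx ?orbT)).
have s5 := hX X5 ltac:(by rewrite !inE eqxx ?orbT).
have s6 := sig_le P6 (hX X6 ltac:(by rewrite !inE eqxx ?orbT)).
have sg0 : 0 <= sig (n := n) h by rewrite mulr_ge0 ?sqr_ge0 // ltW // theta_gt0.
have v0' y : 0 <= a * vsq U k y by rewrite mulr_ge0 // vsq_ge0.
have Vq y : vsq U k.+1 y <= q ^+ 2 by apply: le_trans (UP y); rewrite lerDl.
have Uq : ordb U k.+1 q by exact: ordb_vsq Vq.
have Vb y : vsq U k y <= r' ^+ 2.
  by apply: le_trans Mr; apply: vsq_ordb; apply: Ub; rewrite (ltn_trans _ k1) /=.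
have f1 J : size J = k.+1 -> `|eval U h (EF c c0 J) x| <= C * (L + 2 * Num.sqrt (gam2 U h k.+1 x)).
  by move=> Jk; exact: EF_lower.
have f2 J : size J = k -> `|eval U h (EF c c0 J) x| <= C' * (1 + 2 * Num.sqrt (gam2 U h k x)).
  by move=> Jk; exact: EF_known.
have t1 : 128 * sig (n := n) h * M * C ^+ 2 <= 1.
  by rewrite (_ : _ * _ = sig (n := n) h * X1) // /X1; ring.
have t2 : 4 * sig (n := n) h * M * C ^+ 2 * L ^+ 2 <= 1.
  by rewrite (_ : _ * _ = sig (n := n) h * X2) // /X2; ring.
have t3 : 128 * sig (n := n) h * M' * C' ^+ 2 <= 1.
  by rewrite (_ : _ * _ = sig (n := n) h * X3) // /X3; ring.
have t4 : 4 * sig (n := n) h * M' * C' ^+ 2 * 1 ^+ 2 <= 1.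
  by rewrite (_ : _ * _ = sig (n := n) h * X4) // /X4; ring.
have n1 := energy h0 C0 L0 q0 f1 (Vq x) t1 t2.
have n2 := energy h0 C'0 ler01 r'0 f2 (Vb x) t3 t4.
have gl : vsq U k.+1 x <= gam2 U h k x + 2.
  apply: le_trans (gam2_lower x ju h0 Ue) _; rewrite lerD2l.
  have -> : 2 * h ^+ 2 * (N k * n%:R) * e ^+ 2 = 2 * (h ^+ 2 * X5) by rewrite /X5 /M'; ring.
  by rewrite ler_piMr.
apply: (le_trans (energy_comb n1 n2 (gam2_ge0 U h k.+1 x) gl a0 sg0)).
rewrite avg_lin -/M -/M' -/D -/D' -/E.
have ct := card_theta (R := R) (n := n); have tt := theta_gt0 (R := R) (n := n).
have [big|small] := leP (4^-1 * q ^+ 2) (vsq U k.+1 x).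
  exact: fin_big (avg_le h U (UP x) UP) sg0 key big a0.
have Px : vsq U k.+1 x + a * vsq U k x <= 2^-1 * q ^+ 2.
  have w : a * vsq U k x <= a * r' ^+ 2 by rewrite ler_wpM2l.
  by apply: (le_trans (lerD (ltW small) (le_trans w ar))); rewrite -mulrDl ler_wpM2r ?sqr_ge0 //; clear; lra.
apply: fin_small (avg_le h U Px UP) _ s6 sg0 _ _.
- by rewrite ct andbT mulr_ge0 // ltW.
- by rewrite mulr_ge0 // vsq_ge0.
- by rewrite exprn_ege1.
Qed.

(** For [2 < k] the forcing is linear in order [k + 1], so that even without damping its maximum
    grows at most exponentially. No higher order intervenes, and this closes the chain of refined
    bounds on a finite time interval. *)
Lemma crude_exists c c0 k (B1 b : R) : 0 <= B1 -> 0 <= b -> (2 < k)%N ->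
  exists2 A : R, 0 <= A & forall Em, exists2 h1, 0 < h1 & forall h, 0 < h < h1 -> forall U E,
      isjet U -> ordb U 1 B1 -> (forall j, (0 < j <= k)%N -> ordb U j b) ->
      1 <= E <= Em -> (forall x, vsq U k.+1 x <= E) ->
      forall x, vsq (nxt c c0 h U) k.+1 x <= E * (1 + A * sig (n := n) h).
Proof.
move=> B10 b0 k2; have Z0 := Zc_ge0 (n := n) B10.
have k1 : (1 < k)%N by apply: ltn_trans k2.
have bb0 : 0 <= b1 B1 b := le_trans ler01 (b1_ge1 B10 b0).
set a1 := 1 + 2 * Zc (n := n) B1; have a10 : 0 <= a1 by rewrite /a1; nneg.
set C := cF (n := n) c c0 (b1 B1 b) k.+1; have C0 : 0 <= C by exact: cF_ge0.
pose M := N k.+1; have M0 : 0 <= M by [].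
pose A := 2 * M * C * (1 + a1) + 16 * M ^+ 2 * C ^+ 2 + 1.
have A0 : 0 <= A by rewrite /A; nneg.
exists A => // Em.
pose X1 := 128 * M * C ^+ 2; pose X2 := 4 * M * C ^+ 2 * ((1 + a1) ^+ 2 * `|Em|).
have P1 : 0 <= X1 by rewrite /X1; nneg.
have P2 : 0 <= X2 by rewrite /X2; nneg.
have [h1 h10 H1] := small_steps [:: X1; X2].
exists h1 => // h hh U E ju U1 Ub /andP[E1 EE] UE x; have [hle1 hX] := H1 h hh.
have h0 : 0 < h by case/andP: hh.
have s1 := sig_le P1 (hX X1 ltac:(by rewrite !inE eqxx ?orbT)).
have s2 := sig_le P2 (hX X2 ltac:(by rewrite !inE eqxx ?orbT)).
have sg0 : 0 <= sig (n := n) h by rewrite mulr_ge0 ?sqr_ge0 // ltW // theta_gt0.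
have E0 : 0 <= E := le_trans ler01 E1.
pose q := Num.sqrt E; have qE : q ^+ 2 = E by rewrite sqr_sqrtr.
have q1 : 1 <= q by rewrite -[X in X <= _]sqrtr1 ler_sqrt.
have q0 : 0 <= q := le_trans ler01 q1.
have Vq y : vsq U k.+1 y <= q ^+ 2 by rewrite qE.
have Uq : ordb U k.+1 q by exact: ordb_vsq Vq.
pose L := 1 + a1 * q; have L0 : 0 <= L by rewrite addr_ge0 // mulr_ge0.
have LE : L <= (1 + a1) * q by rewrite [(1 + a1) * q]mulrDl mul1r lerD2r.
have LE2 : L ^+ 2 <= (1 + a1) ^+ 2 * `|Em|.
  apply: (@le_trans _ _ ((1 + a1) ^+ 2 * q ^+ 2)).
    by rewrite -exprMn lerXn2r // nnegrE; nneg.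
  by rewrite ler_wpM2l ?sqr_ge0 // qE (le_trans EE) // ler_norm.
have hF J : size J = k.+1 -> `|eval U h (EF c c0 J) x| <= C * (L + 2 * Num.sqrt (gam2 U h k.+1 x)).
  by move=> Jk; have := EF_lower c c0 x ju h0 B10 b0 q0 k1 U1 Ub Uq Jk; rewrite exp_eq1 // expr1.
have s2' : 4 * sig (n := n) h * M * C ^+ 2 * L ^+ 2 <= 1.
  apply: le_trans s2.
  have -> : sig (n := n) h * X2 = 4 * sig (n := n) h * M * C ^+ 2 * ((1 + a1) ^+ 2 * `|Em|) by rewrite /X2; ring.
  by apply: ler_wpM2l => //; nneg.
have t1 : 128 * sig (n := n) h * M * C ^+ 2 <= 1.
  by rewrite (_ : _ * _ = sig (n := n) h * X1) // /X1; ring.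
have n1 := energy h0 C0 L0 q0 hF (Vq x) t1 s2'.
apply: le_trans n1 _; rewrite [E * _]mulrDr mulr1.
apply: lerD.
  by apply: le_trans (avg_le h U (UE x) UE) _; rewrite -mulrDl subrK mul1r.
have -> : E * (A * sig (n := n) h) = sig (n := n) h * (A * E) by ring.
apply: ler_wpM2l => //.
have g0 := gam2_ge0 U h k.+1 x.
have qL : 2 * M * C * (q * L) <= 2 * M * C * ((1 + a1) * E).
  rewrite ler_wpM2l ?mulr_ge0 // -qE expr2 mulrCA; by rewrite ler_wpM2l.
rewrite -/M qE /A; move: qL g0 E1 E0; clear; lra.
Qed.

End refined.

(** * Comparison, concavity and consistency of the scheme *)

Section monotone.
Context {R : realType} {n : nat}.
Notation V := 'rV[R]_n.
Notation St := ('I_n + 'I_n * 'I_n)%type.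
Notation jets := (seq 'I_n -> V -> R).
Implicit Types (x y z : V) (f g : V -> R) (s : St) (J : seq 'I_n) (U : jets) (h : R)
  (p q : 'I_n -> R).
Variables (c c0 : R).

Definition Hp p : R := vel p * vel p * (c + - c0 * vel p).
(** The right-hand side with the gradient frozen at [p]. Freezing separates the second differences,
    which are monotone, from the dependence on the gradient. *)
Definition Gop f h p x : R := h ^- 2 * (\sum_s sdiff f (h *: dir s p) x) + Hp p.
Definition Sop h f x : R := f x + sig (n := n) h * Gop f h (dgr f h x) x.

Lemma nxt_Sop h U : nxt c c0 h U [::] = Sop h (U [::]).
Proof. by []. Qed.

Lemma vel_lip p q : `|vel p - vel q| <= \sum_i `|p i - q i|.
Proof.
set S := \sum_i _.
have vp := vel_gt0 p; have vq := vel_gt0 q.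
have s0 : 0 < vel p + vel q by rewrite addr_gt0.
have pv (r : 'I_n -> R) i : `|r i| <= vel r.
  rewrite -(@ler_pXn2r _ 2) ?nnegrE ?(ltW (vel_gt0 _)) // sqr_vel real_normK ?num_real //.
  rewrite (bigD1 i) //= addrCA lerDl addr_ge0 // sumr_ge0 // => j _; exact: sqr_ge0.
rewrite -(ler_pM2r s0) -[X in _ * X <= _](gtr0_norm s0) -normrM.
have -> : (vel p - vel q) * (vel p + vel q) = \sum_i (p i - q i) * (p i + q i).
  rewrite -subr_sqr !sqr_vel opprD addrACA subrr add0r -sumrB.
  by apply: eq_bigr => i _; rewrite subr_sqr.
apply: le_trans (ler_norm_sum _ _ _) _; rewrite mulr_suml; apply: ler_sum => i _.
by rewrite normrM ler_wpM2l // (le_trans (ler_normD _ _)) // lerD.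
Qed.

Definition Vm (B1 : R) : R := 1 + n%:R * B1 ^+ 2.
Definition KH (B1 : R) : R := 2 * `|c| * Vm B1 + 3 * `|c0| * Vm B1 ^+ 2.

Lemma Vm_ge0 B1 : 0 <= Vm B1.
Proof. by rewrite addr_ge0 // mulr_ge0 // sqr_ge0. Qed.

Lemma KH_ge0 B1 : 0 <= KH B1.
Proof. have := Vm_ge0 B1 => ?; rewrite /KH; nneg. Qed.

Lemma Hp_lip p q B1 : (forall i, `|p i| <= B1) -> (forall i, `|q i| <= B1) ->
  `|Hp p - Hp q| <= KH B1 * \sum_i `|p i - q i|.
Proof.
move=> pB qB; have vp := vel_bdd pB; have vq := vel_bdd qB; have vl := vel_lip p q.
rewrite -/(Vm B1) in vp vq; have p0 := ltW (vel_gt0 p); have q0 := ltW (vel_gt0 q).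
rewrite /Hp; set v := vel p in vp vl p0 *; set w := vel q in vq vl q0 *.
have -> : v * v * (c + - c0 * v) - w * w * (c + - c0 * w) =
  (c * (v + w) - c0 * (v ^+ 2 + v * w + w ^+ 2)) * (v - w) by ring.
rewrite normrM; apply: ler_pM => //.
apply: (le_trans (ler_normB _ _)); rewrite !normrM; apply: lerD.
  rewrite [2 * _]mulrC -mulrA ler_wpM2l // ger0_norm ?addr_ge0 //.
  move: vp vq; clear; lra.
rewrite [3 * _]mulrC -mulrA ler_wpM2l // ger0_norm ?addr_ge0 ?mulr_ge0 ?sqr_ge0 //.
move: vp vq p0 q0; clear; nra.
Qed.

Definition C11 f df (b : R) :=
  tay f df b /\ forall i x z, `|df i (x + z) - df i x| <= b * nm z.

Lemma jet_C11 U b : isjet U -> ordb U 2 b -> C11 (U [::]) (fun i => U [:: i]) b.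
Proof.
move=> ju U2; split; first exact: (jet_tay (J := [::]) ju U2).
by move=> i x z; exact: (jet_lip (J := [:: i]) _ _ ju U2).
Qed.

Definition Kmv (b B1 : R) : R := #|{: St}|%:R * (6 * b * Zc (n := n) B1 * n%:R) + KH B1.

(** By [tay_sdiff_move] a change of direction alters a second difference by a multiple of [h^2],
    which the factor [h ^- 2] compensates. The [6] is [2 * 3]: the two directions and their
    difference have total size at most [3 Zc]. *)
Lemma Gop_move f df b h p q B1 x : C11 f df b -> 0 <= b -> 0 < h -> 0 <= B1 ->
  (forall i, `|p i| <= B1) -> (forall i, `|q i| <= B1) ->
  `|Gop f h p x - Gop f h q x| <= Kmv b B1 * \sum_i `|p i - q i|.
Proof.
move=> [ft fl] b0 h0 B10 pB qB; rewrite /Gop opprD addrACA -mulrBr.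
have Z0 := Zc_ge0 (n := n) B10.
apply: le_trans (ler_normD _ _) _; rewrite [X in _ <= X]mulrDl; apply: lerD; last exact: Hp_lip.
have h2 : 0 < h ^+ 2 by rewrite exprn_gt0.
rewrite normrM gtr0_norm ?invr_gt0 // ler_pdivrMl //.
set S := \sum_i `|p i - q i|.
have -> : h ^+ 2 * (#|{: St}|%:R * (6 * b * Zc (n := n) B1 * n%:R) * S) =
   \sum_(s : St) h ^+ 2 * (6 * b * Zc (n := n) B1 * (n%:R * S)).
  by rewrite sumr_const -[_ *+ _]mulr_natl; ring.
rewrite -sumrB; apply: le_trans (ler_norm_sum _ _ _) _; apply: ler_sum => s _.
rewrite /sdiff.
have -> (a b' d e r : R) : a + b' - r - (d + e - r) = (a + b') - (d + e) by ring.
apply: (le_trans (tay_sdiff_move x (h *: dir s q) (h *: dir s p) ft fl)).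
have -> : h *: dir s p - h *: dir s q = h *: (dir s p - dir s q) by rewrite scalerBr.
rewrite !nmZ (gtr0_norm h0).
have d1 := nm_dirB s p q; rewrite -/S in d1; have d2 := nm_dir s qB; have d3 := nm_dir s pB.
have d4 : nm (dir s p - dir s q) <= 2 * Zc (n := n) B1.
  apply: le_trans (nmD _ _) _; rewrite nmN; move: d2 d3; clear; lra.
have d0 := nm_ge0 (dir s p - dir s q).
set d := nm (dir s p - dir s q) in d0 d1 d4 *.
have -> : 2 * b * (h * nm (dir s q) + h * d) * (h * d) =
   h ^+ 2 * (2 * b * ((nm (dir s q) + d) * d)) by ring.
have -> : 6 * b * Zc (n := n) B1 * (n%:R * S) = 2 * b * ((3 * Zc (n := n) B1) * (n%:R * S)) by ring.
rewrite ler_wpM2l ?(ltW h2) // ler_wpM2l ?mulr_ge0 // ler_pM ?addr_ge0 ?nm_ge0 //.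
move: d2 d4; clear; lra.
Qed.

Lemma card_St : #|{: St}|%:R * theta (R := R) (n := n) <= 16^-1 :> R.
Proof.
have := card_theta (R := R) (n := n); rewrite card_prod card_bool natrM.
move: (_%:R) (theta) => N t; clear; lra.
Qed.

(** With the directions of [f] used for both functions, the step is monotone. The remaining error is
    [K] times the difference of the discrete gradients, hence at most [theta * K h / 2] times the
    values of [w = f - g - m] at the neighbours along the [e_i]. These values already occur with
    weight [theta] among the second differences, so [K h <= 1] suffices. *)
Lemma Sop_mono f g dg b B1 h m x : C11 g dg b -> 0 <= b -> 0 < h <= 1 -> 0 <= B1 ->
  Kmv b B1 * h <= 1 ->
  (forall x i, `|dgr f h x i| <= B1) -> (forall x i, `|dgr g h x i| <= B1) ->
  (forall y, m <= f y - g y) -> m <= Sop h f x - Sop h g x.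
Proof.
move=> gC b0 /andP[h0 h1] B10 Kh fB gB mw; set K := Kmv b B1 in Kh *.
have K0 : 0 <= K.
  by have := KH_ge0 B1; have := Zc_ge0 (n := n) B10; rewrite /K /Kmv => ? ?; nneg.
pose w y := f y - g y - m; have w0 y : 0 <= w y by rewrite /w subr_ge0.
have t0 := theta_gt0 (R := R) (n := n); set t := theta in t0.
set p := dgr f h x; set q := dgr g h x.
have mv := Gop_move x gC b0 h0 B10 (fB x) (gB x); rewrite -/p -/q -/K in mv.
have pq i : p i - q i = (2 * h)^-1 * (w (x + h *: delta_mx 0 i) - w (x - h *: delta_mx 0 i)).
  by rewrite /p /q /dgr /cdiff -mulrBr /w; congr (_ * _); ring.
have e1 : Gop f h p x - Gop g h p x = h ^- 2 * \sum_s sdiff w (h *: dir s p) x.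
  rewrite /Gop opprD addrACA subrr addr0 -mulrBr -sumrB; congr (_ * _).
  by apply: eq_bigr => s _; rewrite /sdiff /w; ring.
have hh : sig (n := n) h * h ^- 2 = t by rewrite /sig mulfK // expf_neq0 // gt_eqF.
have e2 : sig (n := n) h * (Gop f h p x - Gop g h p x) = t * \sum_s sdiff w (h *: dir s p) x.
  by rewrite e1 mulrA hh.
have sb : t * \sum_i (w (x + h *: delta_mx 0 i) + w (x - h *: delta_mx 0 i)) - 2 * (#|{: St}|%:R * t) * w x
    <= t * \sum_s sdiff w (h *: dir s p) x.
  have -> : t * \sum_s sdiff w (h *: dir s p) x =
      t * (\sum_s (w (x + h *: dir s p) + w (x - h *: dir s p))) - 2 * (#|{: St}|%:R * t) * w x.
    by rewrite /sdiff sumrB sumr_const -[_ *+ _]mulr_natl; ring.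
  rewrite lerD2r.
  rewrite ler_wpM2l ?(ltW t0) // big_sumType /=.
  apply: ler_wpDr; first by apply: sumr_ge0 => i _; rewrite addr_ge0.
  by apply: ler_sum => i _; rewrite dir_inl.
have s0 : 0 < sig (n := n) h by rewrite mulr_gt0 // exprn_gt0.
have e3 : sig (n := n) h * (K * \sum_i `|p i - q i|) <=
   t * \sum_i (w (x + h *: delta_mx 0 i) + w (x - h *: delta_mx 0 i)).
  rewrite !mulr_sumr; apply: ler_sum => i _.
  rewrite pq normrM gtr0_norm ?invr_gt0 ?mulr_gt0 //.
  set a := w _; set a' := w _; have a0 : 0 <= a by exact: w0. have a'0 : 0 <= a' by exact: w0.
  have aa : `|a - a'| <= a + a' by rewrite ler_norml; move: a0 a'0; clear => *; apply/andP; split; lra.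
  have -> : sig (n := n) h * (K * ((2 * h)^-1 * `|a - a'|)) = t * (2^-1 * (K * h) * `|a - a'|).
    rewrite /sig -/t; field; exact: lt0r_neq0.
  rewrite ler_wpM2l ?(ltW t0) //.
  have : K * h * `|a - a'| <= 1 * `|a - a'| by rewrite ler_wpM2r.
  have := normr_ge0 (a - a'); move: aa; clear; lra.
have e4 : - (K * \sum_i `|p i - q i|) <= Gop g h p x - Gop g h q x.
  by move: mv; rewrite ler_norml => /andP[].
have e5 := ler_wpM2l (ltW s0) e4.
have cs := card_St; rewrite -/t in cs.
have e6 : 0 <= (1 - 2 * (#|{: St}|%:R * t)) * w x by rewrite mulr_ge0 //; move: cs; clear; lra.
have -> : Sop h f x - Sop h g x = m + w x + sig (n := n) h * (Gop f h p x - Gop g h p x)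
   + sig (n := n) h * (Gop g h p x - Gop g h q x).
  by rewrite /Sop -/p -/q /w; ring.
rewrite e2; move: e6 e5 e3 sb; clear; lra.
Qed.

Lemma C11_dgr f df b h i x : C11 f df b -> 0 < h -> `|dgr f h x i - df i x| <= b * h.
Proof.
move=> [ft _] h0; have t1 := ft x (h *: delta_mx 0 i); have t2 := ft x (- h *: delta_mx 0 i).
rewrite (sum_delta (fun i => df i x)) nm_delta (gtr0_norm h0) in t1.
rewrite (sum_delta (fun i => df i x)) nm_delta normrN (gtr0_norm h0) scaleNr mulNr opprK in t2.
have -> : dgr f h x i - df i x = (2 * h)^-1 * ((f (x + h *: delta_mx 0 i) - f x - h * df i x)
   - (f (x - h *: delta_mx 0 i) - f x + h * df i x)).
  by rewrite /dgr /cdiff; field; exact: lt0r_neq0.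
rewrite normrM gtr0_norm ?invr_gt0 ?mulr_gt0 // ler_pdivrMl ?mulr_gt0 //.
apply: (le_trans (ler_normB _ _)); move: t1 t2; clear; lra.
Qed.

Definition cvx f (t : R) x y : R := f (t *: x + (1 - t) *: y) - t * f x - (1 - t) * f y.

(* If the gradient gap [D] at the three points is large, the convexity defect
   can be lowered by moving [x] and [y]: this absorbs the first order terms. *)
Lemma cvx_gain f df b t x y e tau : C11 f df b -> 0 <= b -> 0 <= t <= 1 -> 0 <= tau ->
  (forall x y, - e <= cvx f t x y) ->
  - e + tau * (t * (\sum_i `|df i (t *: x + (1 - t) *: y) - df i x|)
     + (1 - t) * (\sum_i `|df i (t *: x + (1 - t) *: y) - df i y|))
    - 2 * b * n%:R ^+ 2 * tau ^+ 2 <= cvx f t x y.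
Proof.
move=> [ft _] b0 /andP[t0 t1] tau0 Ze; set m := t *: x + (1 - t) *: y.
pose eta z : V := \row_i (- tau * Num.sg (df i m - df i z)).
have neta z : nm (eta z) <= n%:R * tau.
  rewrite /nm mulrn_sum; apply: ler_sum => i _; rewrite mxE normrM normrN (ger0_norm tau0).
  by rewrite ler_piMr // normr_sg; case: (_ == _).
have seta z : \sum_i (df i m - df i z) * eta z 0 i = - tau * \sum_i `|df i m - df i z|.
  rewrite mulr_sumr; apply: eq_bigr => i _; rewrite mxE mulrCA; congr (_ * _).
  by rewrite mulrC -normrEsg.
pose w := t *: eta x + (1 - t) *: eta y.
have t1' : 0 <= 1 - t by rewrite subr_ge0.
have nw : nm w <= n%:R * tau.
  apply: le_trans (nmD _ _) _; rewrite !nmZ (ger0_norm t0) (ger0_norm t1').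
  have := ler_wpM2l t0 (neta x); have := ler_wpM2l t1' (neta y); clear; lra.
have sq z : nm z <= n%:R * tau -> b * nm z ^+ 2 <= b * (n%:R ^+ 2 * tau ^+ 2).
  move=> nz; rewrite -exprMn ler_wpM2l // lerXn2r ?nnegrE ?nm_ge0 //.
  by rewrite mulr_ge0.
have := Ze (x + eta x) (y + eta y); rewrite /cvx.
have -> : t *: (x + eta x) + (1 - t) *: (y + eta y) = m + w.
  by rewrite !scalerDr addrACA.
have h1 := ft m w; have h2 := ft x (eta x); have h3 := ft y (eta y).
have sw := sq _ nw; have sx := sq _ (neta x); have sy := sq _ (neta y).
have ex : \sum_i df i x * eta x 0 i = \sum_i df i m * eta x 0 i + tau * \sum_i `|df i m - df i x|.
  rewrite -[tau]opprK mulNr -seta -sumrB; apply: eq_bigr => i _; ring.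
have ey : \sum_i df i y * eta y 0 i = \sum_i df i m * eta y 0 i + tau * \sum_i `|df i m - df i y|.
  rewrite -[tau]opprK mulNr -seta -sumrB; apply: eq_bigr => i _; ring.
have ew : \sum_i df i m * w 0 i = t * \sum_i df i m * eta x 0 i + (1 - t) * \sum_i df i m * eta y 0 i.
  by rewrite !mulr_sumr -big_split; apply: eq_bigr => i _ /=; rewrite !mxE; ring.
rewrite ew in h1; rewrite ex in h2; rewrite ey in h3.
move: h1 h2 h3; rewrite !ler_norml => /andP[_ h1] /andP[h2 _] /andP[h3 _].
have {}h2 := ler_wpM2l t0 h2; have {}h3 := ler_wpM2l t1' h3.
have {}sx := ler_wpM2l t0 sx; have {}sy := ler_wpM2l t1' sy.
move: h1 h2 h3 sx sy sw; clear; lra.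
Qed.

(** The three points are displaced along the directions of the middle one, so that the shifted
    triples satisfy the hypothesis again. Restoring the proper directions at the end points costs
    [sig K] times the gaps between the gradients, and [cvx_gain] with [tau = 2 sig K] pays for it.
    What remains is of order [sig h], a loss of order [h] per unit of time. *)
Lemma Sop_concave f df b B1 t h e : C11 f df b -> 0 <= b -> 0 <= t <= 1 -> 0 < h <= 1 ->
  0 <= B1 -> (forall x i, `|dgr f h x i| <= B1) ->
  (forall x y, - e <= cvx f t x y) ->
  forall x y, - e - (2 * b * n%:R ^+ 2 * (2 * Kmv b B1) ^+ 2 + 2 * Kmv b B1 * n%:R * b)
     * (sig (n := n) h * h) <= cvx (Sop h f) t x y.
Proof.
move=> fC b0 t01 /andP[h0 h1] B10 fB Ze x y; have /andP[t0 t1] := t01.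
have t1' : 0 <= 1 - t by rewrite subr_ge0.
set K := Kmv b B1; have K0 : 0 <= K.
  by have := KH_ge0 B1; have := Zc_ge0 (n := n) B10; rewrite /K /Kmv => ? ?; nneg.
have s0 : 0 <= sig (n := n) h by rewrite mulr_ge0 ?sqr_ge0 // ltW // theta_gt0.
set m := t *: x + (1 - t) *: y; pose p z := dgr f h z.
pose D z := \sum_i `|df i m - df i z|.
have D0 z : 0 <= D z by apply: sumr_ge0.
have pD z : \sum_i `|p z i - p m i| <= D z + 2 * n%:R * (b * h).
  have -> : D z + 2 * n%:R * (b * h) = \sum_i (`|df i m - df i z| + 2 * (b * h)).
    by rewrite big_split /= -mulrn_sum /D; ring.
  apply: ler_sum => i _; have := C11_dgr i z fC h0; have := C11_dgr i m fC h0.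
  rewrite -/(p z i) -/(p m i) => e1 e2.
  have -> : p z i - p m i = (p z i - df i z) - (df i m - df i z) - (p m i - df i m) by ring.
  apply: (le_trans (ler_normB _ _)).
  have := ler_normB (p z i - df i z) (df i m - df i z); move: e1 e2; clear; lra.
have mv z : `|Gop f h (p z) z - Gop f h (p m) z| <= K * (D z + 2 * n%:R * (b * h)).
  by apply: le_trans (Gop_move z fC b0 h0 B10 (fB z) (fB m)) _; rewrite ler_wpM2l.
have th0 := theta_gt0 (R := R) (n := n); set th := theta in th0.
pose T := \sum_s (cvx f t (x + h *: dir s (p m)) (y + h *: dir s (p m))
   + cvx f t (x - h *: dir s (p m)) (y - h *: dir s (p m)) - 2 * cvx f t x y).
have e1 : sig (n := n) h * (Gop f h (p m) m - t * Gop f h (p m) x - (1 - t) * Gop f h (p m) y) = th * T.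
  have -> : Gop f h (p m) m - t * Gop f h (p m) x - (1 - t) * Gop f h (p m) y = h ^- 2 * T.
    have -> : T = \sum_s (sdiff f (h *: dir s (p m)) m - t * sdiff f (h *: dir s (p m)) x
        - (1 - t) * sdiff f (h *: dir s (p m)) y).
      apply: eq_bigr => s _; rewrite /cvx /sdiff.
      have -> z : t *: (x + z) + (1 - t) *: (y + z) = m + z.
        by rewrite !scalerDr addrACA -scalerDl subrKC scale1r.
      have -> : t *: (x - h *: dir s (p m)) + (1 - t) *: (y - h *: dir s (p m)) = m - h *: dir s (p m).
        by rewrite !scalerBr addrACA -opprD -scalerDl subrKC scale1r.
      rewrite -/m; ring.
    by rewrite 2!sumrB -!mulr_sumr /Gop; ring.
  by rewrite mulrA /sig mulfK // expf_neq0 // gt_eqF.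
have gain := cvx_gain x y fC b0 t01 (_ : 0 <= 2 * (sig (n := n) h * K)) Ze.
have {}gain := gain ltac:(nneg); rewrite -/m -/(D x) -/(D y) in gain.
set G := t * D x + (1 - t) * D y in gain.
have G0 : 0 <= G by rewrite /G; nneg.
set z0 := cvx f t x y in gain T e1 *.
have TB : - (2 * #|{: St}|%:R * th) * (e + z0) <= th * T.
  rewrite mulNr -mulrN -[2 * _ * _]mulrC -mulrA ler_wpM2l ?(ltW th0) //.
  have -> : 2 * #|{: St}|%:R * - (e + z0) = \sum_(s : St) (- e - e - 2 * z0).
    by rewrite sumr_const -[_ *+ _]mulr_natl; ring.
  by apply: ler_sum => s _; rewrite lerD2r lerD // Ze.
have cs := card_St; rewrite -/th in cs.
have -> : cvx (Sop h f) t x y = z0 + th * T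
    - sig (n := n) h * (t * (Gop f h (p x) x - Gop f h (p m) x))
    - sig (n := n) h * ((1 - t) * (Gop f h (p y) y - Gop f h (p m) y)).
  by rewrite -e1 /cvx /Sop -/m -/(p m) -/(p x) -/(p y) /z0 /cvx -/m; ring.
have ex : t * (Gop f h (p x) x - Gop f h (p m) x) <= t * (K * (D x + 2 * n%:R * (b * h))).
  by rewrite ler_wpM2l // (le_trans (ler_norm _)) // mv.
have ey : (1 - t) * (Gop f h (p y) y - Gop f h (p m) y) <= (1 - t) * (K * (D y + 2 * n%:R * (b * h))).
  by rewrite ler_wpM2l // (le_trans (ler_norm _)) // mv.
have {}ex := ler_wpM2l s0 ex; have {}ey := ler_wpM2l s0 ey.
have ss : sig (n := n) h ^+ 2 <= sig (n := n) h * h.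
  rewrite expr2 ler_wpM2l // /sig -/th.
  have th1 := theta_le1 (R := R) (n := n); rewrite -/th in th1.
  move: th1 th0 h0 h1; clear; nra.
have C0 : 0 <= 2 * b * n%:R ^+ 2 * (2 * K) ^+ 2 by nneg.
have {}ss := ler_wpM2l C0 ss.
set w := 2 * #|{: St}|%:R * th in TB; have w1 : w <= 2^-1 by rewrite /w; move: cs; clear; lra.
have th00 := ltW th0; have w0 : 0 <= w by rewrite /w; nneg.
have fin : - e + sig (n := n) h * K * G - 2 * b * n%:R ^+ 2 * (2 * K) ^+ 2 * sig (n := n) h ^+ 2
    <= z0 + th * T.
  set q := 2 * b * n%:R ^+ 2 * (2 * K) ^+ 2 * sig (n := n) h ^+ 2.
  have q0 : 0 <= q by rewrite /q; nneg.
  have g1 : 0 <= sig (n := n) h * K * G by nneg.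
  have ze : - e + 2 * (sig (n := n) h * K * G) - q <= z0.
    by move: gain; rewrite /q; clear; lra.
  have : (1 - w) * (- e + 2 * (sig (n := n) h * K * G) - q) <= (1 - w) * z0.
    by rewrite ler_wpM2l //; move: w1; clear; lra.
  have : w * (sig (n := n) h * K * G) <= 2^-1 * (sig (n := n) h * K * G) by rewrite ler_wpM2r.
  have : 0 <= w * q by rewrite mulr_ge0.
  move: TB; clear; lra.
move: fin ex ey ss; rewrite /G; clear; lra.
Qed.

Definition G0 (Q : 'I_n -> 'I_n -> R) p : R := \sum_s quad Q (dir s p) + Hp p.

Lemma Gop_consist f df (ddf : 'I_n -> 'I_n -> V -> R) C L h p B1 x : tay f df C ->
  (forall i, tay (df i) (fun j => ddf j i) L) -> 0 <= L -> 0 < h -> 0 <= B1 ->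
  (forall i, `|p i| <= B1) ->
  `|Gop f h p x - G0 (fun j i => ddf j i x) p| <= #|{: St}|%:R * (2 * L * Zc (n := n) B1 ^+ 3) * h.
Proof.
move=> fC dfL L0 h0 B10 pB; have h2 : 0 < h ^+ 2 by rewrite exprn_gt0.
have -> : #|{: St}|%:R * (2 * L * Zc (n := n) B1 ^+ 3) * h = \sum_(s : St) (2 * L * Zc (n := n) B1 ^+ 3 * h).
  by rewrite sumr_const -[_ *+ _]mulr_natl; ring.
have -> : Gop f h p x - G0 (fun j i => ddf j i x) p =
   \sum_s h ^- 2 * (sdiff f (h *: dir s p) x - quad (fun j i => ddf j i x) (h *: dir s p)).
  rewrite /Gop /G0 opprD addrACA subrr addr0 mulr_sumr -sumrB; apply: eq_bigr => s _.
  have se k : (h *: dir s p) 0 k = h * dir s p 0 k by rewrite mxE.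
  rewrite [RHS]mulrBr; congr (_ - _); rewrite /quad mulr_sumr; apply: eq_bigr => i _.
  rewrite mulr_sumr; apply: eq_bigr => j _; rewrite !se; field; exact: lt0r_neq0.
apply: le_trans (ler_norm_sum _ _ _) _; apply: ler_sum => s _.
rewrite normrM gtr0_norm ?invr_gt0 // ler_pdivrMl //.
apply: le_trans (tay2_sdiff x _ fC dfL) _; rewrite nmZ (gtr0_norm h0) exprMn.
have -> : h ^+ 2 * (2 * L * Zc (n := n) B1 ^+ 3 * h) = 2 * L * (h ^+ 3 * Zc (n := n) B1 ^+ 3) by ring.
rewrite ler_wpM2l ?mulr_ge0 // ler_wpM2l ?exprn_ge0 ?(ltW h0) //.
by rewrite lerXn2r ?nnegrE ?nm_ge0 ?Zc_ge0 // nm_dir.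
Qed.

Lemma Hp_bdd p B1 : (forall i, `|p i| <= B1) -> `|Hp p| <= Vm B1 ^+ 2 * (`|c| + `|c0| * Vm B1).
Proof.
move=> pB; have vp := vel_bdd pB; rewrite -/(Vm B1) in vp; have v0 := ltW (vel_gt0 p).
rewrite /Hp normrM; apply: ler_pM => //; first by rewrite -expr2 ger0_norm ?sqr_ge0 // lerXn2r ?nnegrE // Vm_ge0.
apply: le_trans (ler_normD _ _) _; rewrite lerD2l normrM normrN ler_wpM2l // ger0_norm //.
Qed.

(** Near concavity, tested on segments of half length of order [r], bounds [quad Q z] from above for
    all [z] of moderate size. The sum over the directions is bounded below by the lower bound on
    [Gop], so each pure second derivative is bounded below, and polarization along [e_i + e_j] and
    [e_i - e_j] gives the mixed ones. The third order bound [L] is only weighed against [r] and [h]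
    and is absent from the result. *)
Lemma hess_bound f df (ddf : 'I_n -> 'I_n -> V -> R) C L h p B1 e r x :
  tay f df C -> (forall i, tay (df i) (fun j => ddf j i) L) ->
  (forall i j x z, `|ddf j i (x + z) - ddf j i x| <= L * nm z) ->
  0 <= L -> 0 < h -> 0 <= B1 -> (forall i, `|p i| <= B1) ->
  (forall x y, - e <= cvx f 2^-1 x y) ->
  0 < r -> 2 * L * r * (Zc (n := n) B1 + 2) ^+ 3 <= 1 -> 2 * e <= r ^+ 2 ->
  #|{: St}|%:R * (2 * L * Zc (n := n) B1 ^+ 3) * h <= 1 ->
  - 1 <= Gop f h p x ->
  forall i j, `|ddf j i x| <= 3 + Vm B1 ^+ 2 * (`|c| + `|c0| * Vm B1) + 2 * #|{: St}|%:R.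
Proof.
move=> fC dfL ddfL L0 h0 B10 pB Ze r0 Lr er hs Gx i j.
have Z0 := Zc_ge0 (n := n) B10.
set Q := fun j i => ddf j i x; set HB := Vm B1 ^+ 2 * _.
have up z : nm z <= Zc (n := n) B1 + 2 -> quad Q z <= 2.
  move=> nz; have t1 := tay2_sdiff x (r *: z) fC dfL; rewrite -/Q in t1.
  have qr : quad Q (r *: z) = r ^+ 2 * quad Q z.
    rewrite /quad mulr_sumr; apply: eq_bigr => a _; rewrite mulr_sumr; apply: eq_bigr => b _.
    by rewrite !mxE; ring.
  rewrite qr nmZ (gtr0_norm r0) in t1.
  have := Ze (x + r *: z) (x - r *: z); rewrite /cvx.
  have -> : 2^-1 *: (x + r *: z) + (1 - 2^-1) *: (x - r *: z) = x.
    have -> : (1 - 2^-1 : R) = 2^-1 by field.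
    rewrite -scalerDr addrACA subrr addr0 -mulr2n -[x *+ 2]scaler_nat scalerA mulVf ?scale1r //.
  have r2 : 0 < r ^+ 2 by rewrite exprn_gt0.
  move: t1; rewrite ler_norml => /andP[t1 _] t2; rewrite -(ler_pM2l r2).
  have n3 : nm z ^+ 3 <= (Zc (n := n) B1 + 2) ^+ 3.
    by rewrite lerXn2r ?nnegrE ?nm_ge0 // addr_ge0.
  have : 2 * L * (r * nm z) ^+ 3 <= r ^+ 2 * 1.
    have -> : 2 * L * (r * nm z) ^+ 3 = r ^+ 2 * (2 * L * r * nm z ^+ 3) by ring.
    rewrite ler_wpM2l ?(ltW r2) // (le_trans _ Lr) // ler_wpM2l //; apply: mulr_ge0; [nneg|exact: ltW].
  move: t1 t2 er; clear; lra.
have sm : - 2 <= G0 Q p.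
  have := Gop_consist x fC dfL L0 h0 B10 pB; rewrite -/Q ler_norml => /andP[_ h1].
  move: h1 hs Gx; clear; lra.
have Hb := Hp_bdd pB; rewrite -/HB in Hb.
have diag k : - (2 + HB + 2 * #|{: St}|%:R) <= Q k k.
  move: sm; rewrite /G0 (bigD1 (inl k)) //= dir_inl -[delta_mx _ _]scale1r quad_delta expr1n mul1r.
  have : \sum_(s | s != inl k) quad Q (dir s p) <= 2 * #|{: St}|%:R.
    apply: (@le_trans _ _ (\sum_(s : St | s != inl k) 2)).
      by apply: ler_sum => s _; apply: up; rewrite (le_trans (nm_dir _ pB)) // lerDl.
    have -> : 2 * #|{: St}|%:R = \sum_(s : St) 2 :> R by rewrite sumr_const -[RHS]mulr_natr.
    by rewrite [X in _ <= X](bigID (fun s => s != inl k)) /= lerDl sumr_ge0.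
  move: Hb; rewrite ler_norml => /andP[_]; clear; lra.
have sym a b : Q a b = Q b a by exact: (tay_sym x a b fC dfL ddfL).
have qd a b (s : R) : s ^+ 2 = 1 -> quad Q (1 *: delta_mx 0 a + s *: delta_mx 0 b)
     = Q a a + Q b b + 2 * s * Q a b.
  move=> s2; have -> : quad Q (1 *: delta_mx 0 a + s *: delta_mx 0 b) =
     \sum_i (\sum_k Q k i * (1 *: delta_mx 0 a + s *: delta_mx 0 b : V) 0 k)
        * (1 *: delta_mx 0 a + s *: delta_mx 0 b : V) 0 i.
    by apply: eq_bigr => i' _; rewrite mulr_suml.
  have sd (F : 'I_n -> R) : \sum_k F k * (1 *: delta_mx 0 a + s *: delta_mx 0 b : V) 0 k = F a + s * F b.
    under eq_bigr do rewrite mxE mulrDr.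
    by rewrite big_split /= (sum_delta F) (sum_delta F) mul1r.
  under eq_bigr do rewrite sd; rewrite sd (sym b a).
  have -> : Q a a + s * Q a b + s * (Q a b + s * Q b b) = Q a a + s ^+ 2 * Q b b + 2 * s * Q a b by ring.
  by rewrite s2 mul1r.
have nd a b (s : R) : `|s| = 1 -> nm (1 *: delta_mx 0 a + s *: delta_mx 0 b : V) <= Zc (n := n) B1 + 2.
  move=> s1; apply: le_trans (nmD _ _) _; rewrite !nm_delta s1 normr1; move: Z0; clear; lra.
have u1 := up _ (nd j i 1 (normr1 _)); rewrite qd ?expr1n // in u1.
have u2 := up _ (nd j i (-1) ltac:(by rewrite normrN normr1)); rewrite qd ?sqrrN ?expr1n // in u2.
have d1 := diag i; have d2 := diag j; rewrite -/(Q j i).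
rewrite ler_norml; move: u1 u2 d1 d2; clear => *; apply/andP; split; lra.
Qed.

End monotone.

(** * The iterated scheme on a finite time interval *)

Section iteration.
Context {R : realType} {n : nat}.
Notation V := 'rV[R]_n.
Notation St := ('I_n + 'I_n * 'I_n)%type.
Notation jets := (seq 'I_n -> V -> R).
Implicit Types (x y z : V) (f : V -> R) (s : St) (J : seq 'I_n) (U : jets) (h : R)
  (p q : 'I_n -> R).

Lemma jet_ordb U k : isjet U -> (0 < k)%N -> exists2 b : R, 0 <= b & ordb U k b.
Proof.
move=> ju k0.
have /choice[b Hb] : forall J, exists b, size J = k -> bdd (U J) b.
  move=> J; have [J0|J0] := eqVneq J [::].
    by exists 0 => Jk; move: k0; rewrite -Jk J0.
  by have [b Hb] := ju.1 J J0; exists b.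
exists (\sum_(J <- words k) `|b J|); first exact: sumr_ge0.
move=> J Jk; apply: bdd_le (Hb J Jk); apply: le_trans (ler_norm _) _.
apply: (@ler_sum_mem _ _ _ (fun J => `|b J|)) => [|K]; first by rewrite mem_words Jk.
exact: normr_ge0.
Qed.

Lemma lip_ordb1 U B1 : isjet U ->
  (forall i t x, `|U [::] (x + t *: delta_mx 0 i) - U [::] x| <= B1 * `|t|) -> ordb U 1 B1.
Proof.
move=> ju UL [|i [|//]] //= _ x; have [C0 /tay_pos[C Cge0 HC]] := ju.2 [::].
rewrite leNgt; apply/negP => lt; pose d := `|U [:: i] x| - B1; have d0 : 0 < d by rewrite subr_gt0.
pose t := d / (C + 1); have C1 : 0 < C + 1 by rewrite ltr_wpDl.
have t0 : 0 < t by rewrite divr_gt0.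
have := HC x (t *: delta_mx 0 i); rewrite (sum_delta (fun i => U [:: i] x)) nm_delta (gtr0_norm t0).
have := UL i t x; rewrite (gtr0_norm t0); set D := _ - U [::] x => h1 h2.
have h3 : t * `|U [:: i] x| <= B1 * t + C * t ^+ 2.
  rewrite -[X in X * _ <= _](gtr0_norm t0) -normrM.
  have -> : t * U [:: i] x = D - (D - t * U [:: i] x) by ring.
  by apply: (le_trans (ler_normB _ _)); apply: lerD.
have h4 : t * d <= C * t ^+ 2 by rewrite /d; move: h3; clear; lra.
have h5 : d = t * (C + 1) by rewrite /t divfK // gt_eqF.
have h6 : t * t * (C + 1) <= t * t * C by rewrite -mulrA -h5; move: h4; clear; lra.
have tt : 0 < t * t by rewrite mulr_gt0.
by move: h6 tt; clear; nra.
Qed.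

Variables (c c0 B1 : R) (U0 : jets).
Hypotheses (B10 : 0 <= B1) (ju0 : isjet U0).

Section bounds.
Variable B2 : R.
Hypotheses (B20 : 0 <= B2).

Definition base U := ordb U 1 B1 /\ ordb U 2 B2.

(** [I] is an invariant of the step that implies bounds up to order [k]; the bound [e] on the next
    order limits the mesh but not [b]. Orders 1 and 2 are left to [base], so that the third order is
    known at a new step before the second one has been bounded there. *)
Definition Good k (b : R) (I : jets -> Prop) :=
  [/\ B1 <= b, B2 <= b, I U0, forall U, I U -> forall j, (2 < j <= k)%N -> ordb U j b
    & forall e, 0 <= e -> exists2 h1, 0 < h1 & forall h, 0 < h < h1 -> forall U,
        isjet U -> base U -> I U -> ordb U k.+1 e -> I (nxt c c0 h U)].

Lemma Good_ordb k b I U j : Good k b I -> base U -> I U -> (0 < j <= k)%N -> ordb U j b.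
Proof.
move=> [b1 b2 _ H _] [U1 U2] IU /andP[j0 jk].
case: j j0 jk => [|[|[|j]]] // _ jk; [exact: ordb_le U1|exact: ordb_le U2|exact: H].
Qed.

Lemma Good2 : Good 2 (B1 + B2) (fun _ => True).
Proof.
split=> //; rewrite ?lerDl ?lerDr //; last by move=> e _; exists 1.
by move=> U _ j; case: j => [|[|[|j]]].
Qed.

(** The bound [q] on order [k + 1] provided by the new functional is the [e] that the previous level
    asks for; the threshold is the smaller of the two. *)
Lemma GoodS k b I : base U0 -> (1 < k)%N -> Good k b I ->
  exists b' I', Good k.+1 b' I' /\ forall U, I' U -> I U.
Proof.
move=> base0 k1 G; have [b1 b2 I0 Ib In] := G; have b0 := le_trans B10 b1.
have [e0 e00 Ue0] := jet_ordb ju0 (ltn0Sn k).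
have [q [a [q1 a0 init step]]] := @refined_exists R n c c0 _ _ _ _ B10 b0 e00 k1.
have q0 : 0 <= q := le_trans ler01 q1.
exists (b + q), (fun U => I U /\ forall x, vsq U k.+1 x + a * vsq U k x <= q ^+ 2); split; last by move=> U [].
have Uq U : (forall x, vsq U k.+1 x + a * vsq U k x <= q ^+ 2) -> ordb U k.+1 q.
  move=> UP; apply: ordb_vsq => // x; apply: le_trans (UP x).
  by rewrite lerDl mulr_ge0 // vsq_ge0.
split.
- by rewrite ler_wpDr.
- by rewrite ler_wpDr.
- split=> //; apply: init => //; apply: Good_ordb G base0 I0 _.
  by rewrite leqnn (ltn_trans _ k1).
- move=> U [IU UP] j /andP[j2 jk].
  have [jk'|kj] := leqP j k.
    by apply: ordb_le (Ib U IU j _); rewrite ?lerDl // j2.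
  have -> : j = k.+1 by apply/eqP; rewrite eqn_leq jk.
  by apply: ordb_le (Uq U UP); rewrite lerDr.
move=> e ee0; have [h1 h10 H1] := In q q0; have [h2 h20 H2] := step e ee0.
exists (Num.min h1 h2); first by rewrite lt_min h10.
move=> h; rewrite lt_min => /and3P[h0 hh1 hh2] U ju bU [IU UP] Ue; split.
  by apply: H1; rewrite ?h0 //; exact: Uq.
apply: H2; rewrite ?h0 //; first exact: bU.1.
by move=> j jk; exact: Good_ordb G bU IU jk.
Qed.

(** Dependent choice along the orders. The invariants are nested, so a high level implies each lower
    one with a constant that was fixed before the higher levels. *)
Lemma Good_chain : base U0 -> exists (b : nat -> R) (I : nat -> jets -> Prop),
  (forall k, Good k.+2 (b k) (I k)) /\ forall k U, I k.+1 U -> I k U.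
Proof.
move=> base0; pose T k := {p : R * (jets -> Prop) | Good k.+2 p.1 p.2}.
have step k (s : T k) : {s' : T k.+1 | forall U, (sval s').2 U -> (sval s).2 U}.
  apply: cid; case: s => [[b I] /= G].
  have [b' [I' [G' H]]] := @GoodS k.+2 b I base0 isT G.
  by exists (exist _ (b', I') G').
pose F := fix F k : T k :=
  if k is k'.+1 then sval (step k' (F k')) else exist _ (B1 + B2, fun _ => True) Good2.
exists (fun k => (sval (F k)).1), (fun k => (sval (F k)).2); split.
  by move=> k; exact: (svalP (F k)).
by move=> k U; exact: (svalP (step k (F k))).
Qed.

End bounds.

Variable Pl : ('I_n -> R) -> R -> Prop.
Definition plane p (g : R) x : R := \sum_i p i * x 0 i + g.

Hypotheses
  (conc0 : forall t x y, 0 <= t <= 1 -> 0 <= cvx (U0 [::]) t x y)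
  (lip0 : forall i t x, `|U0 [::] (x + t *: delta_mx 0 i) - U0 [::] x| <= B1 * `|t|)
  (sub0 : forall x, 0 <= G0 c c0 (fun j i => U0 [:: j; i] x) (fun i => U0 [:: i] x))
  (Pl0 : forall p g, Pl p g -> Hp c c0 p = 0)
  (PlB : forall p g i, Pl p g -> `|p i| <= B1)
  (PlU : forall p g x, Pl p g -> U0 [::] x <= plane p g x).

Lemma Sop_shift h f a x : Sop c c0 h (fun y => f (y + a)) x = Sop c c0 h f (x + a).
Proof.
rewrite /Sop; have -> : dgr (fun y => f (y + a)) h x = dgr f h (x + a).
  by apply/funext => i; rewrite /dgr /cdiff (addrAC x (- _) a) (addrAC x (h *: _) a).
congr (_ + _ * (_ * _ + _)); apply: eq_bigr => s _.
by rewrite /sdiff (addrAC x (- _) a) (addrAC x (h *: _) a).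
Qed.

Lemma plane_D p g x y : plane p g (x + y) = plane p g x + \sum_i p i * y 0 i.
Proof.
rewrite /plane addrAC -big_split; congr (_ + _); apply: eq_bigr => i _ /=.
by rewrite mxE mulrDr.
Qed.

Lemma plane_dgr p g h x i : h != 0 -> dgr (plane p g) h x i = p i.
Proof.
move=> h0; rewrite /dgr /cdiff -scaleNr !plane_D !(sum_delta p); by field.
Qed.

Lemma Sop_plane h p g x : h != 0 -> Hp c c0 p = 0 -> Sop c c0 h (plane p g) x = plane p g x.
Proof.
move=> h0 p0; rewrite /Sop; have -> : dgr (plane p g) h x = p.
  by apply/funext => i; exact: plane_dgr.
rewrite /Gop p0 big1 ?mulr0 ?addr0 ?mulr0 ?addr0 // => s _.
rewrite /sdiff !plane_D; set z := h *: _.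
have -> : \sum_i p i * (- z) 0 i = - \sum_i p i * z 0 i.
  by rewrite -sumrN; apply: eq_bigr => i _; rewrite mxE mulrN.
ring.
Qed.

Definition flow h m : jets := iter m (nxt c c0 h) U0.

Lemma small_step1 (Xs : seq R) : exists2 h1 : R, 0 < h1 &
  forall h, 0 < h < h1 -> h <= 1 /\ forall X, X \in Xs -> X * h <= 1.
Proof.
set Y := \sum_(X <- Xs) `|X|; have Y0 : 0 <= Y by exact: sumr_ge0.
exists (1 + Y)^-1; first by rewrite invr_gt0; lra.
move=> h /andP[h0 h1].
have h2 : h * (1 + Y) < 1 by rewrite -ltr_pdivlMr ?div1r //; lra.
have h3 : h <= 1 by nra.
split=> // X XX; have XY : X <= Y.
  by rewrite /Y (big_rem X) //= (le_trans (ler_norm X)) // lerDl sumr_ge0.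
have : X * h <= Y * h by rewrite ler_wpM2r // ltW.
lra.
Qed.

Definition hessB : R := 3 + Vm (n := n) B1 ^+ 2 * (`|c| + `|c0| * Vm (n := n) B1) + 2 * #|{: St}|%:R.

Ltac keep_section := clear - R n c c0 B1 U0 B10 ju0 Pl conc0 lip0 sub0 Pl0 PlB PlU.

Lemma discrete_flow : exists (bb : nat -> R) (C : R), 0 <= C /\ forall K T, 0 <= T ->
  exists2 h1, 0 < h1 & forall h, 0 < h < h1 -> h <= 1 /\ forall m, m%:R * sig (n := n) h <= T ->
  [/\ isjet (flow h m), forall j, (0 < j <= K)%N -> ordb (flow h m) j (bb j),
      forall t x y, 0 <= t <= 1 -> - (C * T * h) <= cvx (flow h m [::]) t x y,
      forall x, U0 [::] x - C * T * h <= flow h m [::] x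
    & (forall p g x, Pl p g -> flow h m [::] x <= plane p g x) /\
      forall x, - (C * h) <= Gop c c0 (flow h m [::]) h (dgr (flow h m [::]) h x) x].
Proof.
have Z0 := Zc_ge0 (n := n) B10.
have [b20 b200 Ub20] := jet_ordb ju0 (ltn0Sn 1).
have [L0 L00 UL0] := jet_ordb ju0 (ltn0Sn 2).
pose B2 := hessB + b20.
have hB0 : 0 <= hessB by have := Vm_ge0 (n := n) B1 => ?; rewrite /hessB; nneg.
have B20 : 0 <= B2 by rewrite addr_ge0.
have base0 : base B2 U0 by split; [exact: lip_ordb1|apply: ordb_le Ub20; rewrite lerDr].
have [b [I [HG HI]]] := Good_chain B20 base0.
pose KM := Kmv (n := n) c c0 B2 B1.
have KM0 : 0 <= KM.
  by have := KH_ge0 (n := n) c c0 B1; rewrite /KM /Kmv => ?; nneg.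
pose CZ := 2 * B2 * n%:R ^+ 2 * (2 * KM) ^+ 2 + 2 * KM * n%:R * B2.
have CZ0 : 0 <= CZ by rewrite /CZ; nneg.
pose CG := #|{: St}|%:R * (2 * L0 * Zc (n := n) B1 ^+ 3) + KM * (n%:R * B2).
have CG0 : 0 <= CG by rewrite /CG; nneg.
exists b, (CZ + CG); split; first by rewrite addr_ge0.
move=> K T T0; pose k := K.+1.
have [b1k b2k Ik0 _ step] := HG k; have bk0 : 0 <= b k := le_trans B10 b1k.
have [A A0 crude] := @crude_exists R n c c0 _ _ _ B10 bk0 (ltn0Sn K : 2 < k.+2)%N.
have [e0 e00 Ue0] := jet_ordb ju0 (ltn0Sn k.+2).
pose E0 := 1 + (size (words (n := n) k.+3))%:R * e0 ^+ 2.
have E01 : 1 <= E0 by rewrite /E0 lerDl; nneg.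
(* The exponential bound up to time [T] for order [k + 3], just above the orders covered by the
   invariant [I k]. *)
pose Em := E0 * expR (A * T).
have AT : 1 <= expR (A * T) by rewrite -[X in X <= _]expR0 ler_expR mulr_ge0.
have Em1 : 1 <= Em by rewrite -[X in X <= _]mulr1 ler_pM.
have [h1 h10 H1] := crude Em; have [h2 h20 H2] := step Em (le_trans ler01 Em1).
(* The step length at which second differences determine the Hessian up to 1, given the third order
   bound [b k]. *)
pose r := (1 + 2 * b k * (Zc (n := n) B1 + 2) ^+ 3)^-1.
have bz0 : 0 <= 2 * b k * (Zc (n := n) B1 + 2) ^+ 3 by nneg.
have r0 : 0 < r by rewrite invr_gt0 ltr_wpDr.
have rb : 2 * b k * r * (Zc (n := n) B1 + 2) ^+ 3 <= 1.
  rewrite mulrAC /r ler_pdivrMr ?ltr_wpDr // mul1r lerDr //.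
have [h3 h30 H3] := small_step1 [:: KM; 2 * (CZ * T) / r ^+ 2;
   #|{: St}|%:R * (2 * b k * Zc (n := n) B1 ^+ 3); CG].
exists (Num.min h1 (Num.min h2 h3)); first by rewrite !lt_min h10 h20.
move=> h; rewrite !lt_min => /and4P[h0 hh1 hh2 hh3].
have [hle1 hX] := H3 h ltac:(by rewrite h0); split=> // {H3}.
have hK := hX KM ltac:(by rewrite !inE eqxx ?orbT).
have hr := hX (2 * (CZ * T) / r ^+ 2) ltac:(by rewrite !inE eqxx ?orbT).
have hS := hX (#|{: St}|%:R * (2 * b k * Zc (n := n) B1 ^+ 3)) ltac:(by rewrite !inE eqxx ?orbT).
have hC := hX CG ltac:(by rewrite !inE eqxx ?orbT).
have hn0 : h != 0 by rewrite gt_eqF.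
have h01 : 0 < h <= 1 by rewrite h0.
have sg0 : 0 < sig (n := n) h by rewrite mulr_gt0 ?theta_gt0 // exprn_gt0.
set sg := sig h in sg0.
pose u m := flow h m [::].
have uS m x : u m.+1 x = Sop c c0 h (u m) x by [].
have uG m x : u m.+1 x - u m x = sg * Gop c c0 (u m) h (dgr (u m) h x) x.
  by rewrite uS /Sop addrAC subrr add0r.
have ju m : isjet (flow h m) by elim: m => //= m IH; exact: isjet_next.
(* The Lipschitz bound follows by comparison with translates, the growth in time by comparison of
   consecutive iterates, the upper bound by comparison with stationary planes. The loss [CG * h] is
   the consistency error of the initial subsolution. *)
pose Inv m := [/\ base B2 (flow h m), I k (flow h m),
   forall x, vsq (flow h m) k.+3 x <= E0 * expR (A * (m%:R * sg)),
   forall t x y, 0 <= t <= 1 -> - (CZ * (m%:R * sg) * h) <= cvx (u m) t x y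
 & [/\ forall i t x, `|u m (x + t *: delta_mx 0 i) - u m x| <= B1 * `|t|,
      forall x, - (sg * (CG * h)) <= u m.+1 x - u m x
    & forall p g x, Pl p g -> u m x <= plane p g x]].
have dgrB m : ordb (flow h m) 1 B1 -> forall x i, `|dgr (u m) h x i| <= B1.
  by move=> U1 x i; exact: dgr_bdd.
have main m : m%:R * sg <= T -> Inv m.
  elim: m => [_|m IH mT].
    split=> //.
    - move=> x; rewrite mul0r mulr0 expR0 mulr1 (le_trans (vsq_ordb x Ue0)) // lerDr //.
    - by move=> t x y t01; rewrite mul0r mulr0 mul0r oppr0; exact: conc0.
    split=> // x; rewrite uG -mulrN ler_wpM2l ?(ltW sg0) //.
    have C0 := jet_C11 ju0 base0.2.
    have D1 i : `|U0 [:: i] x| <= B1 by exact: base0.1.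
    have g1 := Gop_move c c0 x C0 B20 h0 B10 (dgrB 0%N base0.1 x) D1.
    have [Ct HCt] := ju0.2 [::].
    have g2 := @Gop_consist _ _ c c0 _ _ (fun j i => U0 [:: j; i]) _ L0 h _ B1 x HCt
      (fun i => jet_tay (J := [:: i]) ju0 UL0) L00 h0 B10 D1.
    have g3 : \sum_i `|dgr (u 0%N) h x i - U0 [:: i] x| <= n%:R * (B2 * h).
      by rewrite mulrn_sum; apply: ler_sum => i _; exact: (C11_dgr i x C0 h0).
    have g4 := ler_wpM2l KM0 g3.
    move: g1 g2; rewrite -/KM !ler_norml => /andP[g1 _] /andP[g2 _].
    have g5 := sub0 x; rewrite /CG.
    move: g1 g2 g4 g5; rewrite /u /flow /=; keep_section; lra.
  have mT' : m%:R * sg <= T.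
    by apply: le_trans mT; rewrite ler_wpM2r ?(ltW sg0) // ler_nat.
  have [[U1 U2] IU vE Zu [lipu lowu plu]] := IH mT'.
  have Uk j : (0 < j <= k.+2)%N -> ordb (flow h m) j (b k).
    by move=> jk; apply: (Good_ordb (HG k)) jk => //; split.
  have C2 := jet_C11 (ju m) U2.
  have EmE : E0 * expR (A * (m%:R * sg)) <= Em.
    by rewrite ler_wpM2l ?(le_trans ler01) // ler_expR ler_wpM2l.
  have Em' : 1 <= E0 * expR (A * (m%:R * sg)).
    have msg0 : 0 <= m%:R * sg by apply: mulr_ge0 => //; exact: ltW.
    by rewrite -[X in X <= _]mulr1 ler_pM // -[X in X <= _]expR0 ler_expR mulr_ge0.
  have Utop : ordb (flow h m) k.+3 Em.
    apply: ordb_vsq => [|x]; first exact: le_trans Em1.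
    apply: le_trans (vE x) (le_trans EmE _).
    by rewrite expr2 ler_peMr // (le_trans ler01).
  have lip1 i t x : `|u m.+1 (x + t *: delta_mx 0 i) - u m.+1 x| <= B1 * `|t|.
    have half a y : - (B1 * `|a|) <= u m.+1 (y + a *: delta_mx 0 i) - u m.+1 y.
      rewrite !uS -Sop_shift.
      apply: (@Sop_mono _ _ c c0 (fun y => u m (y + a *: delta_mx 0 i)) (u m) _ B2 B1 h _ y C2 B20 h01 B10 hK).
      - move=> z j; have -> : dgr (fun y => u m (y + a *: delta_mx 0 i)) h z = dgr (u m) h (z + a *: delta_mx 0 i).
          by apply/funext => l; rewrite /dgr /cdiff (addrAC z (- _)) (addrAC z (h *: _)).
        exact: dgrB.
      - exact: dgrB.
      - by move=> z; have := lipu i a z; rewrite ler_norml => /andP[].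
    rewrite ler_norml half /=; have := half (- t) (x + t *: delta_mx 0 i).
    rewrite scaleNr addrK normrN; keep_section; lra.
  have V1 : ordb (flow h m.+1) 1 B1 by exact: lip_ordb1.
  have low1 x : - (sg * (CG * h)) <= u m.+2 x - u m.+1 x.
    rewrite (uS m.+1) (uS m).
    by apply: (@Sop_mono _ _ c c0 (u m.+1) (u m) _ B2 B1 h _ x C2 B20 h01 B10 hK) => //; exact: dgrB.
  have IU1 : I k (flow h m.+1).
    by apply: H2; rewrite ?h0.
  have Z1 t x y : 0 <= t <= 1 -> - (CZ * (m.+1%:R * sg) * h) <= cvx (u m.+1) t x y.
    move=> t01; have := @Sop_concave _ _ c c0 (u m) _ B2 B1 t h _ C2 B20 t01 h01 B10 (dgrB m U1) (fun x y => Zu t x y t01) x y.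
    rewrite -/KM -/CZ -/sg => hz; apply: le_trans hz.
    by rewrite le_eqVlt; apply/orP; left; apply/eqP; rewrite -natr1; ring.
  split=> //.
  (* Second derivatives at the new step: the third order bound required by [hess_bound] comes from
     the invariant alone. *)
  - split=> // -[|i [|j [|//]]] //= _ x.
    have [b1' b2' _ Ib _] := HG k.
    have V3 : ordb (flow h m.+1) 3 (b k) by exact: Ib.
    have [Ct HCt] := (ju m.+1).2 [::].
    apply: (le_trans _ (_ : hessB <= B2)); last by rewrite lerDl.
    apply: (@hess_bound _ _ c c0 (u m.+1) _ (fun j i => flow h m.+1 [:: j; i]) _ (b k) h
       (dgr (u m.+1) h x) B1 (CZ * (m.+1%:R * sg) * h) r x HCt
       (fun i => jet_tay (J := [:: i]) (ju m.+1) V3)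
       (fun i j x z => jet_lip (J := [:: j; i]) x z (ju m.+1) V3)) => //.
    + exact: dgrB.
    + by move=> y z; apply: Z1; apply/andP; split; keep_section; lra.
    + have r2 : 0 < r ^+ 2 by rewrite exprn_gt0.
      have q1 : CZ * (m.+1%:R * sg) * h <= CZ * T * h.
        by rewrite ler_wpM2r ?(ltW h0) // ler_wpM2l.
      have q2 : 2 * (CZ * T) * h <= r ^+ 2.
        by move: hr; rewrite mulrAC ler_pdivrMr // mul1r.
      by move: q1 q2; keep_section; lra.
    + have := low1 x; rewrite uG -mulrN ler_pM2l // => q; apply: le_trans q.
      by rewrite lerN2.
  - have EE : 1 <= E0 * expR (A * (m%:R * sg)) <= Em by rewrite Em' EmE.
    move=> x; have := H1 h ltac:(by rewrite h0) (flow h m) _ (ju m) U1 Uk EE vE x.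
    move=> q; apply: le_trans q _; rewrite -mulrA ler_wpM2l ?(le_trans ler01) // -/sg.
    have -> : A * (m.+1%:R * sg) = A * (m%:R * sg) + A * sg by rewrite -natr1; ring.
    by rewrite expRD ler_wpM2l ?expR_ge0 // expR_ge1Dx.
  split=> // p g x Pg; rewrite uS -(Sop_plane g x hn0 (Pl0 Pg)) -subr_ge0.
  apply: (@Sop_mono _ _ c c0 (plane p g) (u m) _ B2 B1 h _ x C2 B20 h01 B10 hK).
  - by move=> z i; rewrite plane_dgr // (PlB i Pg).
  - exact: dgrB.
  - by move=> z; rewrite subr_ge0; exact: plu.
move=> m mT; have [bm Im vm Zm [lm lowm plm]] := main m mT.
have lowC m' x : m'%:R * sg <= T -> U0 [::] x - CG * (m'%:R * sg) * h <= u m' x.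
  elim: m' => [_|m' IH mT1]; first by rewrite mul0r mulr0 mul0r subr0.
  have mT' : m'%:R * sg <= T.
    by apply: le_trans mT1; rewrite ler_wpM2r ?(ltW sg0) // ler_nat.
  have [_ _ _ _ [_ lw _]] := main m' mT'; have := lw x; have := IH mT'.
  rewrite -natr1; keep_section; lra.
have mono (C T' : R) : 0 <= C -> C <= CZ + CG -> T' <= T -> 0 <= T' -> C * T' * h <= (CZ + CG) * T * h.
  by move=> C0' CC TT T'0; rewrite ler_wpM2r ?(ltW h0) // ler_pM.
have ms0 : 0 <= m%:R * sg by rewrite mulr_ge0 // ltW.
split=> //.
- move=> j /andP[j0 jK].
  (* Descending to level [j] yields the bound [bb j], which does not depend on [K]. *)
  have Ij : I j (flow h m).
    have jk : (j <= k)%N by rewrite ltnW // ltnS.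
    have : forall d, I (j + d)%N (flow h m) -> I j (flow h m).
      by elim=> [|d IH]; rewrite ?addn0 // addnS => /HI.
    by move=> /(_ (k - j)%N); rewrite subnKC //; exact.
  by apply: (Good_ordb (HG j)) => //; rewrite j0 /= ltnW // ltnW.
- move=> t x y t01; apply: le_trans (Zm t x y t01); rewrite lerN2; apply: mono => //.
  by rewrite lerDl.
- move=> x; apply: le_trans (lowC m x mT); rewrite lerD2l lerN2; apply: mono => //.
  by rewrite lerDr.
split=> // x; have := lowm x; rewrite uG -mulrN ler_pM2l // => q; apply: le_trans q.
by rewrite lerN2 ler_wpM2r ?(ltW h0) // lerDr.
Qed.

End iteration.

(** * Limit of the scheme *)

Section increments.
Context {R : realType} {n : nat}.
Notation V := 'rV[R]_n.
Notation St := ('I_n + 'I_n * 'I_n)%type.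
Notation jets := (seq 'I_n -> V -> R).
Implicit Types (x y z : V) (f : V -> R) (s : St) (J : seq 'I_n) (U : jets) (h b : R)
  (p q : 'I_n -> R).

Definition GD c c0 U x : R := G0 c c0 (fun j i => U [:: j; i] x) (fun i => U [:: i] x).

Lemma Gop_GD c c0 b : 0 <= b -> exists2 C, 0 <= C & forall U h x, isjet U -> 0 < h ->
  (forall j, (0 < j <= 3)%N -> ordb U j b) ->
  `|Gop c c0 (U [::]) h (dgr (U [::]) h x) x - GD c c0 U x| <= C * h.
Proof.
move=> b0; have Z0 := Zc_ge0 (n := n) b0.
have K0 : 0 <= Kmv (n := n) c c0 b b.
  by have := KH_ge0 (n := n) c c0 b; rewrite /Kmv => ?; nneg.
exists (Kmv (n := n) c c0 b b * (n%:R * b) + #|{: St}|%:R * (2 * b * Zc (n := n) b ^+ 3)).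
  by nneg.
move=> U h x ju h0 Ub; have [Ct HCt] := ju.2 [::].
have C2 := jet_C11 ju (Ub 2 isT); have U3 := Ub 3 isT.
have D1 i : `|U [:: i] x| <= b by exact: (Ub 1 isT).
have d1 i := dgr_bdd x i ju h0 (Ub 1 isT).
have g1 := Gop_move c c0 x C2 b0 h0 b0 d1 D1.
have g2 := @Gop_consist _ _ c c0 _ _ (fun j i => U [:: j; i]) _ b h _ b x HCt
  (fun i => jet_tay (J := [:: i]) ju U3) b0 h0 b0 D1.
have g3 : \sum_i `|dgr (U [::]) h x i - U [:: i] x| <= n%:R * (b * h).
  by rewrite mulrn_sum; apply: ler_sum => i _; exact: (C11_dgr i x C2 h0).
have g4 := ler_wpM2l K0 g3.
rewrite -(subrKA (Gop c c0 (U [::]) h (fun i => U [:: i] x) x)).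
apply: (le_trans (ler_normD _ _)); rewrite mulrDl.
apply: lerD; last by rewrite /GD; move: g2; rewrite mulrA.
by apply: (le_trans g1); apply: (le_trans g4); rewrite !mulrA.
Qed.

Lemma gam2_bound U h x k b B1 : isjet U -> 0 < h -> 0 <= B1 -> 0 <= b -> ordb U 1 B1 -> ordb U k.+1 b ->
  gam2 U h k x <= (size (words (n := n) k))%:R * (#|{: St * bool}|%:R * (b * Zc (n := n) B1) ^+ 2).
Proof.
move=> ju h0 B10 b0 U1 Uk; rewrite /gam2 ler_pdivrMl ?exprn_gt0 //.
have -> : h ^+ 2 * ((size (words (n := n) k))%:R * (#|{: St * bool}|%:R * (b * Zc (n := n) B1) ^+ 2))
  = \sum_(J <- words (n := n) k) \sum_(p : St * bool) (b * (h * Zc (n := n) B1)) ^+ 2.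
  by rewrite big_const_seq count_predT iter_addr_0 sumr_const -[RHS]mulr_natl -[_ *+ #|_|]mulr_natl; ring.
rewrite big_seq [X in _ <= X]big_seq; apply: ler_sum => J; rewrite mem_words => /eqP Jk.
apply: ler_sum => p _; rewrite -[X in X <= _]real_normK ?num_real // lerXn2r ?nnegrE //.
  by apply: mulr_ge0 => //; apply: mulr_ge0; [exact: ltW|exact: Zc_ge0].
have Uk' : ordb U (size J).+1 b by rewrite Jk.
apply: le_trans (jet_lip x _ ju Uk') _; rewrite ler_wpM2l //.
have -> : nm (stp h (U [::]) p x) = h * nm (zeta (U [::]) h p.1 x).
  by rewrite /stp nmZ; case: p.2; rewrite ?normrN gtr0_norm.
by rewrite ler_wpM2l ?(ltW h0) // nm_dir // => i; exact: dgr_bdd.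
Qed.

(** Four orders are used because the right-hand side contains two further derivatives of [d_J u],
    with [size J] at most 2. *)
Lemma rhs_bound c c0 b : 0 <= b -> exists2 C, 0 <= C & forall U h x J, isjet U -> 0 < h ->
  (forall j, (0 < j <= 4)%N -> ordb U j b) -> (0 < size J <= 2)%N -> `|rhs c c0 h U J x| <= C.
Proof.
move=> b0; have Z0 := Zc_ge0 (n := n) b0.
pose g : R := (size (words (n := n) 2))%:R * (#|{: St * bool}|%:R * (b * Zc (n := n) b) ^+ 2).
have g0 : 0 <= g by rewrite /g; nneg.
have bb := b1_ge1 (n := n) b0 b0; have bb0 : 0 <= b1 (n := n) b b := le_trans ler01 bb.
pose CE := \sum_(J <- words (n := n) 1 ++ words 2) bnd (b1 (n := n) b b) (EF c c0 J).
have CE0 : 0 <= CE by apply: sumr_ge0 => J _; exact: bnd_ge0.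
have s0 := sqrtr_ge0 g.
exists (#|{: St}|%:R * (2 * b * Zc (n := n) b ^+ 2) + CE * (1 + 2 * Num.sqrt g)); first by nneg.
move=> U h x J ju h0 Ub /andP[J0 J2].
have dB i : `|dgr (U [::]) h x i| <= b by exact: dgr_bdd (Ub 1 isT).
apply: (le_trans (ler_normD _ _)); apply: lerD.
  have h2 : 0 < h ^+ 2 by rewrite exprn_gt0.
  rewrite /Mop normrM gtr0_norm ?invr_gt0 // ler_pdivrMl //.
  have -> : h ^+ 2 * (#|{: St}|%:R * (2 * b * Zc (n := n) b ^+ 2)) = \sum_(s : St) 2 * b * (h * Zc (n := n) b) ^+ 2.
    by rewrite sumr_const -[RHS]mulr_natl; ring.
  apply: le_trans (ler_norm_sum _ _ _) _; apply: ler_sum => s _.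
  have Uk : ordb U (size J).+2 b by apply: Ub; rewrite /= !ltnS.
  apply: le_trans (tay_sdiff x _ (jet_tay ju Uk)) _; rewrite nmZ (gtr0_norm h0).
  have hz : h * nm (dir s (dgr (U [::]) h x)) <= h * Zc (n := n) b by rewrite ler_wpM2l ?(ltW h0) // nm_dir.
  apply: ler_wpM2l; first by rewrite mulr_ge0.
  by rewrite lerXn2r // nnegrE; apply: mulr_ge0; rewrite ?(ltW h0) ?nm_ge0.
have ee : env U h x 1 2 (b1 (n := n) b b) (1 + (1 + 2 * Zc (n := n) b) * 0)
   (2 * Num.sqrt (gam2 U h 2 x)).
  apply: env_of_ordb => //; [exact: (Ub 1 isT)| |].
    by move=> j /andP[j0 j2]; apply: Ub; rewrite j0 (leq_trans j2).
  by move=> j /andP[j0 j2]; move: j0; rewrite ltnNge j2.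
rewrite mulr0 addr0 in ee.
have gg : 0 <= 2 * Num.sqrt (gam2 U h 2 x) by rewrite mulr_ge0 ?sqrtr_ge0.
have := evalB bb (lexx 1) gg (isT : (0 < 1 < 2)%N) ee (okE_EF c c0 J) (leq_trans (msz_EF _ _ _) J2) (leq_trans (wt_EF _ _ _) (J2 : (size J < 3)%N)).
rewrite expr1n => H; apply: le_trans H _; apply: ler_pM.
- exact: bnd_ge0.
- by rewrite addr_ge0 ?mulr_ge0.
- rewrite /CE; apply: (ler_sum_mem (F := fun J => bnd (b1 (n := n) b b) (EF c c0 J))); last by move=> K; exact: bnd_ge0.
  by rewrite mem_cat !mem_words; case: J J0 J2 => [|? [|? []]].
rewrite lerD2l; apply: (@le_trans _ _ (1 * (2 * Num.sqrt (gam2 U h 2 x)))).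
  by rewrite ler_wpM2r // lern1 leq_b1.
rewrite mul1r ler_wpM2l // ler_sqrt //.
by apply: gam2_bound => //; [exact: (Ub 1 isT)|exact: (Ub 3 isT)].
Qed.

(** Two successive iterates differ by [sig] times the right-hand side, whose derivatives of orders 1
    and 2 are bounded. The velocity therefore changes by [O(sig)] in one step, a bound on the second
    time derivative. *)
Lemma Gop_time c c0 b : 0 <= b -> exists2 C, 0 <= C & forall U h x, isjet U -> 0 < h ->
  (forall j, (0 < j <= 4)%N -> ordb U j b) -> (forall j, (0 < j <= 2)%N -> ordb (nxt c c0 h U) j b) ->
  `|Gop c c0 (nxt c c0 h U [::]) h (dgr (nxt c c0 h U [::]) h x) x
     - Gop c c0 (U [::]) h (dgr (U [::]) h x) x| <= C * sig (n := n) h.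
Proof.
move=> b0; have Z0 := Zc_ge0 (n := n) b0; have [C C0 HC] := rhs_bound c c0 b0.
have K0 : 0 <= Kmv (n := n) c c0 b b.
  by have := KH_ge0 (n := n) c c0 b; rewrite /Kmv => ?; nneg.
exists (Kmv (n := n) c c0 b b * (n%:R * C) + #|{: St}|%:R * (2 * C * Zc (n := n) b ^+ 2)); first by nneg.
move=> U h x ju h0 Ub Nb; have jn := @isjet_next _ _ c c0 h (sig (n := n) h) U ju ltac:(by rewrite gt_eqF).
set U' := nxt c c0 h U in Nb jn *; have sg0 : 0 < sig (n := n) h by rewrite mulr_gt0 ?theta_gt0 // exprn_gt0.
pose W : jets := fun J x => U' J x + -1 * U J x.
have WE J y : W J y = sig (n := n) h * rhs c c0 h U J y by rewrite /W /U' /nxt /next mulN1r addrAC subrr add0r.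
have jW : isjet W.
  split=> J.
    move=> J0; have [b1 H1] := jn.1 J J0; have [b2 H2] := ju.1 J J0.
    exists (b1 + `|-1| * b2); apply: bddD => //; exact: (@bddM _ _ (fun=> -1)).
  have [t1 H1] := jn.2 J; have [t2 H2] := ju.2 J.
  by exists (t1 + `|-1| * t2); exact: tayD H1 (tayZ (-1) H2).
have WB k : (0 < k <= 2)%N -> ordb W k (sig (n := n) h * C).
  move=> kk J Jk y; rewrite WE normrM (gtr0_norm sg0) ler_wpM2l ?(ltW sg0) // HC // Jk //.
set p' := dgr (U' [::]) h x; set p := dgr (U [::]) h x.
have pB i : `|p i| <= b by exact: dgr_bdd (Ub 1 isT).
have p'B i : `|p' i| <= b by exact: dgr_bdd (Nb 1 isT).
have C2 := jet_C11 jn (Nb 2 isT).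
have g1 := Gop_move c c0 x C2 b0 h0 b0 p'B pB.
have g3 : \sum_i `|p' i - p i| <= n%:R * (sig (n := n) h * C).
  rewrite mulrn_sum; apply: ler_sum => i _.
  have -> : p' i - p i = dgr (W [::]) h x i by rewrite /p' /p /dgr /cdiff /W; ring.
  exact: dgr_bdd (WB 1 isT).
have g4 := ler_wpM2l K0 g3.
rewrite -(subrKA (Gop c c0 (U' [::]) h p x)).
apply: (le_trans (ler_normD _ _)); rewrite mulrDl; apply: lerD.
  apply: (le_trans g1); apply: (le_trans g4); rewrite le_eqVlt; apply/orP; left; apply/eqP; ring.
have -> : Gop c c0 (U' [::]) h p x - Gop c c0 (U [::]) h p x = h ^- 2 * \sum_s sdiff (W [::]) (h *: dir s p) x.
  rewrite /Gop opprD addrACA subrr addr0 -mulrBr -sumrB; congr (_ * _).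
  by apply: eq_bigr => s _; rewrite /sdiff /W; ring.
have h2 : 0 < h ^+ 2 by rewrite exprn_gt0.
rewrite normrM gtr0_norm ?invr_gt0 // ler_pdivrMl //.
have -> : h ^+ 2 * (#|{: St}|%:R * (2 * C * Zc (n := n) b ^+ 2) * sig (n := n) h) =
   \sum_(s : St) 2 * (sig (n := n) h * C) * (h * Zc (n := n) b) ^+ 2.
  by rewrite sumr_const -[RHS]mulr_natl; ring.
apply: le_trans (ler_norm_sum _ _ _) _; apply: ler_sum => s _.
apply: le_trans (tay_sdiff x _ (jet_tay (J := [::]) jW (WB 2 isT))) _; rewrite nmZ (gtr0_norm h0).
have sC : 0 <= sig (n := n) h * C by rewrite mulr_ge0 ?(ltW sg0).
have hz : h * nm (dir s p) <= h * Zc (n := n) b by rewrite ler_wpM2l ?(ltW h0) // nm_dir.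
apply: ler_wpM2l; first by rewrite mulr_ge0.
by rewrite lerXn2r // nnegrE; apply: mulr_ge0; rewrite ?(ltW h0) ?nm_ge0.
Qed.

End increments.

Lemma cvgF_sum {R : realType} {T : Type} {F : set_system T} {FF : Filter F} (I : Type)
  (r : seq I) (a : I -> T -> R) (l : I -> R) :
  (forall k, a k i @[i --> F] --> l k) ->
  \sum_(k <- r) a k i @[i --> F] --> \sum_(k <- r) l k.
Proof.
move=> H; elim: r => [|k r IH].
  by rewrite big_nil; under eq_fun do rewrite big_nil; exact: cvg_cst.
by rewrite big_cons; under eq_fun do rewrite big_cons; exact: cvgD (H k) IH.
Qed.

(** * Limits along an ultrafilter *)

Section ultralimits.
Context {R : realType} {n : nat}.
Notation V := 'rV[R]_n.
Notation jets := (seq 'I_n -> V -> R).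
Implicit Types (x y z : V) (J : seq 'I_n).
Variables (F : set_system nat) (UF : UltraFilter F).

(** An ultrafilter makes all bounded quantities converge together, so derivatives of all orders at
    all points have limits along the same filter and no diagonal extraction takes place. *)
Lemma ultra_cvg (a : nat -> R) (C : R) : F [set i | `|a i| <= C] ->
  exists l : R, a i @[i --> F] --> l.
Proof.
move=> FC; have Fp : ProperFilter F by exact: ultra_proper.
have aC : (a @ F) [set` `[- C, C]].
  by apply: filterS FC => i aC; rewrite /= in_itv /= -ler_norml; exact: aC.
have [p [_ pc]] := @segment_compact R (- C) C (a @ F) _ aC.
exists p => B pB; have [//|FB] := in_ultra_setVsetC (a @^-1` B) UF.
by have [y [nB yB]] := pc (~` B) B FB pB.
Qed.

Lemma cvgF_le (a : nat -> R) l m : a i @[i --> F] --> l -> F [set i | a i <= m] -> l <= m.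
Proof.
move=> al Fm; have Fp : ProperFilter F by exact: ultra_proper.
by have := limr_le (cvgP _ al) Fm; rewrite (cvg_lim (@Rhausdorff R) al); exact.
Qed.

Lemma cvgF_ge (a : nat -> R) l m : a i @[i --> F] --> l -> F [set i | m <= a i] -> m <= l.
Proof.
move=> al Fm; have Fp : ProperFilter F by exact: ultra_proper.
by have := limr_ge (cvgP _ al) Fm; rewrite (cvg_lim (@Rhausdorff R) al); exact.
Qed.

Lemma cvgF_norm_le (a : nat -> R) l m : a i @[i --> F] --> l -> F [set i | `|a i| <= m] -> `|l| <= m.
Proof.
move=> al Fm; have Fp : ProperFilter F by exact: ultra_proper.
exact: (cvgF_le (cvg_norm al)).
Qed.

(** The defining inequalities of a jet are closed once their constants are uniform; the Taylor
    constant at [J] is the bound on derivatives two orders higher. *)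
Lemma jets_ulim (W : nat -> jets) (bb : nat -> R) :
  F [set i | isjet (W i)] -> (forall k, (0 < k)%N -> F [set i | ordb (W i) k (bb k)]) ->
  (forall x, exists C, F [set i | `|W i [::] x| <= C]) ->
  exists Phi : jets, [/\ forall J x, W i J x @[i --> F] --> Phi J x, isjet Phi &
    forall k, (0 < k)%N -> ordb Phi k (bb k)].
Proof.
move=> jW Wb W0; have Fp : ProperFilter F by exact: ultra_proper.
have /choice[Phi HP] : forall Jx : seq 'I_n * V, exists l : R, W i Jx.1 Jx.2 @[i --> F] --> l.
  move=> [[|j J] x] /=; first by have [C HC] := W0 x; exact: ultra_cvg HC.
  apply: (@ultra_cvg _ (bb (size J).+1)); apply: filterS (Wb _ (ltn0Sn (size J))) => i /= Wi.
  exact: Wi.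
have HP' J x : W i J x @[i --> F] --> Phi (J, x) by exact: (HP (J, x)).
have ob k : (0 < k)%N -> ordb (fun J x => Phi (J, x)) k (bb k).
  move=> k0 J Jk x; apply: cvgF_norm_le (HP' J x) _.
  by apply: filterS (Wb k k0) => i /= Wi; exact: Wi.
exists (fun J x => Phi (J, x)); split=> //; split=> J.
  move=> J0; exists (bb (size J)); apply: (ob (size J)) => //.
  by rewrite lt0n size_eq0.
exists (bb (size J).+2) => x z.
have cv : W i J (x + z) - W i J x - \sum_k W i (k :: J) x * z 0 k @[i --> F] -->
   Phi (J, x + z) - Phi (J, x) - \sum_k Phi (k :: J, x) * z 0 k.
  apply: cvgB; first exact: cvgB.
  by apply: cvgF_sum => k; apply: cvgM => //; exact: cvg_cst.
apply: cvgF_norm_le cv _.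
apply: filterS2 jW (Wb _ (ltn0Sn (size J).+1)) => i jWi Wi.
exact: (jet_tay jWi Wi).
Qed.

Lemma GD_ulim c c0 (W : nat -> jets) (Phi : jets) x :
  (forall J x, W i J x @[i --> F] --> Phi J x) ->
  GD c c0 (W i) x @[i --> F] --> GD c c0 Phi x.
Proof.
move=> H; have Fp : ProperFilter F by exact: ultra_proper.
have cd s l : dir s (fun i => W k [:: i] x) 0 l @[k --> F] --> dir s (fun i => Phi [:: i] x) 0 l.
  rewrite mxE; under eq_fun do rewrite mxE; apply: cvgD; first exact: cvg_cst.
  by apply: cvgF_sum => m; apply: cvgM => //; exact: cvg_cst.
have cv : vel (fun i => W k [:: i] x) @[k --> F] --> vel (fun i => Phi [:: i] x).
  apply: (@cvg_comp _ _ _ (fun k => 1 + \sum_i W k [:: i] x ^+ 2) Num.sqrt F); last exact: sqrt_continuous.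
  apply: cvgD; first exact: cvg_cst.
  by apply: cvgF_sum => i; under eq_fun do rewrite expr2; rewrite expr2; exact: cvgM.
apply: cvgD.
  apply: cvgF_sum => s; apply: cvgF_sum => i; apply: cvgF_sum => j.
  by apply: cvgM => //; apply: cvgM.
apply: cvgM; first exact: cvgM.
by apply: cvgD; [exact: cvg_cst|apply: cvgM => //; exact: cvg_cst].
Qed.

End ultralimits.

(** * From the flow to a stationary solution *)

Section stationary.
Context {R : realType} {n : nat}.
Notation V := 'rV[R]_n.
Notation jets := (seq 'I_n -> V -> R).
Variables (c c0 B1 : R) (U0 : jets).
Hypotheses (B10 : 0 <= B1) (ju0 : isjet U0).
Variable Pl : ('I_n -> R) -> R -> Prop.
Hypothesis conc0 : forall t x y, 0 <= t <= 1 -> 0 <= cvx (U0 [::]) t x y.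
Hypothesis lip0 : forall i t x, `|U0 [::] (x + t *: delta_mx 0 i) - U0 [::] x| <= B1 * `|t|.
Hypothesis sub0 : forall x, 0 <= GD c c0 U0 x.
Hypothesis Pl0 : forall p g, Pl p g -> Hp c c0 p = 0.
Hypothesis PlB : forall p g i, Pl p g -> `|p i| <= B1.
Hypothesis PlU : forall p g x, Pl p g -> U0 [::] x <= plane p g x.
Implicit Types (x y : V) (h e s : R) (W : jets).
Local Ltac kp := clear - B10 ju0 conc0 lip0 sub0 Pl0 PlB PlU.

Definition admissible e W := [/\ isjet W, forall t x y, 0 <= t <= 1 -> - e <= cvx (W [::]) t x y,
  forall x, U0 [::] x - e <= W [::] x & forall p g x, Pl p g -> W [::] x <= plane p g x].

(** A velocity that falls at rate at most [C] keeps a positive value for a while, and the flow then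
    rises by a definite amount. A limit that no longer rises must thus have nonpositive velocity. *)
Lemma flow_increment h (C : R) (m q : nat) x : 0 < h -> 0 <= C ->
  (forall j, (j < q)%N -> let W := flow c c0 U0 h (m + j) in
    `|Gop c c0 (nxt c c0 h W [::]) h (dgr (nxt c c0 h W [::]) h x) x
     - Gop c c0 (W [::]) h (dgr (W [::]) h x) x| <= C * sig (n := n) h) ->
  let t := q%:R * sig (n := n) h in let W := flow c c0 U0 h m in
  t * (Gop c c0 (W [::]) h (dgr (W [::]) h x) x - C * t) <=
    flow c c0 U0 h (m + q) [::] x - W [::] x.
Proof.
move=> h0 C0 H; pose G j := let W := flow c c0 U0 h j in Gop c c0 (W [::]) h (dgr (W [::]) h x) x.
have sg0 : 0 < sig (n := n) h by rewrite mulr_gt0 ?theta_gt0 // exprn_gt0.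
have H1 j : (j < q)%N -> G (m + j).+1 - G (m + j)%N >= - (C * sig (n := n) h).
  by move=> /H /=; rewrite ler_norml => /andP[].
have H2 j : (j <= q)%N -> G (m + j)%N >= G m - C * (j%:R * sig (n := n) h).
  elim: j => [|j IH] jq; first by rewrite addn0 mul0r mulr0 subr0.
  have := IH (ltnW jq); have := H1 j jq; rewrite addnS -natr1.
  kp; lra.
rewrite /= -/(G m).
elim: q {H H1} H2 => [|q IH] H2; first by rewrite addn0 subrr !mul0r.
have := IH (fun j jq => H2 j (leqW jq)); have := H2 q (leqnSn q).
have -> : flow c c0 U0 h (m + q.+1) [::] x = flow c c0 U0 h (m + q) [::] x + sig (n := n) h * G (m + q)%N.
  by rewrite addnS /flow iterS nxt_Sop.
rewrite -natr1; set a := sig h in sg0 *; set u := flow c c0 U0 h (m + q) [::] x; set w := flow _ _ _ _ m _ _.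
have q0 : 0 <= q%:R :> R by [].
move: sg0 q0 C0; move: (q%:R : R) (G m) (G (m + q)%N) => r g g'; kp => a0 r0 C0 h1 h2.
have h3 : a * (g - C * (r * a)) <= a * g' by rewrite ler_pM2l.
have a1 := ltW a0; have h4 : 0 <= C * (a * a) * (r + 1) by nneg.
have -> : (r + 1) * a * (g - C * ((r + 1) * a)) = r * a * (g - C * (r * a)) + a * (g - C * (r * a)) - C * (a * a) * (r + 1).
  by ring.
lra.
Qed.

Lemma flow_mono h (C : R) (m q : nat) x : 0 < h ->
  (forall j, (j < q)%N -> let W := flow c c0 U0 h (m + j) in
    - C <= Gop c c0 (W [::]) h (dgr (W [::]) h x) x) ->
  - (q%:R * sig (n := n) h * C) <= flow c c0 U0 h (m + q) [::] x - flow c c0 U0 h m [::] x.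
Proof.
move=> h0; have sg0 : 0 < sig (n := n) h by rewrite mulr_gt0 ?theta_gt0 // exprn_gt0.
elim: q => [|q IH] H; first by rewrite addn0 subrr !mul0r oppr0.
have := IH (fun j jq => H j (leqW jq)); have := H q (leqnn q) => /=.
have -> : flow c c0 U0 h (m + q.+1) [::] x = flow c c0 U0 h (m + q) [::] x
   + sig (n := n) h * Gop c c0 (flow c c0 U0 h (m + q) [::]) h (dgr (flow c c0 U0 h (m + q) [::]) h x) x.
  by rewrite addnS /flow iterS nxt_Sop.
move: (Gop _ _ _ _ _ _) (flow _ _ _ _ _ _ _) (flow _ _ _ _ _ _ _) sg0 => G u w.
rewrite -natr1; move: (sig _) (q%:R : R) => a r a0 h1 h2.
have h3 : a * - C <= a * G by rewrite ler_pM2l.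
move: h2 h3; kp; lra.
Qed.

(** The index [i] fixes the mesh, the horizon [i + 1], the available orders and the error. The flow
    is sampled at integer times [r], and [Wt.2 s] is the multiple of the time step just below [s].
    The rise over a time [s] after [r] bounds the rise up to [r + 1] from below because the flow is
    almost increasing. *)
Lemma stages : exists (bb : nat -> R) (C : R), 0 <= C /\ forall i : nat,
  exists Wt : (nat -> jets) * (R -> R), let W := Wt.1 in let e := C / i.+1%:R in
  [/\ forall r, (r <= i)%N -> [/\ admissible e (W r), forall j, (0 < j <= i)%N -> ordb (W r) j (bb j),
         forall x, - e <= GD c c0 (W r) x & forall x, - e <= W r.+1 [::] x - W r [::] x],
      forall s, 0 < s <= 1 -> s - i.+1%:R^-1 <= Wt.2 s <= s
    & forall s r x, 0 < s <= 1 -> (r <= i)%N ->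
        Wt.2 s * (GD c c0 (W r) x - C * Wt.2 s) - e <= W r.+1 [::] x - W r [::] x].
Proof.
have [bb [C1 [C10 HF]]] := discrete_flow B10 ju0 conc0 lip0 sub0 Pl0 PlB PlU.
pose b := \sum_(j < 5) `|bb j|; have b0 : 0 <= b by apply: sumr_ge0.
have [C2 C20 HG] := Gop_GD (n := n) c c0 b0; have [C3 C30 HT] := Gop_time (n := n) c c0 b0.
exists bb, (C1 + C2 + C3); split; first by rewrite !addr_ge0.
move=> i; have T0 : 0 <= i.+1%:R :> R by [].
(* Order [i + 5] instead of [i], so that the four orders bounded by [b] are available for every
   [i]. *)
have [h1 h10 Hh] := HF (i + 5)%N i.+1%:R T0.
have i0 : 0 < i.+1%:R :> R by rewrite ltr0n.
(* The second bound makes the accumulated error [T * h] at most [1 / (i + 1)], where [T = i + 1]. *)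
pose h := Num.min (h1 / 2) (i.+1%:R ^- 2).
have h0 : 0 < h by rewrite lt_min divr_gt0 //= invr_gt0 exprn_gt0.
have hh1 : 0 < h < h1 by rewrite h0 gt_min; apply/orP; left; move: h10; kp; lra.
have [hl1 Hm] := Hh h hh1.
have hT : i.+1%:R * h <= i.+1%:R^-1.
  rewrite -ler_pdivlMl // -invfM -expr2; by rewrite ge_min lexx orbT.
have hi : h <= i.+1%:R^-1.
  by apply: le_trans hT; rewrite ler_peMl ?(ltW h0) // ler1n.
pose sg := sig (n := n) h.
have sg0 : 0 < sg by rewrite mulr_gt0 ?theta_gt0 // exprn_gt0.
have sgh : sg <= h.
  have th := theta_le1 (R := R) (n := n); have t0 := theta_gt0 (R := R) (n := n).
  rewrite /sg /sig expr2 mulrA ler_piMl ?(ltW h0) //.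
  by rewrite mulr_ile1 ?(ltW h0) // ltW.
pose fl (t : R) : nat := Num.truncn (t / sg).
have fl1 t : 0 <= t -> (fl t)%:R * sg <= t.
  by move=> t0; rewrite -ler_pdivlMr // truncn_le divr_ge0 // ltW.
have fl2 t : t - sg <= (fl t)%:R * sg.
  have := truncnS_gt (t / sg); rewrite ltr_pdivrMr // -/(fl t) -natr1.
  move: (((fl t)%:R : R)) => a; kp; lra.
pose W r := flow c c0 U0 h (fl r%:R).
have nice m : m%:R * sg <= i.+1%:R -> [/\ isjet (flow c c0 U0 h m),
    forall j, (0 < j <= i)%N -> ordb (flow c c0 U0 h m) j (bb j),
    forall j, (0 < j <= 4)%N -> ordb (flow c c0 U0 h m) j b &
    forall x, - (C1 * h) <= Gop c c0 (flow c c0 U0 h m [::]) h (dgr (flow c c0 U0 h m [::]) h x) x].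
  move=> /Hm[a1 a2 _ _ [_ a5]]; split=> // j /andP[j0 j4].
    by apply: a2; rewrite j0 (leq_trans j4) // leq_addr.
  have jj : (j < 5)%N by [].
  apply: ordb_le (a2 j _); last by rewrite j0 (leq_trans j4) // -[X in (X <= _)%N]add0n leq_add.
  apply: (le_trans (ler_norm _)); rewrite /b (bigD1 (Ordinal jj)) //= lerDl.
  by apply: sumr_ge0.
have rT r : (r <= i)%N -> (fl r.+1%:R)%:R * sg <= i.+1%:R.
  by move=> ri; apply: (le_trans (fl1 _ _)) => //; rewrite ler_nat.
have rT' r : (r <= i)%N -> (fl r%:R)%:R * sg <= i.+1%:R.
  by move=> ri; apply: (le_trans (fl1 _ _)) => //; rewrite ler_nat leqW.
have flm : {homo fl : s t / s <= t >-> (s <= t)%N}.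
  by move=> s t st; rewrite /fl le_truncn // ler_pM2r ?invr_gt0.
have e1 : C1 * i.+1%:R * h <= C1 / i.+1%:R by rewrite -mulrA ler_wpM2l.
have e0 (C : R) : 0 <= C -> 0 <= C / i.+1%:R by move=> ?; rewrite divr_ge0.
have e2 : C2 * h <= C2 / i.+1%:R by rewrite ler_wpM2l.
have e3 : C1 * h <= C1 / i.+1%:R by rewrite ler_wpM2l.
have Ee : (C1 + C2 + C3) / i.+1%:R = C1 / i.+1%:R + C2 / i.+1%:R + C3 / i.+1%:R by rewrite !mulrDl.
have E1 := e0 _ C10; have E2 := e0 _ C20; have E3 := e0 _ C30.
have grow m q x : (m + q)%:R * sg <= i.+1%:R ->
   - (C1 / i.+1%:R) <= flow c c0 U0 h (m + q) [::] x - flow c c0 U0 h m [::] x.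
  move=> mq; have G j : (j < q)%N -> - (C1 * h) <= Gop c c0 (flow c c0 U0 h (m + j) [::]) h (dgr (flow c c0 U0 h (m + j) [::]) h x) x.
    move=> jq; have [|_ _ _ ->//] := nice (m + j)%N.
    by apply: le_trans mq; rewrite ler_pM2r // ler_nat leq_add2l ltnW.
  apply: le_trans (flow_mono (C := C1 * h) h0 G); rewrite lerN2 -/sg.
  apply: le_trans e1; rewrite [q%:R * sg * _]mulrC [C1 * h * _]mulrAC ler_wpM2r ?(ltW h0) // ler_wpM2l //.
  by apply: le_trans mq; rewrite ler_pM2r // ler_nat leq_addl.
have GDb m x : m%:R * sg <= i.+1%:R ->
  `|Gop c c0 (flow c c0 U0 h m [::]) h (dgr (flow c c0 U0 h m [::]) h x) x - GD c c0 (flow c c0 U0 h m) x| <= C2 / i.+1%:R.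
  move=> /nice[jm _ om _]; apply: le_trans e2; apply: HG => // j /andP[j0 j3].
  by apply: om; rewrite j0 ltnW.
exists (W, fun s => (fl s)%:R * sg) => /=; rewrite Ee; split.
- move=> r ri; have [jW oW _ gW] := nice _ (rT' r ri).
  have [_ _ cW uW [pW _]] := Hm _ (rT' r ri).
  split=> //.
  + split=> //.
      move=> t x y t01; apply: le_trans (cW t x y t01); rewrite lerN2.
      by apply: (le_trans e1); rewrite -addrA lerDl addr_ge0.
    move=> x; apply: le_trans (uW x); rewrite lerD2l lerN2.
    by apply: (le_trans e1); rewrite -addrA lerDl addr_ge0.
  + move=> x; have := GDb _ x (rT' r ri); rewrite ler_norml => /andP[_].
    rewrite -/(W r); have := gW x; rewrite -/(W r); move: e3 E3.
    move: (Gop _ _ _ _ _ _) (GD _ _ _ _) (C1 * h) (C1 / _) (C2 / _) (C3 / _) => G1 G2 d1 d2 d3 d4; kp; lra.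
  + move=> x; have := grow (fl r%:R) (fl r.+1%:R - fl r%:R)%N x.
    rewrite subnKC; last by rewrite flm // ler_nat.
    move=> /(_ (rT r ri)); rewrite -/(W r) -/(W r.+1); move: E2 E3.
    move: (W r.+1 _ _) (W r _ _) (C1 / _) (C2 / _) (C3 / _) => a a' d2 d3 d4; kp; lra.
- move=> s /andP[s0 s1]; rewrite fl1 ?(ltW s0) // andbT; apply: le_trans (fl2 s).
  by rewrite lerD2l lerN2 (le_trans sgh).
move=> s r x /andP[s0 s1] ri; set tau := (fl s)%:R * sg.
have tau0 : 0 <= tau by rewrite mulr_ge0 // ltW.
have tau1 : tau <= 1 by apply: le_trans s1; rewrite fl1 // ltW.
have mq : (fl r%:R + fl s <= fl r.+1%:R)%N.
  rewrite truncn_ge_nat ?divr_ge0 ?(ltW sg0) // ler_pdivlMr // natrD mulrDl -natr1.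
  by rewrite lerD ?fl1 // (le_trans _ s1) // fl1 // ltW.
have mqT : (fl r%:R + fl s)%:R * sg <= i.+1%:R.
  by apply: le_trans (rT r ri); rewrite ler_pM2r // ler_nat.
have mqT' j : (j <= fl s)%N -> (fl r%:R + j)%:R * sg <= i.+1%:R.
  by move=> js; apply: le_trans mqT; rewrite ler_pM2r // ler_nat leq_add2l.
have inc : tau * (Gop c c0 (W r [::]) h (dgr (W r [::]) h x) x - C3 * tau) <=
    flow c c0 U0 h (fl r%:R + fl s) [::] x - W r [::] x.
  apply: (@flow_increment h C3 (fl r%:R) (fl s) x h0 C30) => j js /=.
  have [jj _ oj _] := nice _ (mqT' j (ltnW js)).
  have [_ _ oj' _] := nice _ (mqT' j.+1 js).
  apply: (HT (flow c c0 U0 h (fl r%:R + j)) h x jj h0 oj) => k /andP[k0 k2].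
  have -> : nxt c c0 h (flow c c0 U0 h (fl r%:R + j)) = flow c c0 U0 h (fl r%:R + j.+1).
    by rewrite addnS /flow iterS.
  by apply: oj'; rewrite k0 (leq_trans k2).
have gr := grow (fl r%:R + fl s)%N (fl r.+1%:R - (fl r%:R + fl s))%N x.
rewrite subnKC // in gr; have {}gr := gr (rT r ri); rewrite -/(W r.+1) in gr.
have gd := GDb _ x (rT' r ri); rewrite -/(W r) ler_norml in gd.
move: gd => /andP[gd _]; move: gd inc gr E1 E2 E3 tau0 tau1 C10 C20 C30.
move: (Gop _ _ _ _ _ _) (GD _ _ _ _) (W r.+1 _ _) (W r _ _) (flow _ _ _ _ _ _ _) (C1 / _) (C2 / _) (C3 / _).
move: tau; kp => t G D w' w u a1 a2 a3 gd inc gr E1 E2 E3 t0 t1 C10 C20 C30.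
have q1 : t * (D - a2) <= t * G by rewrite ler_wpM2l //; lra.
have q2 : t * a2 <= a2 by rewrite ler_piMl.
have q3 : 0 <= t * t * (C1 + C2) by rewrite !mulr_ge0 ?addr_ge0.
move: q1 q2 q3 inc gr E1 E2 E3; kp; lra.
Qed.

End stationary.

Section stationary_limit.
Context {R : realType} {n : nat}.
Notation V := 'rV[R]_n.
Notation jets := (seq 'I_n -> V -> R).
Implicit Types (x y : V) (h e s : R) (W : jets).

Lemma cvgF_le2 (F : set_system nat) (UF : UltraFilter F) (a b e : nat -> R) (l m : R) :
  a i @[i --> F] --> l -> b i @[i --> F] --> m -> e i @[i --> F] --> (0 : R) ->
  F [set i | a i - e i <= b i] -> l <= m.
Proof.
move=> al bm e0 H; have Fp : ProperFilter F by exact: ultra_proper.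
rewrite -subr_ge0; apply: (@cvgF_ge _ _ UF (fun i => b i - (a i - e i))).
  by rewrite -[l in X in _ --> X](subr0 l); apply: cvgB => //; exact: cvgB.
by apply: filterS H => i /=; rewrite subr_ge0.
Qed.

Variables (F : set_system nat) (UF : UltraFilter F) (U0 : jets) (Pl : ('I_n -> R) -> R -> Prop).

Lemma admissible_ulim (e : nat -> R) (W : nat -> jets) (Phi : jets) :
  (forall J x, W i J x @[i --> F] --> Phi J x) -> e i @[i --> F] --> (0 : R) ->
  F [set i | admissible U0 Pl (e i) (W i)] -> isjet Phi -> admissible U0 Pl 0 Phi.
Proof.
move=> WP e0 Fa jP; have Fp : ProperFilter F by exact: ultra_proper.
have c0 : (fun=> 0 : R) i @[i --> F] --> (0 : R) by exact: cvg_cst.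
split=> //.
- move=> t x y t01; rewrite oppr0; apply: (@cvgF_le2 _ UF (fun=> 0) (fun i => cvx (W i [::]) t x y) e) => //.
    by rewrite /cvx; apply: cvgB; [apply: cvgB => //|]; apply: cvgM => //; exact: cvg_cst.
  by apply: filterS Fa => i [_ /(_ t x y t01)] /= H _ _; rewrite sub0r.
- move=> x; rewrite subr0; apply: (@cvgF_le2 _ UF (fun=> U0 [::] x) (W ^~ [::] ^~ x) e) => //.
    exact: cvg_cst.
  by apply: filterS Fa => i [_ _ /(_ x)].
- move=> p g x pl; apply: (cvgF_le UF (WP [::] x)).
  by apply: filterS Fa => i [_ _ _ /(_ p g x pl)].
Qed.

Lemma admissible_bound e C W p g x : Pl p g -> admissible U0 Pl e W -> e <= C -> 0 <= C ->
  `|W [::] x| <= `|U0 [::] x| + C + `|plane p g x|.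
Proof.
move=> pl [_ _ /(_ x) lo /(_ p g x pl) up] eC C0.
have := ler_norm (- U0 [::] x); have := ler_norm (plane p g x); rewrite normrN.
have := normr_ge0 (plane p g x); have := normr_ge0 (U0 [::] x).
move: lo up eC C0; move: `|U0 [::] x| `|plane p g x| (W _ _) (U0 _ _) (plane _ _ _) => a b w u q.
by clear - R; move=> *; rewrite ler_norml; apply/andP; split; lra.
Qed.

End stationary_limit.

(** Two limits along the same ultrafilter: the mesh tends to 0 at each integer time [r], then [r]
    tends to infinity. The limits increase with [r] below a plane, so their increments tend to 0.
    The rise estimate becomes [s (GD - C s) <= 0] for all [s] in [(0, 1]], which gives [GD <= 0] in
    the limit; the opposite inequality is inherited from the subsolution. *)
Theorem stationary_exists {R : realType} {n : nat} (c c0 B1 : R)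
    (U0 : seq 'I_n -> 'rV[R]_n -> R) (Pl : ('I_n -> R) -> R -> Prop) :
  0 <= B1 -> isjet U0 ->
  (forall t x y, 0 <= t <= 1 -> 0 <= cvx (U0 [::]) t x y) ->
  (forall i t x, `|U0 [::] (x + t *: delta_mx 0 i) - U0 [::] x| <= B1 * `|t|) ->
  (forall x, 0 <= GD c c0 U0 x) ->
  (forall p g, Pl p g -> Hp c c0 p = 0) ->
  (forall p g i, Pl p g -> `|p i| <= B1) ->
  (forall p g x, Pl p g -> U0 [::] x <= plane p g x) ->
  (exists p g, Pl p g) ->
  exists Phi, admissible U0 Pl 0 Phi /\ forall x, GD c c0 Phi x = 0.
Proof.
move=> B10 ju0 conc0 lip0 sub0 Pl0 PlB PlU [p0 [g0 pl0]].
have [bb [C [C0 HS]]] := stages B10 ju0 conc0 lip0 sub0 Pl0 PlB PlU.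
have [Wt HW] := choice HS; pose W r i := (Wt i).1 r; pose tau s i := (Wt i).2 s.
(* [F] refines the filter at infinity, so ordinary limits of sequences remain limits along it. *)
have [F [UF FO]] := ultraFilterLemma (eventually_filter : ProperFilter \oo).
have Fp : ProperFilter F by exact: ultra_proper.
have Fge r : F [set i | (r <= i)%N] by apply: FO; exact: nbhs_infty_ge.
have hF : (i.+1%:R^-1 : R) @[i --> F] --> (0 : R).
  by move=> B /cvg_harmonic HB; apply: FO.
have eF : (C / i.+1%:R : R) @[i --> F] --> (0 : R).
  by rewrite -[0 in X in _ --> X](mulr0 C); apply: cvgM => //; exact: cvg_cst.
have eC i : C / i.+1%:R <= C by rewrite ler_pdivrMr // ler_peMr // ler1n.
have adm r : F [set i | admissible U0 Pl (C / i.+1%:R) (W r i)].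
  by apply: filterS (Fge r) => i /= ri; have [/(_ r ri)[]] := HW i.
have /choice[Phi HPhi] : forall r, exists P, [/\ forall J x, W r i J x @[i --> F] --> P J x, isjet P &
    forall k, (0 < k)%N -> ordb P k (bb k)].
  move=> r; apply: (jets_ulim UF).
  - by apply: filterS (adm r) => i [].
  - move=> k k0; apply: filterS2 (Fge r) (Fge k) => i /= ri ki.
    by have [/(_ r ri)[_ + _ _] _ _] := HW i; apply; rewrite k0.
  - move=> x; exists (`|U0 [::] x| + C + `|plane p0 g0 x|).
    by apply: filterS (adm r) => i /= ai; exact: admissible_bound pl0 ai (eC i) C0.
have cP r J x : W r i J x @[i --> F] --> Phi r J x by have [] := HPhi r.
have aP r : admissible U0 Pl 0 (Phi r).
  by apply: (admissible_ulim UF (cP r) eF (adm r)); have [] := HPhi r.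
have gP r x : GD c c0 (W r i) x @[i --> F] --> GD c c0 (Phi r) x by exact: GD_ulim.
have z0 : (fun=> 0 : R) i @[i --> F] --> (0 : R) by exact: cvg_cst.
have G0 r x : 0 <= GD c c0 (Phi r) x.
  apply: (@cvgF_le2 _ _ UF (fun=> 0) _ (fun i => C / i.+1%:R) _ _ z0 (gP r x) eF).
  by apply: filterS (Fge r) => i /= ri; rewrite sub0r; have [/(_ r ri)[]] := HW i.
have mono r x : Phi r [::] x <= Phi r.+1 [::] x.
  apply: (@cvgF_le2 _ _ UF _ _ (fun i => C / i.+1%:R) _ _ (cP r [::] x) (cP r.+1 [::] x) eF).
  apply: filterS (Fge r) => i /= ri; have [/(_ r ri)[_ _ _ /(_ x)] + _ _] := HW i.
  by rewrite -/(W r i) -/(W r.+1 i) lerBrDr addrC.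
have tF s : 0 < s <= 1 -> tau s i @[i --> F] --> s.
  move=> s01; apply: (@squeeze_cvgr _ _ _ _ (fun i => s - i.+1%:R^-1) (fun=> s)).
  - by apply: filterS (Fge 0%N) => i _; have [_ /(_ s s01)] := HW i.
  - by rewrite -[s in X in _ --> X]subr0; apply: cvgB => //; exact: cvg_cst.
  - exact: cvg_cst.
have inc s r x : 0 < s <= 1 -> s * (GD c c0 (Phi r) x - C * s) <= Phi r.+1 [::] x - Phi r [::] x.
  move=> s01.
  apply: (@cvgF_le2 _ _ UF (fun i => tau s i * (GD c c0 (W r i) x - C * tau s i))
    (fun i => W r.+1 i [::] x - W r i [::] x) (fun i => C / i.+1%:R)) => //.
  - apply: cvgM; first exact: tF.
    by apply: cvgB => //; apply: cvgM; [exact: cvg_cst|exact: tF].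
  - exact: cvgB.
  - by apply: filterS (Fge r) => i /= ri; have [_ _ /(_ s r x s01 ri)] := HW i.
have [P [cPP jP _]] : exists P, [/\ forall J x, Phi i J x @[i --> F] --> P J x, isjet P &
    forall k, (0 < k)%N -> ordb P k (bb k)].
  apply: (jets_ulim UF).
  - by apply: filterS (Fge 0%N) => r _; have [] := HPhi r.
  - by move=> k k0; apply: filterS (Fge 0%N) => r _; have [_ _] := HPhi r; apply.
  - move=> x; exists (`|U0 [::] x| + 0 + `|plane p0 g0 x|).
    by apply: filterS (Fge 0%N) => i _; exact: admissible_bound pl0 (aP i) (lexx 0) (lexx 0).
exists P; split.
  by apply: (admissible_ulim UF cPP z0 _ jP); apply: filterS (Fge 0%N) => i _; exact: aP.
move=> x; have gPP : GD c c0 (Phi i) x @[i --> F] --> GD c c0 P x by exact: GD_ulim.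
apply/eqP; rewrite eq_le; apply/andP; split; last first.
  by apply: (cvgF_ge UF gPP); apply: filterS (Fge 0%N) => i _; exact: G0.
have dF : Phi r.+1 [::] x - Phi r [::] x @[r --> F] --> (0 : R).
  have cv : cvgn (fun r => Phi r [::] x).
    apply: nondecreasing_is_cvgn; first exact/nondecreasing_seqP.
    by exists (plane p0 g0 x) => _ [r _ <-]; have [_ _ _ /(_ _ _ _ pl0)] := aP r.
  have cv' : Phi r.+1 [::] x @[r --> \oo] --> limn (fun r => Phi r [::] x).
    by rewrite (cvg_shiftS (fun r => Phi r [::] x)).
  have : Phi r.+1 [::] x - Phi r [::] x @[r --> \oo] --> (0 : R).
    by rewrite -(subrr (limn (fun r => Phi r [::] x))); exact: cvgB cv' cv.
  by move=> H B /H HB; apply: FO.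
have key s : 0 < s <= 1 -> s * (GD c c0 P x - C * s) <= 0.
  move=> s01; apply: (@cvgF_le2 _ _ UF (fun r => s * (GD c c0 (Phi r) x - C * s)) (fun=> 0) _ _ _ _ z0 dF).
    by apply: cvgM; [exact: cvg_cst|apply: cvgB => //; exact: cvg_cst].
  by apply: filterS (Fge 0%N) => r _ /=; rewrite subr_le0; exact: inc.
rewrite leNgt; apply/negP => gt0; move: key gt0 C0; move: (GD _ _ _ _); clear - R => G key gt0 C0.
pose s := Num.min 1 (G / (2 * (C + 1))).
have C1 : 0 < 2 * (C + 1) by lra.
have s0 : 0 < s by rewrite lt_min ltr01 divr_gt0.
have s1 : s <= 1 by rewrite ge_min lexx.
have s2 : s <= G / (2 * (C + 1)) by rewrite ge_min lexx orbT.
have := key s; rewrite s0 s1 pmulr_rle0 // => /(_ isT) h1.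
rewrite ler_pdivlMr // in s2; have h2 : 0 <= C * s by rewrite mulr_ge0 // ltW.
move: h1 s2 s0 h2; clear - R; lra.
Qed.

(** * The soft minimum is a subsolution *)

Section expbounds.
Context {R : realType}.
Implicit Types b s t : R.

Lemma expR_quad b : `|b| <= 2^-1 -> expR b <= 1 + b + 2 * b ^+ 2.
Proof.
rewrite ler_norml => /andP[b1 b2]; have h := expR_ge1Dx (- b).
have h1 : 0 < 1 - b by lra.
have h2 : expR b * (1 - b) <= 1.
  by rewrite -[X in _ <= X](expRxMexpNx_1 b) ler_wpM2l ?expR_ge0.
rewrite -(ler_pM2r h1); apply: (le_trans h2).
have -> : (1 + b + 2 * b ^+ 2) * (1 - b) = 1 + b ^+ 2 * (1 - 2 * b) by ring.
by rewrite lerDl mulr_ge0 ?sqr_ge0 //; lra.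
Qed.

Lemma expR_tay s t : s <= 0 -> t <= 0 ->
  `|expR t - expR s - expR s * (t - s)| <= 4 * (t - s) ^+ 2.
Proof.
move=> s0 t0; set d := t - s; have te : t = s + d by rewrite /d; ring.
have es : expR s <= 1 by rewrite -expR0 ler_expR.
have et : expR t <= 1 by rewrite -expR0 ler_expR.
have es0 := expR_gt0 s; have et0 := expR_gt0 t; have ed := expR_ge1Dx d.
have E : expR t = expR s * expR d by rewrite te expRD.
have -> : expR t - expR s - expR s * d = expR s * (expR d - 1 - d) by rewrite E; ring.
have a0 : 0 <= expR d - 1 - d by lra.
rewrite normrM (ger0_norm (expR_ge0 s)) (ger0_norm a0).
have dd := sqr_ge0 d.
have bound X : expR d - 1 - d <= X -> X <= 4 * d ^+ 2 -> 0 <= X -> expR s * (expR d - 1 - d) <= 4 * d ^+ 2.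
  move=> h1 h2 X0; apply: le_trans h2; apply: (@le_trans _ _ (1 * (expR d - 1 - d))).
    by rewrite ler_wpM2r.
  by rewrite mul1r.
have [d1|d1] := lerP `|d| 2^-1.
  apply: (bound (2 * d ^+ 2)); [have := expR_quad d1; lra|lra|lra].
have [dn|dp] := leP d 0.
  rewrite ler0_norm // in d1; have : expR d <= 1 by rewrite -expR0 ler_expR.
  by move=> ?; apply: (bound (- d)); nra.
rewrite gtr0_norm // in d1; apply: (@le_trans _ _ 1).
  rewrite E in et; move: et dp es0; clear - R; move: (expR s) (expR d) => a b; nra.
by move: d1; clear - R; nra.
Qed.

(** The logarithm of the exponential moment of a centred variable is nonnegative by convexity. It is
    quadratic in [B] for small [B]; for [B > 1 / 2] the trivial bound [B] is already below
    [2 B^2]. *)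
Lemma ln_mean_exp (I : finType) (w b : I -> R) (B : R) :
  (forall m, 0 <= w m) -> \sum_m w m = 1 -> \sum_m w m * b m = 0 -> (forall m, `|b m| <= B) ->
  0 <= B -> 0 <= ln (\sum_m w m * expR (b m)) <= 2 * B ^+ 2.
Proof.
move=> w0 w1 wb bB B0; set T := \sum_m _.
have T1 : 1 <= T.
  have -> : 1 = \sum_m w m * (1 + b m).
    by under eq_bigr do rewrite mulrDr mulr1; rewrite big_split /= w1 wb addr0.
  by apply: ler_sum => m _; rewrite ler_wpM2l // expR_ge1Dx.
have T0 : 0 < T by apply: lt_le_trans T1.
apply/andP; split; first exact: ln_ge0.
have [B1|B1] := lerP B 2^-1.
  have T2 : T <= 1 + 2 * B ^+ 2.
    have -> : 1 + 2 * B ^+ 2 = \sum_m w m * (1 + b m + 2 * B ^+ 2).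
      under eq_bigr do rewrite mulrDr mulrDr mulr1.
      by rewrite !big_split /= w1 wb addr0 -mulr_suml w1 mul1r.
    apply: ler_sum => m _; rewrite ler_wpM2l //.
    apply: le_trans (expR_quad (le_trans (bB m) B1)) _; rewrite lerD2l ler_pM2l //.
    by rewrite -[X in X <= _]real_normK ?num_real // lerXn2r ?nnegrE.
  have := le_ln1Dx (x := T - 1); rewrite subrKC; move=> /(_ _) h.
  apply: (@le_trans _ _ (T - 1)); last by lra.
  by apply: h; lra.
have T2 : T <= expR B.
  rewrite -[X in _ <= X]mul1r -w1 mulr_suml; apply: ler_sum => m _.
  by rewrite ler_wpM2l // ler_expR (le_trans (ler_norm _)).
apply: (@le_trans _ _ B); last by nra.
by rewrite -[X in _ <= X]expRK ler_ln ?posrE ?expR_gt0.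
Qed.
End expbounds.

(** * The soft minimum of planes and its derivatives *)

Section softmin.
Context {R : realType} {n : nat} {I : finType}.
Notation V := 'rV[R]_n.
Variables (i0 : I) (p : I -> 'I_n -> R) (gam : I -> R) (lam kap : R).
Hypotheses (lam0 : 0 < lam) (kap0 : 0 <= kap) (pk : forall m i, `|p m i| <= kap).
Implicit Types (x y z : V) (m : I) (i j k : 'I_n) (J : seq 'I_n).
Local Ltac kp := clear - i0 lam0 kap0 pk gam.

Definition pexp m x : R := expR (- lam * plane (p m) (gam m) x).
Definition psum x : R := \sum_m pexp m x.
Definition softmin x : R := - lam^-1 * ln (psum x).
(** The Gibbs weights, normalized through [softmin] itself: their derivatives then follow from those
    of [softmin], and the exponent is nonpositive. *)
Definition sw m x : R := expR (- lam * (plane (p m) (gam m) x - softmin x)).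
Definition pdot m z : R := \sum_i p m i * z 0 i.
Definition pmean i x : R := \sum_m sw m x * p m i.

Lemma psum_gt0 x : 0 < psum x.
Proof.
rewrite /psum (bigD1 i0) //= ltr_wpDr ?expR_gt0 //.
by apply: sumr_ge0 => m _; exact: expR_ge0.
Qed.

Lemma swE m x : sw m x = pexp m x / psum x.
Proof.
have -> : (psum x)^-1 = expR (- ln (psum x)) by rewrite expRN lnK // posrE psum_gt0.
rewrite /sw /pexp -expRD; congr expR; rewrite /softmin; field; exact: lt0r_neq0.
Qed.

Lemma sw_ge0 m x : 0 <= sw m x.
Proof. exact: expR_ge0. Qed.

Lemma sw_sum x : \sum_m sw m x = 1.
Proof.
by under eq_bigr do rewrite swE; rewrite -mulr_suml divff // gt_eqF // psum_gt0.
Qed.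

Lemma softmin_le m x : softmin x <= plane (p m) (gam m) x.
Proof.
rewrite -subr_ge0; have : sw m x <= 1.
  by rewrite -(sw_sum x) (bigD1 m) //= lerDl sumr_ge0 // => k _; exact: sw_ge0.
by rewrite /sw -expR0 ler_expR mulNr oppr_le0 pmulr_rge0.
Qed.

Lemma sw_le1 m x : sw m x <= 1.
Proof. by rewrite /sw -expR0 ler_expR mulNr oppr_le0 pmulr_rge0 // subr_ge0 softmin_le. Qed.

Lemma softmin_ge (a : R) x : (forall m, a <= plane (p m) (gam m) x) ->
  a - ln #|I|%:R / lam <= softmin x.
Proof.
move=> H; have I0 : 0 < #|I|%:R :> R by rewrite ltr0n; apply/card_gt0P; exists i0.
have : psum x <= #|I|%:R * expR (- lam * a).
  rewrite mulr_natl -[_ *+ #|_|]sumr_const; apply: ler_sum => m _.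
  by rewrite ler_expR !mulNr lerN2 ler_pM2l.
rewrite -ler_ln ?posrE ?psum_gt0 ?mulr_gt0 ?expR_gt0 // lnM ?posrE ?expR_gt0 // expRK.
rewrite /softmin => h; rewrite -(ler_pM2l lam0); have lam1 := lt0r_neq0 lam0.
have -> : lam * (a - ln #|I|%:R / lam) = lam * a - ln #|I|%:R by field.
have -> : lam * (- lam^-1 * ln (psum x)) = - ln (psum x) by field.
by move: h; move: (ln _) (ln _) => a1 a2; kp; lra.
Qed.

(** With the exponential of plane [m] factored out, the sum is 1 plus at most [#|I|] terms bounded
    by [exp (- lam d)], and [ln (1 + s) <= s]. *)
Lemma softmin_near m x (d : R) : (forall k : I, k != m -> d <= plane (p k) (gam k) x - plane (p m) (gam m) x) ->
  plane (p m) (gam m) x - softmin x <= #|I|%:R / lam * expR (- lam * d).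
Proof.
move=> H; pose T := \sum_k expR (- lam * (plane (p k) (gam k) x - plane (p m) (gam m) x)).
have PT : psum x = pexp m x * T.
  by rewrite /psum /T mulr_sumr; apply: eq_bigr => k _; rewrite /pexp -expRD; congr expR; ring.
have T1 : 0 < T by have := psum_gt0 x; rewrite PT pmulr_rgt0 // expR_gt0.
have -> : plane (p m) (gam m) x - softmin x = lam^-1 * ln T.
  rewrite /softmin PT lnM ?posrE ?expR_gt0 // expRK; field; exact: lt0r_neq0.
rewrite [#|I|%:R / lam]mulrC -mulrA ler_pM2l ?invr_gt0 //.
have := le_ln1Dx (x := T - 1); rewrite subrKC => h; apply: (le_trans (h _)); first by lra.
rewrite lerBlDl /T (bigD1 m) //= subrr mulr0 expR0 lerD2l.
apply: (@le_trans _ _ (\sum_(k | k != m) expR (- lam * d))).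
  by apply: ler_sum => k km; rewrite ler_expR !mulNr lerN2 ler_pM2l // H.
rewrite big_mkcond /= mulr_natl -[_ *+ #|_|]sumr_const; apply: ler_sum => k _.
by case: ifP => // _; exact: expR_ge0.
Qed.

Lemma sum_swD x z : \sum_i pmean i x * z 0 i = \sum_m sw m x * pdot m z.
Proof.
under eq_bigr do rewrite /pmean mulr_suml.
rewrite exchange_big; apply: eq_bigr => m _; rewrite /pdot mulr_sumr.
by apply: eq_bigr => i _; rewrite mulrA.
Qed.

(** An exact remainder: the logarithmic exponential moment, under the weights at [x], of the centred
    slopes. Together with [ln_mean_exp] it yields both concavity and the quadratic Taylor bound. *)
Lemma softminD x z : let a := \sum_i pmean i x * z 0 i in
  softmin (x + z) - softmin x - a
   = - lam^-1 * ln (\sum_m sw m x * expR (- lam * (pdot m z - a))).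
Proof.
move=> a; set T := \sum_m _.
have E : psum (x + z) = psum x * (expR (- lam * a) * T).
  rewrite /psum /T [X in _ * X]mulr_sumr [RHS]mulr_sumr; apply: eq_bigr => m _; rewrite swE.
  have -> : pexp m (x + z) = pexp m x * (expR (- lam * a) * expR (- lam * (pdot m z - a))).
    by rewrite /pexp plane_D -/(pdot m z) -!expRD; congr expR; ring.
  by rewrite -/(psum x); field; rewrite gt_eqF // psum_gt0.
have T0 : 0 < T.
  by have := psum_gt0 (x + z); rewrite E pmulr_rgt0 ?psum_gt0 // pmulr_rgt0 // expR_gt0.
rewrite /softmin E lnM ?posrE ?psum_gt0 ?mulr_gt0 ?expR_gt0 //.
rewrite lnM ?posrE ?expR_gt0 // expRK; field; exact: lt0r_neq0.
Qed.

Lemma pmean_le i x : `|pmean i x| <= kap.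
Proof.
apply: le_trans (ler_norm_sum _ _ _) _; rewrite -[X in _ <= X]mul1r -(sw_sum x) mulr_suml.
by apply: ler_sum => m _; rewrite normrM (ger0_norm (sw_ge0 _ _)) ler_wpM2l ?sw_ge0.
Qed.

Lemma softmin_tay x z :
  - (lam^-1 * (2 * (2 * lam * kap * nm z) ^+ 2))
    <= softmin (x + z) - softmin x - \sum_i pmean i x * z 0 i <= 0.
Proof.
pose a := \sum_i pmean i x * z 0 i; rewrite softminD -/a; set b := fun m => - lam * (pdot m z - a).
have B0 : 0 <= 2 * lam * kap * nm z by have := ltW lam0; have := nm_ge0 z => *; nneg.
have bs : \sum_m sw m x * b m = 0.
  transitivity (- lam * (\sum_m sw m x * pdot m z - \sum_m sw m x * a)).
    by rewrite -sumrB mulr_sumr; apply: eq_bigr => m _; rewrite /b -mulrBr mulrCA.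
  by rewrite -sum_swD -/a -[X in _ - X]mulr_suml sw_sum mul1r subrr mulr0.
have bB m : `|b m| <= 2 * lam * kap * nm z.
  rewrite /b normrM normrN (gtr0_norm lam0) [2 * lam]mulrC -!mulrA ler_pM2l //.
  apply: (le_trans (ler_normB _ _)); rewrite mulr_natl mulr2n; apply: lerD.
    exact: ler_sum_nm (pk m).
  by apply: ler_sum_nm => i; exact: pmean_le.
have /andP[h1 h2] := ln_mean_exp (fun m => sw_ge0 m x) (sw_sum x) bs bB B0.
have i0' : 0 <= lam^-1 by rewrite invr_ge0 ltW.
by rewrite mulNr lerN2 oppr_le0 mulr_ge0 // andbT ler_wpM2l.
Qed.

Lemma tay_softmin : tay softmin pmean (lam^-1 * (2 * (2 * lam * kap) ^+ 2)).
Proof.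
move=> x z; have /andP[h1 h2] := softmin_tay x z; rewrite ler0_norm //.
by move: h1; rewrite exprMn; move: (softmin _ - _ - _) => d; rewrite !mulrA; kp; lra.
Qed.

Lemma softmin_cvx t x y : 0 <= t <= 1 -> 0 <= cvx softmin t x y.
Proof.
move=> /andP[t0 t1]; rewrite /cvx; set z := t *: x + (1 - t) *: y.
have /andP[_ h1] := softmin_tay z (x - z); have /andP[_ h2] := softmin_tay z (y - z).
rewrite !subrKC in h1 h2.
have E : t * (\sum_i pmean i z * (x - z) 0 i) + (1 - t) * (\sum_i pmean i z * (y - z) 0 i) = 0.
  rewrite !mulr_sumr -big_split big1 // => i _ /=; rewrite /z !mxE; ring.
have s0 : 0 <= 1 - t by rewrite subr_ge0.
have h3 := ler_wpM2l t0 h1; have h4 := ler_wpM2l s0 h2.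
move: (\sum_i _) (\sum_i _) h3 h4 E => a b; kp => h3 h4 E.
by move: E h3 h4; kp; rewrite !mulr0 !mulrBr; lra.
Qed.

Lemma softmin_lip i t x : `|softmin (x + t *: delta_mx 0 i) - softmin x| <= kap * `|t|.
Proof.
by rewrite -(nm_delta (n := n) i t); apply: (tay_lip _ _ tay_softmin) => k y; exact: pmean_le.
Qed.

Lemma good_sw m : good (sw m) (fun k x => - lam * (sw m x * (p m k + \sum_l sw l x * - p l k))).
Proof.
pose f x := - lam * (plane (p m) (gam m) x - softmin x).
pose df k x := - lam * (p m k - pmean k x).
have [C tf] : exists C, tay f df C.
  exists (`|- lam| * (0 + `|-1| * (lam^-1 * (2 * (2 * lam * kap) ^+ 2)))).
  have t1 : tay (plane (p m) (gam m)) (fun k _ => p m k) 0.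
    by move=> x z; rewrite plane_D addrAC addrK subrr normr0 mul0r.
  have e : f = fun x => - lam * (plane (p m) (gam m) x + -1 * softmin x).
    by apply/funext => x; rewrite mulN1r.
  rewrite e; apply: tay_ext (tayZ (- lam) (tayD t1 (tayZ (-1) tay_softmin))) => k x.
  by rewrite /df mulN1r.
have f0 x : f x <= 0 by rewrite /f mulNr oppr_le0 pmulr_rge0 // subr_ge0 softmin_le.
have dfb k : bdd (df k) (lam * (kap + kap)).
  move=> x; rewrite /df normrM normrN (gtr0_norm lam0) ler_pM2l //.
  by apply: (le_trans (ler_normB _ _)); apply: lerD; [exact: pk|exact: pmean_le].
have e k x : - lam * (sw m x * (p m k + \sum_l sw l x * - p l k)) = sw m x * df k x.
  rewrite /df /pmean -sumrN; under [in RHS]eq_bigr do rewrite -mulrN.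
  by rewrite mulrCA.
have s1 x : `|sw m x| <= 1 by rewrite ger0_norm ?sw_ge0 // sw_le1.
split.
- by exists 1 => x; exact: s1.
- exists (1 * (lam * (kap + kap))) => k x; rewrite e normrM ler_pM //; exact: dfb.
exists (4 * (lam * (kap + kap)) ^+ 2 + 1 * C) => x z.
under eq_bigr do rewrite e -mulrA.
rewrite -mulr_sumr; set S := \sum_i _.
have -> : sw m (x + z) - sw m x - sw m x * S =
  (sw m (x + z) - sw m x - sw m x * (f (x + z) - f x)) + sw m x * (f (x + z) - f x - S).
  by rewrite [X in _ = _ + X]mulrBr addrA subrK.
have h1 := expR_tay (f0 x) (f0 (x + z)); have h2 := tay_lip x z tf dfb.
have h3 : (f (x + z) - f x) ^+ 2 <= (lam * (kap + kap) * nm z) ^+ 2.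
  have a0 : 0 <= lam * (kap + kap) * nm z by have := ltW lam0; have := nm_ge0 z => *; nneg.
  by rewrite -[X in X <= _]real_normK ?num_real // lerXn2r ?nnegrE.
apply: le_trans (ler_normD _ _) _; rewrite mulrDl; apply: lerD.
  by apply: (le_trans h1); rewrite -mulrA -exprMn ler_pM2l.
by rewrite normrM -mulrA ler_pM //; exact: tf.
Qed.

(** Polynomials in the weights. The derivative of a weight is such a polynomial, hence so are all
    derivatives of [softmin] of positive order, and they are bounded because the weights lie in
    [[0, 1]]. *)
Inductive wexpr : Type := Wc of R | Wv of I | Wadd of wexpr & wexpr | Wmul of wexpr & wexpr.

Fixpoint weval e x : R :=
  match e with
  | Wc a => a
  | Wv m => sw m x
  | Wadd a b => weval a x + weval b x
  | Wmul a b => weval a x * weval b x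
  end.

Definition Wsum (f : I -> wexpr) : wexpr := foldr (fun l a => Wadd (f l) a) (Wc 0) (enum I).

Fixpoint wded k e : wexpr :=
  match e with
  | Wc _ => Wc 0
  | Wv m => Wmul (Wc (- lam)) (Wmul (Wv m) (Wadd (Wc (p m k)) (Wsum (fun l => Wmul (Wv l) (Wc (- p l k))))))
  | Wadd a b => Wadd (wded k a) (wded k b)
  | Wmul a b => Wadd (Wmul (wded k a) b) (Wmul a (wded k b))
  end.

Lemma weval_sum F x : weval (Wsum F) x = \sum_m weval (F m) x.
Proof.
rewrite -[RHS]big_enum /= /Wsum; elim: (enum I) => [|a r IH] /=; first by rewrite big_nil.
by rewrite big_cons IH.
Qed.

Lemma weval_ded_sum k F x : weval (wded k (Wsum F)) x = \sum_m weval (wded k (F m)) x.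
Proof.
rewrite -[RHS]big_enum /= /Wsum; elim: (enum I) => [|a r IH] /=; first by rewrite big_nil.
by rewrite big_cons IH.
Qed.

Lemma good_weval e : good (weval e) (fun k => weval (wded k e)).
Proof.
elim: e => [a|m|a ha b hb|a ha b hb]; [exact: good_cst| |exact: goodD|exact: goodM].
by apply: good_ext (good_sw m) => k x /=; rewrite weval_sum.
Qed.

(** The last letter of the word is the derivative taken first and gives the mean slope. The value at
    the empty word is a default, which [sjet] replaces by [softmin]. *)
Fixpoint swjet J : wexpr :=
  if J is k :: J' then
    if J' is [::] then Wsum (fun m => Wmul (Wv m) (Wc (p m k))) else wded k (swjet J')
  else Wc 0.
Definition sjet J : V -> R := if J is [::] then softmin else weval (swjet J).

Lemma sjet1 k x : sjet [:: k] x = pmean k x.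
Proof. by rewrite /= weval_sum. Qed.

Lemma isjet_sjet : isjet sjet.
Proof.
split=> [[//|k J] _|[|k J]]; first by have [] := good_weval (swjet (k :: J)).
  by eexists; apply: tay_ext tay_softmin => k x; rewrite sjet1.
by have [_ _ [C HC]] := good_weval (swjet (k :: J)); exists C.
Qed.

(** The Hessian is [- lam] times the covariance matrix of the slopes under the Gibbs weights. *)
Lemma sjet2 j k x : sjet [:: j; k] x =
  - lam * (\sum_m sw m x * p m j * p m k - pmean j x * pmean k x).
Proof.
rewrite /sjet /swjet weval_ded_sum /=.
transitivity (\sum_m - lam * (sw m x * (p m j - pmean j x) * p m k)).
  apply: eq_bigr => m _; rewrite mulr0 addr0 weval_sum /= [RHS]mulrA /pmean -sumrN.
  by under [in RHS]eq_bigr do rewrite -mulrN.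
rewrite -[LHS]mulr_sumr; congr (_ * _).
rewrite [pmean k x]/pmean mulr_sumr -sumrB; apply: eq_bigr => m _.
by rewrite mulrBr mulrBl -mulrA [in X in _ - X]mulrAC [X in _ - X]mulrC.
Qed.

End softmin.

Section second_order_form.
Context {R : realType} {n : nat}.
Implicit Types (Q : 'I_n -> 'I_n -> R) (q : 'I_n -> R).

(** The coordinate directions give the trace. In the sum over all ordered pairs each of the
    remaining terms occurs twice, which the factor [1 / sqrt 2] in the directions compensates. *)
Lemma sum_quad_dir Q q :
  \sum_s quad Q (dir s q) =
  (1 + \sum_i q i ^+ 2) * \sum_i Q i i - \sum_i \sum_j Q j i * q j * q i.
Proof.
rewrite big_sumType /=.
have -> : \sum_i quad Q (dir (inl i) q) = \sum_i Q i i.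
  by apply: eq_bigr => i _; rewrite dir_inl -[delta_mx _ _]scale1r quad_delta expr1n mul1r.
have dE i j : dir (inr (i, j)) q = (Num.sqrt 2)^-1 *: (q i *: delta_mx 0 j - q j *: delta_mx 0 i).
  apply/rowP => l; rewrite !mxE add0r eqxx /=.
  under eq_bigr do rewrite -mulrA; rewrite -mulr_sumr; congr (_ * _).
  have sd (k : 'I_n) (a : R) : \sum_m (a * (m == k)%:R) * q m = a * q k.
    rewrite (bigD1 k) //= big1 => [|m /negPf ->]; last by rewrite mulr0 mul0r.
    by rewrite eqxx mulr1 addr0.
  under eq_bigr do rewrite mulrBl; rewrite sumrB !sd.
  by rewrite mulrC [_ * q j]mulrC.
have s2 : ((Num.sqrt 2)^-1 : R) ^+ 2 = 2^-1 by rewrite exprVn sqr_sqrtr.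
have sel (a : 'I_n -> R) k : \sum_l a l * (l == k)%:R = a k.
  rewrite (bigD1 k) //= big1 => [|m /negPf ->]; last by rewrite mulr0.
  by rewrite eqxx mulr1 addr0.
have lin i j (F : 'I_n -> R) : \sum_b F b * dir (inr (i, j)) q 0 b =
    (Num.sqrt 2)^-1 * (q i * F j - q j * F i).
  rewrite dE -(sel F j) -(sel F i) !mulr_sumr -sumrB mulr_sumr; apply: eq_bigr => b _.
  by rewrite !mxE eqxx /=; ring.
have qE i j : quad Q (dir (inr (i, j)) q) =
    2^-1 * (q i ^+ 2 * Q j j + q j ^+ 2 * Q i i - (Q j i * q j * q i + Q i j * q i * q j)).
  rewrite /quad; under eq_bigr do rewrite -mulr_suml lin.
  by rewrite lin -s2; ring.
have -> : \sum_(k : 'I_n * 'I_n) quad Q (dir (inr k) q) = \sum_i \sum_j quad Q (dir (inr (i, j)) q).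
  by rewrite (pair_bigA _ (fun i j => quad Q (dir (inr (i, j)) q))); apply: eq_bigr => -[].
have E2 i : \sum_j quad Q (dir (inr (i, j)) q) = 2^-1 * (q i ^+ 2 * (\sum_j Q j j) +
    (\sum_j q j ^+ 2) * Q i i - (\sum_j Q j i * q j * q i + \sum_j Q i j * q i * q j)).
  under eq_bigr do rewrite qE.
  by rewrite -mulr_sumr sumrB !big_split /= -mulr_sumr -mulr_suml.
rewrite (eq_bigr _ (fun i _ => E2 i)) -[\sum_i 2^-1 * _]mulr_sumr sumrB !big_split /= -mulr_suml -mulr_sumr.
have -> : \sum_i \sum_j Q i j * q i * q j = \sum_i \sum_j Q j i * q j * q i.
  by rewrite exchange_big.
by field.
Qed.

Lemma GD_expand c c0 (U : seq 'I_n -> 'rV[R]_n -> R) x :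
  let q i := U [:: i] x in
  GD c c0 U x = vel q ^+ 2 * (\sum_i U [:: i; i] x + c - c0 * vel q)
    - \sum_i \sum_j U [:: j; i] x * q j * q i.
Proof.
by move=> q; rewrite /GD /G0 sum_quad_dir /Hp -/q -sqr_vel; ring.
Qed.

End second_order_form.

Section softmin_stationary.
Context {R : realType} {n : nat} {I : finType}.
Notation V := 'rV[R]_n.
Variables (i0 : I) (p : I -> 'I_n -> R) (gam : I -> R) (c0 kap : R).
Hypotheses (c00 : 0 < c0) (kap0 : 0 <= kap) (pk : forall m, \sum_i p m i ^+ 2 = kap ^+ 2).
Implicit Types (x y z : V) (m : I) (i j k : 'I_n).
Local Ltac kp := clear - i0 kap0 pk gam c00.

Let vs : R := Num.sqrt (1 + kap ^+ 2).
(** [vs] is the value of [sqrt (1 + |p|^2)] on the planes. The factor 2 comes from [vs + v <= 2 vs]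
    in [softmin_subsolution]. *)
Definition soft_rate : R := c0 / (2 * vs).

Let vs1 : 1 <= vs.
Proof. by rewrite -[X in X <= _]sqrtr1 ler_sqrt ?lerDl ?addr_ge0 ?sqr_ge0. Qed.

Let vs2 : vs ^+ 2 = 1 + kap ^+ 2.
Proof. by rewrite sqr_sqrtr // addr_ge0 ?sqr_ge0. Qed.

Let lam0 : 0 < soft_rate.
Proof. by rewrite divr_gt0 // mulr_gt0 // (lt_le_trans ltr01 vs1). Qed.

Let pk1 m i : `|p m i| <= kap.
Proof.
rewrite -(ger0_norm kap0) -(ler_pXn2r (n := 2)) ?nnegrE ?normr_ge0 //.
rewrite !real_normK ?num_real // -(pk m) (bigD1 i) //= lerDl.
by apply: sumr_ge0 => j _; exact: sqr_ge0.
Qed.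

Local Notation U0 := (sjet p gam soft_rate).
Local Notation w := (sw p gam soft_rate).
Local Notation q := (pmean p gam soft_rate).

Lemma weighted_square x (a : I -> R) : (\sum_m w m x * a m) ^+ 2 <= \sum_m w m x * a m ^+ 2.
Proof.
set A := \sum_m _; rewrite -subr_ge0.
have -> : \sum_m w m x * a m ^+ 2 - A ^+ 2 = \sum_m w m x * (a m - A) ^+ 2.
  rewrite [RHS](eq_bigr (fun m => w m x * a m ^+ 2 - (2 * A) * (w m x * a m) + A ^+ 2 * w m x)); last first.
    by move=> m _; ring.
  by rewrite big_split /= sumrB -!mulr_sumr (sw_sum i0) // -/A; ring.
by apply: sumr_ge0 => m _; rewrite mulr_ge0 ?sw_ge0 ?sqr_ge0.
Qed.

(** With [P = |Du|^2] the trace of the Hessian is [- lam (kap^2 - P) = - lam (vs - v) (vs + v)], and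
    its value on the gradient is [- lam (B - P^2)], where [P^2 <= B] by Jensen's inequality. The
    operator becomes [v^2 (vs - v) (c0 - lam (vs + v)) + lam (B - P^2)], a sum of nonnegative terms
    since [v <= vs]. *)
Lemma softmin_subsolution x : 0 <= GD (c0 * vs) c0 U0 x.
Proof.
rewrite GD_expand; set v := vel _.
have v2 : v ^+ 2 = 1 + \sum_i q i x ^+ 2.
  by rewrite /v sqr_vel; under eq_bigr do rewrite sjet1.
set P := \sum_i _ in v2.
have tr : \sum_i U0 [:: i; i] x = - soft_rate * (kap ^+ 2 - P).
  under eq_bigr do rewrite sjet2; rewrite -mulr_sumr sumrB exchange_big /=; congr (_ * (_ - _)).
  transitivity (\sum_m w m x * kap ^+ 2); last by rewrite -mulr_suml (sw_sum i0) // mul1r.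
  apply: eq_bigr => m _; rewrite -(pk m) mulr_sumr; apply: eq_bigr => i _.
  by rewrite -mulrA -expr2.
pose B := \sum_m w m x * (\sum_i p m i * q i x) ^+ 2.
have bi : \sum_i \sum_j U0 [:: j; i] x * U0 [:: j] x * U0 [:: i] x = - soft_rate * (B - P ^+ 2).
  have E i j : U0 [:: j; i] x * U0 [:: j] x * U0 [:: i] x =
     - soft_rate * (\sum_m w m x * ((p m j * q j x) * (p m i * q i x)) - (q j x ^+ 2) * (q i x ^+ 2)).
    rewrite !sjet1 sjet2 -!mulrA; congr (_ * _); rewrite mulrBl; congr (_ - _); last by ring.
    by rewrite [LHS]mulr_suml; apply: eq_bigr => m _; ring.
  under eq_bigr do under eq_bigr do rewrite E.
  under eq_bigr do rewrite -mulr_sumr sumrB -mulr_suml.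
  rewrite -mulr_sumr sumrB -mulr_sumr -/P -expr2; congr (_ * (_ - _)).
  rewrite /B exchange_big /=; under eq_bigr do rewrite exchange_big /=.
  rewrite exchange_big /=; apply: eq_bigr => m _.
  rewrite expr2 big_distrlr /= mulr_sumr; apply: eq_bigr => i _.
  by rewrite [RHS]mulr_sumr; apply: eq_bigr => j _; ring.
have BP : P ^+ 2 <= B.
  have -> : P = \sum_m w m x * \sum_i p m i * q i x.
    have := sum_swD p gam soft_rate x (\row_i q i x).
    rewrite /pdot; under eq_bigr do rewrite mxE -expr2.
    by rewrite -/P => ->; apply: eq_bigr => m _; congr (_ * _); apply: eq_bigr => i _; rewrite mxE.
  exact: weighted_square.
have PK : P <= kap ^+ 2.
  have -> : kap ^+ 2 = \sum_i \sum_m w m x * p m i ^+ 2.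
    rewrite exchange_big /=; under eq_bigr do rewrite -mulr_sumr pk.
    by rewrite -mulr_suml (sw_sum i0) // mul1r.
  by apply: ler_sum => i _; exact: weighted_square.
have P0 : 0 <= P by apply: sumr_ge0 => i _; exact: sqr_ge0.
have v1 : 1 <= v by exact: vel_ge1.
have vle : v <= vs.
  rewrite -(ler_pXn2r (n := 2)) ?nnegrE //; try by apply: le_trans ler01 _.
  by rewrite v2 vs2 lerD2l.
have lv : soft_rate * (vs + v) <= c0.
  rewrite /soft_rate mulrAC ler_pdivrMr ?mulr_gt0 ?(lt_le_trans ltr01 vs1) //.
  by rewrite ler_pM2l // mulr_natl mulr2n lerD2l.
rewrite tr bi; clear tr bi; move: lam0 (vs2) (vs1) v2 BP PK P0 v1 vle lv c00; move: (soft_rate) vs v P B (kap ^+ 2).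
kp => lam V v P B K l0 e1 h1 e2 BP PK P0 v1 vV lv c0p.
have -> : v ^+ 2 * (- lam * (K - P) + c0 * V - c0 * v) - - lam * (B - P ^+ 2)
   = v ^+ 2 * ((V - v) * (c0 - lam * (V + v))) + lam * (B - P ^+ 2).
  have -> : K - P = (V - v) * (V + v) by rewrite -subr_sqr e1 e2; ring.
  by ring.
have l1 := ltW l0; have t1 : 0 <= V - v by rewrite subr_ge0.
have t2 : 0 <= c0 - lam * (V + v) by rewrite subr_ge0.
have t3 : 0 <= B - P ^+ 2 by rewrite subr_ge0.
by nneg.
Qed.

Theorem soft_stationary : exists Phi : seq 'I_n -> V -> R, [/\ isjet Phi,
  forall t x y, 0 <= t <= 1 -> 0 <= cvx (Phi [::]) t x y,
  forall x, softmin p gam soft_rate x <= Phi [::] x,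
  forall m x, Phi [::] x <= plane (p m) (gam m) x
  & forall x, GD (c0 * vs) c0 Phi x = 0].
Proof.
pose Pl a g := exists m, a = p m /\ g = gam m.
have [||||||||| Phi [[jP cP lP uP] gP]] := @stationary_exists R n (c0 * vs) c0 kap U0 Pl.
- exact: kap0.
- exact: (isjet_sjet i0 gam lam0 kap0 pk1).
- by move=> t x y; exact: (softmin_cvx i0 gam lam0 kap0 pk1).
- by move=> i t x; exact: (softmin_lip i0 gam lam0 kap0 pk1).
- exact: softmin_subsolution.
- by move=> _ _ [m [-> _]]; rewrite /Hp /vel pk -/vs; ring.
- by move=> _ _ i [m [-> _]].
- by move=> _ _ x [m [-> ->]]; exact: softmin_le.
- by exists (p i0), (gam i0), i0.
exists Phi; split=> //.
- by move=> t x y t01; have := cP t x y t01; rewrite oppr0.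
- by move=> x; have := lP x; rewrite subr0.
- by move=> m x; apply: uP; exists m.
Qed.

End softmin_stationary.

(** * Directional derivatives and the mean curvature operator *)

Section directional.
Context {R : realType} {V : normedModType R}.
Implicit Types (f : V -> R) (x v : V).

Lemma is_deriveP f x v (d : R) : is_derive x v f d <->
  forall e : R, 0 < e -> exists2 r : R, 0 < r &
    forall h : R, `|h| < r -> `|f (x + h *: v) - f x - d * h| <= e * `|h|.
Proof.
set q := fun h : R => h^-1 *: ((f \o shift x) (h *: v) - f x).
have qE (h : R) : h != 0 -> d - q h = - h^-1 * (f (x + h *: v) - f x - d * h).
  move=> h0; rewrite /q /= [h *: v + x]addrC; set a := f _ - f x.
  by rewrite -[_ *: _]/(h^-1 * a); field.
split=> [[fd dE] e e0|H].
  have qd : q h @[h --> 0^'] --> d by rewrite -dE; exact: fd.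
  have /cvgrPdist_lt/(_ e e0) := qd.
  move=> /nbhs_ballP[r /= r0 Hr]; exists r => // h hr.
  have [->|h0] := eqVneq h 0; first by rewrite scale0r addr0 subrr mulr0 subr0 !normr0 mulr0.
  have := Hr h; rewrite /ball /= sub0r normrN => /(_ hr h0).
  rewrite qE // normrM normrN normfV mulrC ltr_pdivrMr ?normr_gt0 //.
  exact: ltW.
have qd : q h @[h --> 0^'] --> d.
  apply/cvgrPdist_lt => e e0; have e2 : 0 < e / 2 by rewrite divr_gt0.
  have [r r0 Hr] := H _ e2; apply/nbhs_ballP; exists r => // h.
  rewrite /ball /= sub0r normrN => hr h0.
  rewrite qE // normrM normrN normfV mulrC ltr_pdivrMr ?normr_gt0 //.
  apply: (le_lt_trans (Hr h hr)); rewrite ltr_pM2r ?normr_gt0 //.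
  by move: e0; clear - R; lra.
split; first by apply/cvg_ex; exists d.
exact/cvg_lim.
Qed.

End directional.

Section directional_line.
Context {R : realType} {V : normedModType R}.
Implicit Types (f : V -> R) (x v : V).

Lemma is_derive_line f x v (t d : R) : is_derive (x + t *: v) v f d ->
  is_derive t 1 (fun s : R => f (x + s *: v)) d.
Proof.
move=> /is_deriveP H; apply/is_deriveP => e /H[r r0 Hr]; exists r => // h /Hr.
by rewrite [h *: 1]mulr1 -(addrA x) -scalerDl.
Qed.

End directional_line.

(** * Partial derivatives, functions of class C^k and jets *)

Section smooth_calculus.
Context {R : realType} {n : nat}.
Notation V := 'rV[R]_n.
Implicit Types (f g : V -> R) (x y z v : V) (i j k : 'I_n).

Lemma has_partialP i f x : has_partial i f x -> is_derive x (delta_mx 0 i : V) f (partial i f x).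
Proof. by move=> h; split. Qed.

Lemma partial_mvt i f y (s : R) : (forall x, has_partial i f x) ->
  exists2 t : R, `|t| <= `|s| & f (y + s *: delta_mx 0 i) - f y = partial i f (y + t *: delta_mx 0 i) * s.
Proof.
move=> hp; pose g (t : R) := f (y + t *: delta_mx 0 i).
have gd (t : R) : is_derive t 1 g (partial i f (y + t *: delta_mx 0 i)).
  by apply: is_derive_line; exact: has_partialP.
have gc : continuous g.
  by move=> t; apply/differentiable_continuous/derivable1_diffP; have [] := gd t.
have gcs a b : {within `[a, b], continuous g} by exact: continuous_subspaceT.
have g0 : g 0 = f y by rewrite /g scale0r addr0.
have [s0|s0] := leP 0 s.
  have [t + E] := MVT_segment s0 (fun t _ => gd t) (gcs _ _).
  rewrite in_itv /= => /andP[t0 ts]; exists t; first by rewrite !ger0_norm.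
  by rewrite -g0 -/(g s) E subr0.
have [t + E] := MVT_segment (ltW s0) (fun t _ => gd t) (gcs _ _).
rewrite in_itv /= => /andP[t0 ts]; exists t; first by rewrite !ler0_norm ?(ltW s0) ?lerN2.
by rewrite -g0 -/(g s) -[LHS]opprB E sub0r mulrN opprK.
Qed.

Lemma mx_ballP x y (r : R) : 0 < r -> ball x r y <-> forall i, `|x 0 i - y 0 i| < r.
Proof.
move=> r0; split=> [[_ H] i|H]; first exact: (H 0 i).
by split=> // a i; rewrite (ord1 a); exact: H.
Qed.

Lemma cvg_eps f x : {for x, continuous f} -> forall e : R, 0 < e ->
  exists2 r : R, 0 < r & forall z, (forall i, `|z 0 i| < r) -> `|f (x + z) - f x| < e.
Proof.
move=> fx e e0; have /cvgrPdist_lt/(_ e e0) := fx.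
move=> /nbhs_ballP[r /= r0 Hr]; exists r => // z zr.
rewrite distrC; apply: Hr; apply/(mx_ballP _ _ r0) => i.
by rewrite mxE opprD addrA subrr sub0r normrN.
Qed.

(** [class_C] speaks of partial derivatives only. The increment along [h v] is split into coordinate
    steps by the partial vectors [T k], and the mean value theorem is applied to each step. *)
Lemma is_derive_C1 f x v : class_C 1 f ->
  is_derive x v f (\sum_i partial i f x * v 0 i).
Proof.
move=> fC; apply/is_deriveP => e e0.
have nv : 0 < nm v + 1 by rewrite ltr_pwDr // nm_ge0.
have e1 : 0 < e / (nm v + 1) by rewrite divr_gt0.
have /choice[r Hr] : forall i, exists r : R, 0 < r /\ forall z, (forall j, `|z 0 j| < r) ->
    `|partial i f (x + z) - partial i f x| < e / (nm v + 1).
  move=> i; have [_ /(_ x) ci] := fC i; have [r r0 H] := cvg_eps ci e1.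
  by exists r.
pose r0 := \big[Num.min/1]_i r i.
have r00 : 0 < r0.
  by rewrite /r0; elim/big_ind: _ => // [a b a0 b0|i _]; [rewrite lt_min a0|have [] := Hr i].
have r0r i : r0 <= r i by rewrite /r0 (bigD1 i) //= ge_min lexx.
exists (r0 / (nm v + 1)); first by rewrite divr_gt0.
move=> h; rewrite ltr_pdivlMr // => hr.
pose T (k : nat) : V := \row_i (if (i < k)%N then h * v 0 i else 0).
have T0 : T 0%N = 0 by apply/rowP => i; rewrite !mxE.
have Tn : T n = h *: v by apply/rowP => i; rewrite !mxE ltn_ord.
have TS i : T i.+1 = T i + (h * v 0 i) *: delta_mx 0 i.
  apply/rowP => j; rewrite !mxE eqxx /= ltnS leq_eqVlt.
  have [->|ji] := eqVneq j i; first by rewrite eqxx ltnn mulr1 add0r.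
  by rewrite mulr0 addr0; case: eqP => // /val_inj /eqP; rewrite (negbTE ji).
have small i : `|h * v 0 i| < r0.
  apply: le_lt_trans hr; rewrite normrM ler_wpM2l // /nm (bigD1 i) //= -addrA lerDl.
  by rewrite addr_ge0 // sumr_ge0.
have -> : f (x + h *: v) - f x - (\sum_i partial i f x * v 0 i) * h =
   \sum_(i < n) (f (x + T i.+1) - f (x + T i) - partial i f x * v 0 i * h).
  rewrite sumrB -mulr_suml; congr (_ - _).
  have := @telescope_sumr R 0 n (fun k : nat => f (x + T k)) (leq0n n).
  by rewrite Tn T0 addr0 big_mkord.
apply: le_trans (ler_norm_sum _ _ _) _.
apply: (@le_trans _ _ (\sum_i e / (nm v + 1) * `|h * v 0 i|)).
  apply: ler_sum => i _; rewrite TS addrA.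
  have [t ts ->] := partial_mvt (x + T i) (h * v 0 i) (proj1 (fC i)).
  have -> : partial i f (x + T i + t *: delta_mx 0 i) * (h * v 0 i) - partial i f x * v 0 i * h =
    (partial i f (x + T i + t *: delta_mx 0 i) - partial i f x) * (h * v 0 i) by ring.
  rewrite normrM ler_wpM2r // ltW // -addrA; have [_] := Hr i; apply=> j.
  apply: lt_le_trans (r0r i); rewrite !mxE eqxx /=.
  have [->|ji] := eqVneq j i; first by rewrite ltnn add0r mulr1 (le_lt_trans ts) // small.
  by rewrite mulr0 addr0; case: ifP => _; rewrite ?normr0 // small.
rewrite -mulr_sumr mulrAC ler_pdivrMr // -mulrA ler_wpM2l ?(ltW e0) //.
under eq_bigr do rewrite normrM.
by rewrite -mulr_sumr -/(nm v) ler_wpM2l // lerDl.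
Qed.

Lemma tay_is_derive f (df : 'I_n -> V -> R) (C : R) x v : tay f df C ->
  is_derive x v f (\sum_i df i x * v 0 i).
Proof.
move=> /tay_pos[{}C C0 fC]; apply/is_deriveP => e e0.
have c0 : 0 < C * nm v ^+ 2 + 1 by rewrite ltr_wpDl // mulr_ge0 ?exprn_ge0 ?nm_ge0.
exists (e / (C * nm v ^+ 2 + 1)); first by rewrite divr_gt0.
move=> h; rewrite ltr_pdivlMr // => hr; have := fC x (h *: v); rewrite nmZ.
have -> : \sum_i df i x * (h *: v) 0 i = (\sum_i df i x * v 0 i) * h.
  by rewrite mulr_suml; apply: eq_bigr => i _; rewrite mxE; ring.
move=> H; apply: (le_trans H).
have : `|h| * (`|h| * (C * nm v ^+ 2 + 1)) <= `|h| * e by rewrite ler_wpM2l // ltW.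
have := sqr_ge0 `|h|; rewrite exprMn; move: `|h| (nm v) => a b; clear - R; lra.
Qed.

Lemma tay_partial f (df : 'I_n -> V -> R) (C : R) i x : tay f df C ->
  has_partial i f x /\ partial i f x = df i x.
Proof.
move=> fC; have [h1 h2] := tay_is_derive x (delta_mx 0 i) fC; split => //.
by rewrite /partial h2 -[delta_mx _ _]scale1r sum_delta mul1r.
Qed.

Lemma lip_continuous f (L : R) : (forall x z, `|f (x + z) - f x| <= L * nm z) -> continuous f.
Proof.
move=> fL x; apply/(@cvgrPdist_lt _ _ _ (nbhs x) (nbhs_filter x)) => e e0.
pose K := n%:R * `|L| + 1; have K0 : 0 < K by rewrite ltr_wpDl // mulr_ge0.
have eK : 0 < e / K by rewrite divr_gt0.
apply/nbhs_ballP; exists (e / K) => // y /(mx_ballP _ _ eK) xy.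
have := fL x (y - x); rewrite subrKC distrC => H; apply: (le_lt_trans H).
have nb : nm (y - x) <= n%:R * (e / K).
  rewrite /nm mulrn_sum; apply: ler_sum => i _.
  by rewrite !mxE distrC ltW.
apply: (@le_lt_trans _ _ (`|L| * (n%:R * (e / K)))).
  by apply: (@le_trans _ _ (`|L| * nm (y - x))); rewrite ?ler_wpM2r ?nm_ge0 ?ler_norm // ler_wpM2l.
rewrite !mulrA ltr_pdivrMr // mulrC ltr_pM2l // /K [`|L| * _]mulrC.
by rewrite ltrDl.
Qed.

Lemma jet_continuous (U : seq 'I_n -> V -> R) J : isjet U -> continuous (U J).
Proof.
move=> ju; have [b Hb] := jet_dbdd J ju; have [C HC] := ju.2 J.
by apply: (@lip_continuous _ b) => x z; exact: tay_lip HC Hb.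
Qed.

Lemma jet_partial (U : seq 'I_n -> V -> R) J i : isjet U ->
  (forall x, has_partial i (U J) x) /\ partial i (U J) = U (i :: J).
Proof.
move=> ju; have [C HC] := ju.2 J.
by split=> [x|]; [|apply/funext => x]; have [] := tay_partial i x HC.
Qed.

Lemma jet_smooth (U : seq 'I_n -> V -> R) J : isjet U -> smooth (U J).
Proof.
move=> ju k; elim: k J => [|k IH] J /=; first exact: jet_continuous.
by move=> i; have [h1 ->] := jet_partial J i ju.
Qed.

End smooth_calculus.

Section composition.
Context {R : realType} {V : normedModType R}.
Implicit Types (f : V -> R) (x v : V).

Lemma is_derive_of_line f x v (d : R) : is_derive (0 : R) 1 (fun s : R => f (x + s *: v)) d ->
  is_derive x v f d.
Proof.
move=> /is_deriveP H; apply/is_deriveP => e /H[r r0 Hr]; exists r => // h /Hr.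
by rewrite [h *: 1]mulr1 add0r scale0r addr0.
Qed.

Lemma is_derive_comp1 (g : R -> R) f x v (d b : R) : is_derive (f x) 1 g b -> is_derive x v f d ->
  is_derive x v (fun y => g (f y)) (b * d).
Proof.
move=> gb fd; apply: is_derive_of_line.
apply: (@is_derive1_comp _ g (fun s : R => f (x + s *: v))); first by rewrite scale0r addr0.
by apply: is_derive_line; rewrite scale0r addr0.
Qed.

Lemma is_derive_sum1 (n : nat) (f : 'I_n -> V -> R) x v (d : 'I_n -> R) :
  (forall j, is_derive x v (f j) (d j)) -> is_derive x v (fun y => \sum_j f j y) (\sum_j d j).
Proof.
move=> H; have -> : (fun y => \sum_j f j y) = \sum_(j < n) f j.
  by apply/funext => y; rewrite fct_sumE.
exact: is_derive_sum.
Qed.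

Lemma is_derive_add f g x v (a b : R) : is_derive x v f a -> is_derive x v g b ->
  is_derive x v (fun y => f y + g y) (a + b).
Proof. exact: is_deriveD. Qed.

Lemma is_derive_mul f g x v (a b : R) : is_derive x v f a -> is_derive x v g b ->
  is_derive x v (fun y => f y * g y) (a * g x + f x * b).
Proof.
move=> fa gb; have -> : a * g x + f x * b = f x *: b + g x *: a by rewrite /GRing.scale /=; ring.
exact: is_deriveM.
Qed.
End composition.

(** * The equation in nondivergence form *)

Section mean_curvature.
Context {R : realType} {n : nat}.
Notation V := 'rV[R]_n.
Implicit Types (f g : V -> R) (x y z v : V) (i j k : 'I_n).

Lemma vel_grad f y : Num.sqrt (1 + enorm (grad f y) ^+ 2) = vel (fun i => partial i f y).
Proof.
rewrite /vel; congr (Num.sqrt (1 + _)); rewrite /enorm sqr_sqrtr; last first.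
  by apply: sumr_ge0 => i _; rewrite -expr2 sqr_ge0.
by apply: eq_bigr => i _; rewrite !mxE expr2.
Qed.

Definition mc_operator (c c0 : R) f x : R :=
  G0 c c0 (fun j i => partial j (partial i f) x) (fun i => partial i f x).

Lemma mc_expand c c0 f x : class_C 2 f ->
  - divergence (fun y => (Num.sqrt (1 + enorm (grad f y) ^+ 2))^-1 *: grad f y) x
    + c0 - c / Num.sqrt (1 + enorm (grad f x) ^+ 2)
  = - (vel (fun i => partial i f x) ^- 3 * mc_operator c c0 f x).
Proof.
move=> fC; pose p i := partial i f x; pose X j i := partial j (partial i f) x.
have v0 := vel_gt0 p; set v := vel p in v0.
have D i j : is_derive x (delta_mx 0 i : V) (partial j f) (X i j).
  by apply: has_partialP; have [_ /(_ i)[]] := fC j.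
have dq i : is_derive x (delta_mx 0 i : V) (fun y => 1 + \sum_j partial j f y ^+ 2) (\sum_j 2 * p j * X i j).
  rewrite -[X in is_derive _ _ _ X]add0r.
  apply: (is_derive_add (f := fun=> 1)).
  apply: is_derive_sum1 => j; under eq_fun do rewrite expr2.
  have -> : 2 * p j * X i j = X i j * p j + p j * X i j by ring.
  exact: is_derive_mul.
have dv i : is_derive x (delta_mx 0 i : V) (fun y => vel (fun j => partial j f y)) (v^-1 * \sum_j p j * X i j).
  have -> : v^-1 * \sum_j p j * X i j = (2 * v)^-1 * \sum_j 2 * p j * X i j.
    under [in RHS]eq_bigr do rewrite -mulrA; rewrite -mulr_sumr.
    by field; exact: lt0r_neq0.
  have s0 : 0 < 1 + \sum_j p j ^+ 2.
    by rewrite ltr_wpDr //; apply: sumr_ge0 => j _; exact: sqr_ge0.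
  exact: (is_derive_comp1 (f := fun y => 1 + \sum_j partial j f y ^+ 2) (is_derive1_sqrt s0) (dq i)).
have dc i : partial i (fun y => ((Num.sqrt (1 + enorm (grad f y) ^+ 2))^-1 *: grad f y) 0 i) x =
    v^-1 * X i i - v ^- 3 * (\sum_j p j * X i j) * p i.
  have -> : (fun y => ((Num.sqrt (1 + enorm (grad f y) ^+ 2))^-1 *: grad f y) 0 i) =
     fun y => (vel (fun j => partial j f y))^-1 * partial i f y.
    by apply/funext => y; rewrite !mxE vel_grad.
  have di : is_derive x (delta_mx 0 i : V) (fun y => (vel (fun j => partial j f y))^-1)
      (- v ^- 2 * (v^-1 * \sum_j p j * X i j)).
    have iv : is_derive v (1 : R) (fun t : R => t^-1) (- v ^- 2).
      rewrite -[X in is_derive _ _ _ X]mulr1; apply: (is_deriveV (f := id)).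
      exact: lt0r_neq0.
    exact: (is_derive_comp1 (f := fun y => vel (fun j => partial j f y)) iv (dv i)).
  have [_ H] := is_derive_mul di (D i i); rewrite /partial H -/(p i) -/v.
  by field; exact: lt0r_neq0.
have vE : vel (fun i => partial i f x) = v by [].
rewrite /divergence (eq_bigr _ (fun i _ => dc i)) vel_grad vE.
have -> : mc_operator c c0 f x =
    v ^+ 2 * (\sum_i X i i) - \sum_i \sum_j X j i * p j * p i + v * v * (c + - c0 * v).
  by rewrite /v sqr_vel -(sum_quad_dir X p).
clear D dq dv dc vE; clearbody v; clearbody p X; rewrite sumrB -mulr_sumr.
have -> : \sum_i v ^- 3 * (\sum_j p j * X i j) * p i = v ^- 3 * \sum_i \sum_j X j i * p j * p i.
  rewrite exchange_big mulr_sumr; apply: eq_bigr => i _ /=.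
  by rewrite -mulrA mulr_suml; congr (_ * _); apply: eq_bigr => j _; ring.
by field; exact: lt0r_neq0.
Qed.

Lemma forced_mcP c c0 f : class_C 2 f ->
  forced_mc_equation c0 c f <-> forall x, mc_operator c c0 f x = 0.
Proof.
move=> fC; split=> H x; last by rewrite mc_expand // H mulr0 oppr0.
have := H x; rewrite mc_expand // => /eqP; rewrite oppr_eq0 mulf_eq0 invr_eq0 expf_eq0 /=.
by rewrite gt_eqF ?vel_gt0 //= => /eqP.
Qed.
End mean_curvature.

Section maximum.
Context {R : realType}.
(** [g'] is differentiated at 0 only. If that derivative were positive, [g'] would be positive on a
    short interval to the right of 0, and the mean value theorem would make [g] exceed its
    maximum. *)
Lemma max_second (g g' : R -> R) (d2 : R) :
  (forall t : R, is_derive t (1 : R) g (g' t)) -> is_derive (0 : R) 1 g' d2 -> (forall t : R, g t <= g 0) ->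
  g' 0 = 0 /\ d2 <= 0.
Proof.
move=> gd gd2 gmax; have g0 : g' 0 = 0.
  apply/eqP; apply: contraT => a0; have e0 : 0 < `|g' 0| / 2 by rewrite divr_gt0 // normr_gt0.
  have /is_deriveP/(_ _ e0)[r r0 Hr] := gd 0.
  pose h := Num.sg (g' 0) * (r / 2).
  have hn : `|h| = r / 2 by rewrite /h normrM normr_sg a0 mul1r gtr0_norm // divr_gt0.
  have := Hr h; rewrite hn => /(_ _) H; have {}H : `|g (0 + h *: 1) - g 0 - g' 0 * h| <= `|g' 0| / 2 * (r / 2).
    by apply: H; move: r0; clear - R; lra.
  have gh : g' 0 * h = `|g' 0| * (r / 2) by rewrite /h mulrA [g' 0 * _]mulrC -normrEsg.
  move: H; rewrite gh; have := gmax (0 + h *: 1); rewrite ler_norml.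
  have : 0 < `|g' 0| * r by rewrite mulr_gt0 // normr_gt0.
  move: (g _) (g 0) `|_| => u w a; clear - R; lra.
split=> //; rewrite leNgt; apply/negP => d0.
have e0 : 0 < d2 / 2 by rewrite divr_gt0.
have /is_deriveP/(_ _ e0)[r r0 Hr] := gd2.
have pos h : 0 < h < r -> 0 < g' h.
  move=> /andP[h0 hr]; have := Hr h; rewrite gtr0_norm // => /(_ hr).
  rewrite g0 add0r [h *: 1]mulr1 subr0 ler_norml => /andP[+ _].
  have : 0 < d2 * h by rewrite mulr_gt0.
  clear - R; lra.
have r2 : 0 < r / 2 by rewrite divr_gt0.
have gc : {within `[0, r / 2], continuous g}.
  apply: continuous_subspaceT => t; apply/differentiable_continuous/derivable1_diffP.
  by have [] := gd t.
have [t] := MVT r2 (fun t _ => gd t) gc.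
rewrite in_itv /= subr0 => /andP[t0 tr] E; have := gmax (r / 2); rewrite -subr_le0 E leNgt.
by rewrite mulr_gt0 // pos // t0 (lt_trans tr) // ltr_pdivrMr // mulr_natr mulr2n ltrDl.
Qed.
End maximum.

(** * Comparison of entire solutions *)

Section comparison.
Context {R : realType} {n : nat}.
Notation V := 'rV[R]_n.
Implicit Types (x y z v : V) (i j : 'I_n) (p q : 'I_n -> R).

Lemma dotvC x y : dotv x y = dotv y x.
Proof. by apply: eq_bigr => i _; rewrite mulrC. Qed.

Lemma dotv_ge0 x : 0 <= dotv x x.
Proof. by apply: sumr_ge0 => i _; rewrite -expr2 sqr_ge0. Qed.

Lemma sqr_coord_le x i : x 0 i ^+ 2 <= dotv x x.
Proof.
rewrite /dotv (bigD1 i) //= -expr2 lerDl; apply: sumr_ge0 => j _.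
by rewrite -expr2 sqr_ge0.
Qed.

Lemma dotv_line y v (t : R) :
  dotv (y + t *: v) (y + t *: v) = dotv y y + (t * (2 * dotv y v) + t * t * dotv v v).
Proof.
rewrite /dotv !mulr_sumr -!big_split /=; apply: eq_bigr => i _; rewrite !mxE; ring.
Qed.

Lemma dotv_delta y i : dotv y (delta_mx 0 i) = y 0 i.
Proof.
by rewrite /dotv -[delta_mx _ _]scale1r (sum_delta (fun i => y 0 i)) mul1r.
Qed.

Lemma sum_quad_dir_lip (X : 'I_n -> 'I_n -> R) (b B : R) p q :
  (forall j i, `|X j i| <= b) -> (forall i, `|p i| <= B) -> (forall i, `|q i| <= B) ->
  0 <= b -> 0 <= B ->
  `|\sum_s quad X (dir s p) - \sum_s quad X (dir s q)| <= 4 * n%:R * b * B * \sum_i `|p i - q i|.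
Proof.
move=> Xb pB qB b0 B0; rewrite !sum_quad_dir; set D := \sum_i `|_|.
pose P := \sum_i p i ^+ 2; pose Q := \sum_i q i ^+ 2; pose TX := \sum_i X i i.
pose A := \sum_i \sum_j X j i * p j * p i; pose A' := \sum_i \sum_j X j i * q j * q i.
rewrite [X in `|X|](_ : _ = (P - Q) * TX - (A - A')); last first.
  by rewrite -/P -/Q -/TX -/A -/A'; ring.
have h1 : `|P - Q| <= 2 * B * D.
  rewrite /P /Q -sumrB mulr_sumr; apply: le_trans (ler_norm_sum _ _ _) _; apply: ler_sum => i _.
  rewrite subr_sqr normrM mulrC ler_wpM2r //; apply: (le_trans (ler_normD _ _)).
  by rewrite mulr_natl mulr2n lerD.
have h2 : `|TX| <= n%:R * b.
  by rewrite mulrn_sum; apply: le_trans (ler_norm_sum _ _ _) _; exact: ler_sum.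
have h3 : `|A - A'| <= 2 * n%:R * b * B * D.
  have -> : 2 * n%:R * b * B * D = \sum_i \sum_j b * (B * `|p i - q i| + B * `|p j - q j|).
    under eq_bigr do rewrite -mulr_sumr big_split /= sumr_const card_ord -mulr_sumr -/D.
    rewrite -mulr_sumr big_split /= sumr_const card_ord.
    under eq_bigr do rewrite -mulrnAl.
    by rewrite -mulr_sumr -/D -[_ *+ n]mulr_natl -[B *+ n]mulr_natl; ring.
  rewrite /A /A' -sumrB; apply: le_trans (ler_norm_sum _ _ _) _; apply: ler_sum => i _.
  rewrite -sumrB; apply: le_trans (ler_norm_sum _ _ _) _; apply: ler_sum => j _.
  have -> : X j i * p j * p i - X j i * q j * q i = X j i * (p j * (p i - q i) + (p j - q j) * q i) by ring.
  rewrite normrM ler_pM //; apply: (le_trans (ler_normD _ _)); apply: lerD.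
    by rewrite normrM ler_wpM2r.
  by rewrite normrM mulrC ler_wpM2r.
have h4 : `|(P - Q) * TX| <= (2 * B * D) * (n%:R * b) by rewrite normrM ler_pM.
apply: (le_trans (ler_normB _ _)); move: h3 h4; move: `|_ * _| `|_| => a1 a2; clear - R; lra.
Qed.

Variables (c c0 b k1 : R) (Phi : seq 'I_n -> V -> R) (psi : V -> R).
Hypotheses (jP : isjet Phi) (b0 : 0 <= b) (k10 : 0 <= k1) (P1 : ordb Phi 1 k1) (P2 : ordb Phi 2 b)
  (GP : forall x, GD c c0 Phi x = 0) (psiS : smooth psi) (psiE : forall x, mc_operator c c0 psi x = 0).
Local Ltac kp := clear - jP b0 k10 P1 P2 GP psiS psiE.

(** Restriction to the lines through the maximum point reduces this to [max_second]. The sign [s]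
    treats [psi - Phi] and its opposite together. *)
Lemma barrier_max x0 z (K e e1 s : R) :
  (forall x, s * (psi x - Phi [::] x) + e * (expR (- K * dotv (x - z) (x - z)) - e1) <=
     s * (psi x0 - Phi [::] x0) + e * (expR (- K * dotv (x0 - z) (x0 - z)) - e1)) ->
  let y := x0 - z in let E := expR (- K * dotv y y) in forall v,
  s * (\sum_i partial i psi x0 * v 0 i - \sum_i Phi [:: i] x0 * v 0 i) = 2 * K * e * E * dotv y v /\
  s * (quad (fun j i => partial j (partial i psi) x0) v - quad (fun j i => Phi [:: j; i] x0) v)
    + e * E * (4 * K ^+ 2 * dotv y v ^+ 2 - 2 * K * dotv v v) <= 0.
Proof.
move=> Hmax y E v; pose r2 := dotv y y; pose a := dotv y v; pose d := dotv v v.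
pose q (t : R) := r2 + (t * (2 * a) + t * t * d); pose q' (t : R) := 2 * a + 2 * t * d.
pose g (t : R) := s * (psi (x0 + t *: v) - Phi [::] (x0 + t *: v)) + e * (expR (- K * q t) - e1).
pose g' (t : R) := s * (\sum_i partial i psi (x0 + t *: v) * v 0 i - \sum_i Phi [:: i] (x0 + t *: v) * v 0 i)
  + e * (expR (- K * q t) * (- K * q' t)).
have id1 (t : R) : is_derive t (1 : R) (fun t : R => t) 1 by exact: is_derive_id.
have cst1 (k t : R) : is_derive t (1 : R) (fun _ : R => k) 0 by exact: is_derive_cst.
have dq (t : R) : is_derive t (1 : R) q (q' t).
  apply: is_derive_eq (is_derive_add (cst1 r2 t) (is_derive_add (is_derive_mul (id1 t) (cst1 (2 * a) t))
    (is_derive_mul (is_derive_mul (id1 t) (id1 t)) (cst1 d t)))) _.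
  rewrite /q'; ring.
have dE (t : R) : is_derive t (1 : R) (fun t => expR (- K * q t)) (expR (- K * q t) * (- K * q' t)).
  have h : is_derive t (1 : R) (fun t => - K * q t) (- K * q' t).
    by apply: is_derive_eq (is_derive_mul (cst1 (- K) t) (dq t)) _; rewrite mul0r add0r.
  exact: (is_derive_comp1 (f := fun t => - K * q t) (is_derive_expR (- K * q t)) h).
have dq' (t : R) : is_derive t (1 : R) q' (2 * d).
  apply: is_derive_eq (is_derive_add (cst1 (2 * a) t) (is_derive_mul (is_derive_mul (cst1 2 t) (id1 t)) (cst1 d t))) _.
  ring.
have [C0 HC0] := jP.2 [::].
have mulc (k t dk : R) (f : R -> R) : is_derive t (1 : R) f dk -> is_derive t (1 : R) (fun t => k * f t) (k * dk).
  by move=> h; apply: is_derive_eq (is_derive_mul (cst1 k t) h) _; rewrite mul0r add0r.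
have subd (t d1 d2 : R) (f1 f2 : R -> R) : is_derive t (1 : R) f1 d1 -> is_derive t (1 : R) f2 d2 ->
    is_derive t (1 : R) (fun t => f1 t - f2 t) (d1 - d2).
  by move=> h1 h2; exact: is_deriveB.
have dg (t : R) : is_derive t (1 : R) g (g' t).
  apply: is_derive_add.
    apply: mulc; apply: subd; apply: is_derive_line.
      exact: (is_derive_C1 _ _ (psiS 1)).
    exact: tay_is_derive HC0.
  apply: mulc; rewrite -[X in is_derive _ _ _ X]subr0; exact: subd (dE t) (cst1 e1 t).
pose QP := quad (fun j i => partial j (partial i psi) x0) v; pose QF := quad (fun j i => Phi [:: j; i] x0) v.
pose d2 := s * (QP - QF) + e * (expR (- K * q 0) * (- K * q' 0) * (- K * q' 0)
   + expR (- K * q 0) * (- K * (2 * d))).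
have dg' : is_derive (0 : R) (1 : R) g' d2.
  apply: is_derive_add.
    apply: mulc; apply: subd.
      apply: is_derive_sum1 => i; rewrite -mulr_suml.
      apply: is_derive_eq (is_derive_mul (is_derive_line _) (cst1 (v 0 i) 0)) _.
        by rewrite scale0r addr0; apply: (is_derive_C1 _ _ _); have [_] := psiS 2 i.
      by rewrite mulr0 addr0.
    apply: is_derive_sum1 => i; rewrite -mulr_suml; have [C1 HC1] := jP.2 [:: i].
    apply: is_derive_eq (is_derive_mul (is_derive_line _) (cst1 (v 0 i) 0)) _.
      by rewrite scale0r addr0; exact: tay_is_derive HC1.
    by rewrite mulr0 addr0.
  exact: (mulc _ _ _ _ (is_derive_mul (dE 0) (mulc (- K) 0 _ _ (dq' 0)))).
have gm t : g t <= g 0.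
  have := Hmax (x0 + t *: v).
  have -> : x0 + t *: v - z = y + t *: v by rewrite /y addrAC.
  by rewrite dotv_line -/(q t) /g scale0r addr0 /q !mul0r !addr0.
have [h1 h2] := max_second dg dg' gm.
have q0 : q 0 = r2 by rewrite /q !mul0r !addr0.
have q'0 : q' 0 = 2 * a by rewrite /q' mulr0 mul0r addr0.
split; last first.
  rewrite -/QP -/QF -/a -/d; move: h2; rewrite /d2 q0 q'0 -/E.
  have -> : e * (E * (- K * (2 * a)) * (- K * (2 * a)) + E * (- K * (2 * d))) =
    e * E * (4 * K ^+ 2 * a ^+ 2 - 2 * K * d) by ring.
  by [].
move: h1; rewrite /g' q0 q'0 scale0r addr0 -/E -/a => /eqP; rewrite addr_eq0 => /eqP ->.
ring.
Qed.

(** The barrier vanishes at distance [t + 1] from [z] and equals [eta] at distance [t]. A value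
    above [M - eta] at [x] would make the sum exceed [M] there, so its maximum lies outside the unit
    ball and within distance [t + 1]. At this point the equation of [Phi] is evaluated at the
    gradient of [psi], with an error of order [K e E r2]; the Hessian of the barrier contributes at
    least [4 K^2 e E r2] up to a term linear in [K], a contradiction for the chosen [K]. *)
Lemma comparison_step (M t : R) : 0 < M -> 0 <= t -> exists2 eta : R, 0 < eta & forall s : R,
  `|s| = 1 -> (forall x, s * (psi x - Phi [::] x) <= M) ->
  forall x z, dotv (x - z) (x - z) = t ^+ 2 ->
  (forall y, dotv (y - z) (y - z) <= 1 -> s * (psi y - Phi [::] y) <= M / 2) ->
  s * (psi x - Phi [::] x) <= M - eta.
Proof.
(* [e <= M / 4] keeps the maximum out of the unit ball, and [e <= 1 / 2] keeps the components of the
   two gradients within distance 1, whence the bound [B] for both. *)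
move=> M0 t0; pose e := Num.min (M / 4) 2^-1; pose B := k1 + 1.
have B0 : 0 <= B by rewrite addr_ge0.
have KH0 := KH_ge0 (n := n) c c0 B.
pose CL := KH (n := n) c c0 B + 4 * n%:R * b * B; have CL0 : 0 <= CL by rewrite /CL; nneg.
pose N1 : R := n%:R * (1 + n%:R * B ^+ 2); have N10 : 0 <= N1 by rewrite /N1; nneg.
(* [N1] bounds the sum of the squared lengths of the directions, and [CL * n] is the constant of the
   first order error; [K] exceeds their sum. *)
pose K := N1 + CL * n%:R + 1.
have K0 : 0 < K by rewrite /K ltr_pwDr // addr_ge0 // mulr_ge0.
have e0 : 0 < e by rewrite lt_min divr_gt0 // invr_gt0 ltr0n.
have eM : e <= M / 4 by rewrite ge_min lexx.
have e2 : 2 * e <= 1 by have : e <= 2^-1 by [rewrite ge_min lexx orbT]; kp; lra.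
pose e1 := expR (- K * (t + 1) ^+ 2).
exists (e * (expR (- K * t ^+ 2) - e1)).
  rewrite mulr_gt0 // subr_gt0 ltr_expR !mulNr ltrN2 ltr_pM2l //.
  by move: t0; kp; nra.
move=> s s1 WM x z xz Wi; rewrite leNgt; apply/negP => Hx.
pose F y := s * (psi y - Phi [::] y) + e * (expR (- K * dotv (y - z) (y - z)) - e1).
have Fx : M < F x by rewrite /F xz; move: Hx; move: (_ * (_ - e1)) (s * _) => a1 a2; kp; lra.
have cF : continuous F.
  have cq : continuous (fun y => dotv (y - z) (y - z)).
    move=> y; apply: (@cvgF_sum R V (nbhs y) (nbhs_filter y) _ _ (fun i y => (y - z) 0 i * (y - z) 0 i)) => i.
    have ci : {for y, continuous (fun y : V => (y - z) 0 i)}.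
      have -> : (fun y : V => (y - z) 0 i) = (fun y => y 0 i + (- z) 0 i).
        by apply/funext => u; rewrite mxE.
      apply: (@continuousD _ _ _ (fun y : V => y 0 i) (fun=> (- z) 0 i)); last exact: cst_continuous.
      exact: coord_continuous.
    exact: (continuousM ci ci).
  have cst (k : R) (y : V) : {for y, continuous (fun _ : V => k)} by exact: cst_continuous.
  move=> y; have c1 : {for y, continuous (fun y => psi y - Phi [::] y)}.
    have p1 : {for y, continuous psi} by exact: (psiS 0).
    have p2 : {for y, continuous (Phi [::])} by exact: jet_continuous.
    exact: (continuousB p1 p2).
  have c2 : {for y, continuous (fun y => expR (- K * dotv (y - z) (y - z)))}.
    exact: (continuous_comp (continuousM (cst (- K) y) (cq y)) (@continuous_expR R _)).
  exact: (continuousD (continuousM (cst s y) c1) (continuousM (cst e y) (continuousB c2 (cst e1 y)))).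
(* A compact cube that contains the ball of radius [t + 1]; outside this ball the barrier is
   nonpositive. *)
pose A : set V := [set y | forall i, [set` `[z 0 i - (t + 1), z 0 i + (t + 1)]] (y ord0 i)].
have Ac : compact A.
  apply: (@rV_compact R n (fun i => [set` `[z 0 i - (t + 1), z 0 i + (t + 1)]])) => i.
  exact: segment_compact.
have inA y : (forall i, `|(y - z) 0 i| <= t + 1) -> A y.
  move=> H i; have := H i; rewrite !mxE ler_norml /= in_itv /= => /andP[h1 h2].
  by apply/andP; split; move: h1 h2; kp; lra.
have sqle (a : R) : a ^+ 2 <= (t + 1) ^+ 2 -> `|a| <= t + 1.
  have t1 : 0 <= t + 1 by rewrite addr_ge0.
  by rewrite -[a ^+ 2]real_normK ?num_real // ler_pXn2r ?nnegrE.
have Ax : A x.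
  apply: inA => i; apply: sqle; apply: (le_trans (sqr_coord_le _ _)); rewrite xz.
  by move: t0; kp; nra.
have [x0 _ x0max] := compact_EVT_max (ex_intro _ x Ax) Ac (continuous_subspaceT cF).
have Fx0 : M < F x0 by apply: (lt_le_trans Fx); apply: x0max; rewrite inE.
have gmax y : F y <= F x0.
  have [yA|yA] := pselect (A y); first by apply: x0max; rewrite inE.
  apply: le_trans (ltW Fx0); rewrite /F -[X in _ <= X]addr0; apply: lerD; first exact: WM.
  rewrite pmulr_rle0 // subr_le0 ler_expR !mulNr lerN2 ler_pM2l //.
  rewrite leNgt; apply/negP => lt; apply: yA; apply: inA => i; apply: sqle.
  exact: le_trans (sqr_coord_le _ _) (ltW lt).
pose y := x0 - z; pose r2 := dotv y y; pose E := expR (- K * r2).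
have E0 : 0 < E by exact: expR_gt0.
have E1 : E <= 1 by rewrite /E -expR0 ler_expR mulNr oppr_le0 mulr_ge0 ?(ltW K0) ?dotv_ge0.
have r1 : 1 < r2.
  rewrite ltNge; apply/negP => r1; have := Wi x0 r1; move: Fx0; rewrite /F -/y -/r2 -/E.
  have e10 : 0 <= e1 by exact: expR_ge0.
  have : e * (E - e1) <= e by rewrite ger_pMr //; move: E1 e10; kp; lra.
  by move: eM M0; move: (e * _) (s * _) => a1 a2; kp; lra.
have BM := barrier_max gmax; rewrite -/y -/r2 -/E in BM.
pose q i := partial i psi x0; pose p i := Phi [:: i] x0.
have qp i : s * (q i - p i) = 2 * K * e * E * y 0 i.
  have [+ _] := BM (delta_mx 0 i); rewrite dotv_delta -[delta_mx _ _]scale1r.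
  by rewrite (sum_delta (fun i => partial i psi x0)) (sum_delta (fun i => Phi [:: i] x0)) !mul1r.
have KrE : K * r2 * E <= 1.
  have -> : E = (expR (K * r2))^-1 by rewrite /E mulNr expRN.
  rewrite ler_pdivrMr ?expR_gt0 // mul1r; have := expR_ge1Dx (K * r2).
  by move: (expR _) => a1; kp; lra.
have sqle1 (a r : R) : 0 <= a -> 1 < r -> a ^+ 2 <= r -> a <= r by kp; nra.
have yr i : `|y 0 i| <= r2.
  by apply: sqle1 => //; rewrite real_normK ?num_real // sqr_coord_le.
have cE : 0 <= 2 * K * e * E by have := ltW K0; have := ltW e0; have := ltW E0 => *; nneg.
have dqp i : `|q i - p i| <= 2 * K * e * E * r2.
  have -> : `|q i - p i| = `|s * (q i - p i)| by rewrite normrM s1 mul1r.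
  by rewrite qp normrM (ger0_norm cE) ler_wpM2l.
have pB1 i : `|p i| <= k1 by exact: P1.
have pB i : `|p i| <= B by apply: le_trans (pB1 i) _; rewrite lerDl.
have dq1 i : `|q i - p i| <= 1.
  apply: (le_trans (dqp i)).
  have : 2 * e * (K * r2 * E) <= 2 * e * 1 by rewrite ler_wpM2l // mulr_ge0 // ltW.
  move: e2; kp => h1 h2; lra.
have qB i : `|q i| <= B.
  rewrite -(subrK (p i) (q i)); apply: (le_trans (ler_normD _ _)); rewrite /B addrC.
  exact: lerD.
have D1 : \sum_i `|q i - p i| <= n%:R * (2 * K * e * E * r2).
  by rewrite mulrn_sum; exact: ler_sum.
have XB j i : `|Phi [:: j; i] x0| <= b by exact: P2.
have h1 := Hp_lip (n := n) c c0 qB pB; have h2 := sum_quad_dir_lip XB qB pB b0 B0.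
have g1 : \sum_s quad (fun j i => partial j (partial i psi) x0) (dir s q) = - Hp c c0 q.
  by apply/eqP; rewrite -addr_eq0; apply/eqP; exact: psiE.
have g2 : \sum_s quad (fun j i => Phi [:: j; i] x0) (dir s p) = - Hp c c0 p.
  by apply/eqP; rewrite -addr_eq0; apply/eqP; exact: GP.
pose S1 := \sum_s dotv y (dir s q) ^+ 2; pose S2 := \sum_s dotv (dir s q) (dir s q).
have sumBM : s * (- Hp c c0 q - \sum_s quad (fun j i => Phi [:: j; i] x0) (dir s q))
    + e * E * (4 * K ^+ 2 * S1 - 2 * K * S2) <= 0.
  rewrite -g1 -sumrB mulr_sumr /S1 /S2 !mulr_sumr -sumrB mulr_sumr -big_split.
  by apply: sumr_le0 => l _; have [_] := BM (dir l q).
have S1r : r2 <= S1.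
  rewrite /S1 big_sumType /= -[X in X <= _]addr0; apply: lerD.
    by apply: ler_sum => i _; rewrite dir_inl dotv_delta expr2.
  by apply: sumr_ge0 => l _; exact: sqr_ge0.
have S2r : S2 <= N1.
  have -> : S2 = \sum_s quad (fun j i => (j == i)%:R) (dir s q).
    apply: eq_bigr => l _; rewrite /quad; apply: eq_bigr => i _.
    rewrite (bigD1 i) //= eqxx mul1r big1 ?addr0 // => j /negPf ->.
    by rewrite !mul0r.
  rewrite sum_quad_dir /N1; have -> : \sum_(i < n) (i == i)%:R = n%:R :> R.
    by under eq_bigr do rewrite eqxx; rewrite sumr_const card_ord.
  rewrite mulrC.
  have hq : \sum_i q i ^+ 2 <= n%:R * B ^+ 2.
    rewrite mulrn_sum; apply: ler_sum => i _.
    by rewrite -[q i ^+ 2]real_normK ?num_real // lerXn2r ?nnegrE.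
  have -> : \sum_i \sum_j (j == i)%:R * q j * q i = \sum_i q i ^+ 2.
    apply: eq_bigr => i _; rewrite (bigD1 i) //= eqxx mul1r big1 ?addr0 ?expr2 // => j /negPf ->.
    by rewrite !mul0r.
  have q0 : 0 <= \sum_i q i ^+ 2 by apply: sumr_ge0 => i _; exact: sqr_ge0.
  apply: (@le_trans _ _ (n%:R * (1 + \sum_i q i ^+ 2))); first by rewrite gerBl.
  by rewrite ler_wpM2l // lerD2l.
have low : - (CL * (n%:R * (2 * K * e * E * r2))) <=
    s * (- Hp c c0 q - \sum_s quad (fun j i => Phi [:: j; i] x0) (dir s q)).
  set T := - Hp c c0 q - _; suff HT : `|T| <= CL * (n%:R * (2 * K * e * E * r2)).
    by have : `|s * T| <= CL * (n%:R * (2 * K * e * E * r2)); [rewrite normrM s1 mul1r|rewrite ler_norml => /andP[]].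
  apply: (@le_trans _ _ (CL * \sum_i `|q i - p i|)); last by rewrite ler_wpM2l.
  have -> : T = - (Hp c c0 q - Hp c c0 p) - (\sum_s quad (fun j i => Phi [:: j; i] x0) (dir s q)
     - \sum_s quad (fun j i => Phi [:: j; i] x0) (dir s p)).
    by rewrite g2 /T; move: (Hp _ _ _) (Hp _ _ _) (\sum_s _) => a1 a2 a3; ring.
  apply: (le_trans (ler_normB _ _)); rewrite normrN /CL mulrDl; exact: lerD h1 h2.
have Ee : 0 < e * E by rewrite mulr_gt0.
have fin : 4 * K ^+ 2 * r2 - 2 * K * N1 <= CL * n%:R * 2 * K * r2.
  rewrite -(ler_pM2l Ee).
  have a1 : e * E * (4 * K ^+ 2 * r2 - 2 * K * N1) <= e * E * (4 * K ^+ 2 * S1 - 2 * K * S2).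
    rewrite ler_pM2l //; apply: lerB.
      by rewrite ler_pM2l // mulr_gt0 // exprn_gt0.
    by rewrite ler_pM2l // mulr_gt0.
  apply: (le_trans a1); move: low sumBM; move: (s * _) (e * E * (_ - _)) => b1 b2.
  have -> : CL * (n%:R * (2 * K * e * E * r2)) = e * E * (CL * n%:R * 2 * K * r2) by ring.
  by move: (e * E * _) => b3; kp; lra.
have K2 : 0 < 2 * K by rewrite mulr_gt0.
have : 2 * K * (2 * K * r2 - N1) <= 2 * K * (CL * n%:R * r2).
  by move: fin; kp; move: (CL * n%:R) => d1; lra.
rewrite ler_pM2l //; have arith (N d r : R) : 0 <= N -> 0 <= d -> 1 < r ->
    2 * (N + d + 1) * r - N <= d * r -> False.
  kp => N0 d0 r0 h; have : 0 <= N * (r - 1) by rewrite mulr_ge0 // subr_ge0 ltW.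
  have r00 : 0 <= r by move: r0; kp; lra.
  have : 0 <= N * r by rewrite mulr_ge0.
  have : 0 <= d * r by rewrite mulr_ge0.
  by move: h r0; kp; lra.
by apply: arith r1 => //; rewrite mulr_ge0.
Qed.

End comparison.

(** * The singular set *)

Section inner_product.
Context {R : realType} {n : nat}.
Notation V := 'rV[R]_n.
Implicit Types (x y z v : V) (i j : 'I_n).

Lemma dotvDl x y z : dotv (x + y) z = dotv x z + dotv y z.
Proof. by rewrite /dotv -big_split; apply: eq_bigr => i _; rewrite mxE mulrDl. Qed.

Lemma dotvZl (a : R) x z : dotv (a *: x) z = a * dotv x z.
Proof. by rewrite /dotv mulr_sumr; apply: eq_bigr => i _; rewrite mxE mulrA. Qed.

Lemma dotvNl x z : dotv (- x) z = - dotv x z.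
Proof. by rewrite -scaleN1r dotvZl mulN1r. Qed.

Lemma dotvBr x y z : dotv z (x - y) = dotv z x - dotv z y.
Proof. by rewrite dotvC dotvDl dotvNl !(dotvC _ z). Qed.

Lemma enorm_ge0 x : 0 <= enorm x.
Proof. exact: sqrtr_ge0. Qed.

Lemma enormK x : enorm x ^+ 2 = dotv x x.
Proof. by rewrite sqr_sqrtr ?dotv_ge0. Qed.

Lemma enorm_gt0 x : x != 0 -> 0 < enorm x.
Proof.
move=> x0; rewrite sqrtr_gt0 lt_def dotv_ge0 andbT; apply: contra x0 => /eqP x0.
apply/eqP/rowP => i; rewrite mxE; apply/eqP; rewrite -sqrf_eq0 eq_le sqr_ge0 andbT.
by rewrite -x0 sqr_coord_le.
Qed.

Lemma enormZ (a : R) x : 0 <= a -> enorm (a *: x) = a * enorm x.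
Proof.
move=> a0; rewrite /enorm dotvZl dotvC dotvZl mulrA -expr2 sqrtrM ?sqr_ge0 //.
by rewrite sqrtr_sqr ger0_norm.
Qed.

Lemma cauchy_schwarz x y : dotv x y <= enorm x * enorm y.
Proof.
have [->|y0] := eqVneq y 0.
  rewrite /dotv big1 ?mulr_ge0 ?enorm_ge0 // => i _; by rewrite mxE mulr0.
have b0 := enorm_gt0 y0; have a0 := enorm_ge0 x.
have [|h] := leP (dotv x y) 0; first by move=> /le_trans; apply; rewrite mulr_ge0 ?enorm_ge0.
have e0 : 0 <= enorm x * enorm y by rewrite mulr_ge0 ?enorm_ge0.
rewrite -(ler_pXn2r (n := 2)) ?nnegrE ?(ltW h) // exprMn !enormK.
have d0 : 0 < dotv y y by rewrite -enormK exprn_gt0.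
have := dotv_ge0 (x + (- (dotv x y / dotv y y)) *: y); rewrite dotv_line.
have -> : dotv x x + (- (dotv x y / dotv y y) * (2 * dotv x y)
   + - (dotv x y / dotv y y) * - (dotv x y / dotv y y) * dotv y y) =
   (dotv x x * dotv y y - dotv x y ^+ 2) / dotv y y by field; exact: lt0r_neq0.
by rewrite pmulr_lge0 ?invr_gt0 // subr_ge0.
Qed.

Lemma dotv_lip v x z : `|dotv (x + z) v - dotv x v| <= nm v * nm z.
Proof.
rewrite dotvDl addrC addKr dotvC; apply: ler_sum_nm => i.
by rewrite /nm (bigD1 i) //= lerDl sumr_ge0.
Qed.

Lemma touch (f : V -> R) y v (d c : R) : is_derive y v f d ->
  (forall h : R, f (y + h *: v) <= f y + c * h) -> d = c.
Proof.
move=> /is_deriveP H Hc; apply/eqP; rewrite -subr_eq0 -normr_eq0 eq_le normr_ge0 andbT.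
apply/ler_addgt0Pr => e e0; rewrite add0r; have [r r0 Hr] := H e e0.
have r2 : 0 < r / 2 by rewrite divr_gt0.
have rr : r / 2 < r by move: r0; clear - R; lra.
have := Hr (r / 2); rewrite gtr0_norm // => /(_ rr).
have := Hr (- (r / 2)); rewrite normrN gtr0_norm // => /(_ rr).
have := Hc (r / 2); have := Hc (- (r / 2)); rewrite !ler_norml.
move: (f _) (f _) (f y) => a b u h1 h2 /andP[h3 _] /andP[h5 _].
by apply/andP; split; rewrite -(ler_pM2r r2); move: h1 h2 h3 h5; clear - R; lra.
Qed.

Lemma inf_min (S : set R) (a : R) : S a -> (forall b, S b -> a <= b) -> inf S = a.
Proof.
move=> Sa Sb; apply/eqP; rewrite eq_le; apply/andP; split.
  by apply: ge_inf => //; exists a => b; exact: Sb.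
by apply: lb_le_inf => [|b]; [exists a|exact: Sb].
Qed.
End inner_product.

Section singular_set.
Context {R : realType} {n : nat} {I : finType}.
Notation V := 'rV[R]_n.
Variables (i0 : I) (nu : I -> V) (alpha : R).
Hypotheses (nu1 : forall m, enorm (nu m) = 1) (nuI : injective nu) (kap0 : 0 < cot alpha).
Implicit Types (x y z : V) (m k : I).
Local Ltac kp := clear - i0 nu1 nuI kap0.

Let kap : R := cot alpha.
(** As [cot alpha] is positive, a maximal product with [nu m] means that the plane of [m] realizes
    [phi_infty] at [y]. *)
Definition top m y := forall k, dotv y (nu k) <= dotv y (nu m).
Local Notation A := (range nu).
Local Notation E := (E_infty alpha A).

Lemma ex_top y : exists m, top m y.
Proof.
have [m _ Hm] := @arg_maxP _ R I i0 predT (fun m => dotv y (nu m)) isT.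
by exists m => k; exact: Hm.
Qed.

Lemma phi_infty_top m y : top m y -> phi_infty alpha A y = - kap * dotv y (nu m).
Proof.
move=> tm; apply: inf_min; first by exists (nu m) => //; exists m.
by move=> _ [_ [k _ <-] <-]; rewrite !mulNr lerN2 ler_pM2l.
Qed.

Lemma phi_infty_le m y : phi_infty alpha A y <= - kap * dotv y (nu m).
Proof. by have [k tk] := ex_top y; rewrite (phi_infty_top tk) !mulNr lerN2 ler_pM2l. Qed.

(** [phi_infty] lies below both planes and touches them at [y], so its partial derivatives there
    would coincide with both slopes, which are distinct. *)
Lemma tie_singular m k y : m != k -> top m y -> dotv y (nu k) = dotv y (nu m) -> E y.
Proof.
move=> mk tm tie C1; have tk : top k y by move=> j; rewrite tie.
suff : nu m = nu k by move=> /nuI /eqP; rewrite (negbTE mk).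
apply/rowP => i; have /(_ i)[hp _] := nbhs_singleton C1.
have H j : top j y -> partial i (phi_infty alpha A) y = - kap * nu j 0 i.
  move=> tj; apply: touch (has_partialP hp) _ => h.
  apply: (le_trans (phi_infty_le j _)); rewrite (phi_infty_top tj) dotvDl dotvZl.
  by rewrite [dotv (delta_mx _ _) _]dotvC dotv_delta mulrDr [h * _]mulrC mulrA.
have kn : - kap != 0 by rewrite oppr_eq0 gt_eqF.
by apply: (mulfI kn); rewrite -(H m tm) -(H k tk).
Qed.

Lemma strict_C1 m x : (forall k, k != m -> dotv x (nu k) < dotv x (nu m)) ->
  C1_at (phi_infty alpha A) x.
Proof.
pose S := [set y | forall k, k != m -> dotv y (nu k) < dotv y (nu m)].
have So y : S y -> nbhs y S.
  move=> Sy; have H k : \forall z \near y, k != m -> dotv z (nu k) < dotv z (nu m).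
    have [->|km] := eqVneq k m; first exact: (@filterE V (nbhs y) (nbhs_filter y)).
    have cf : continuous (fun z => dotv z (nu m - nu k)).
      by apply: (@lip_continuous _ _ _ (nm (nu m - nu k))) => u w; exact: dotv_lip.
    have d0 : 0 < dotv y (nu m - nu k) by rewrite dotvBr subr_gt0; exact: Sy.
    have /cvgrPdist_lt/(_ _ d0) := cf y; apply: (@filterS V (nbhs y) (nbhs_filter y)) => z /= dz _.
    have := le_lt_trans (ler_norm _) dz; rewrite -subr_gt0 opprB addrC subrK.
    by rewrite dotvBr subr_gt0.
  by have := @filter_forall V I _ (nbhs y) (nbhs_filter y) H.
have St y : S y -> top m y.
  by move=> Sy k; have [->//|km] := eqVneq k m; rewrite ltW // Sy.
move=> Sx; rewrite /C1_at; apply: (@filterS V (nbhs x) (nbhs_filter x) _ _ _ (So x Sx)) => y Sy i.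
have D z : S z -> is_derive z (delta_mx 0 i : V) (phi_infty alpha A) (- kap * nu m 0 i).
  move=> Sz; apply: (@near_eq_is_derive R V R (fun z => - kap * dotv z (nu m))).
    by apply: (@filterS V (nbhs z) (nbhs_filter z) _ _ _ (So z Sz)) => w Sw; rewrite (phi_infty_top (St w Sw)).
  apply/is_deriveP => e e0; exists 1 => // h _.
  rewrite dotvDl dotvZl [dotv (delta_mx _ _) _]dotvC dotv_delta.
  rewrite (_ : _ - _ = 0) ?normr0 ?mulr_ge0 ?(ltW e0) //; ring.
split; first by have [] := D y Sy.
apply: (near_cst_continuous (- kap * nu m 0 i)).
by apply: (@filterS V (nbhs y) (nbhs_filter y) _ _ _ (So y Sy)) => z Sz; have [_] := D z Sz.
Qed.

Lemma singular_tie m y : E y -> exists2 k, k != m & dotv y (nu m) <= dotv y (nu k).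
Proof.
move=> Ey; apply: contrapT => H; apply: Ey; apply: (@strict_C1 m) => k km.
by rewrite ltNge; apply/negP => h; apply: H; exists k.
Qed.

(** The smallest distance between two of the vectors, capped at 1, which is also the default for a
    single vector. *)
Definition sep : R := \big[Num.min/1]_(p : I * I | p.1 != p.2) enorm (nu p.1 - nu p.2).

Lemma sep_gt0 : 0 < sep.
Proof.
rewrite /sep; elim/big_ind: _ => // [a b a0 b0|[m k] /= mk]; first by rewrite lt_min a0.
by apply: enorm_gt0; rewrite subr_eq0; apply: contra mk => /eqP /nuI ->.
Qed.

Lemma sep_le m k : m != k -> sep <= enorm (nu m - nu k).
Proof. by move=> mk; rewrite /sep (bigD1 (m, k)) //= ge_min lexx. Qed.

(** Moving from [x] in the direction [v = nu k - nu m] closes the gap of [k] at rate [|v|^2]. At the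
    first time [t] at which some [j] ties with [m], the point reached is singular, so [l <= t |v|];
    as [k] has not overtaken [m] before, its gap was at least [t |v|^2]. *)
Lemma dist_gap x m k (l : R) : (l%:E <= edistv x E)%E -> top m x -> k != m ->
  l * sep <= dotv x (nu m - nu k).
Proof.
move=> lx tm km; pose v := nu k - nu m.
pose g j := dotv x (nu m - nu j); pose r j := - dotv v (nu m - nu j).
have g0 j : 0 <= g j by rewrite /g dotvBr subr_ge0.
have v0 : 0 < enorm v by apply: enorm_gt0; rewrite subr_eq0; apply: contra km => /eqP /nuI ->.
have rk : r k = enorm v ^+ 2 by rewrite /r enormK -[nu m - nu k]opprB -/v -dotvNl dotvC dotvNl dotvC dotvNl opprK.
have rk0 : 0 < r k by rewrite rk exprn_gt0.
have [j rj Hj] := @arg_minP _ R I k (fun j => 0 < r j) (fun j => g j / r j) rk0.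
pose t := g j / r j; have t0 : 0 <= t by rewrite divr_ge0 // ltW.
pose y := x + t *: v.
have yE i : dotv y (nu m - nu i) = g i - t * r i.
  by rewrite /y dotvDl dotvZl /r mulrN opprK.
have ty : top m y.
  move=> i; rewrite -subr_ge0 -dotvBr yE subr_ge0.
  have [ri|ri] := ltP 0 (r i); first by rewrite -ler_pdivlMr // Hj.
  by apply: le_trans (g0 i); rewrite mulr_ge0_le0.
have tie : dotv y (nu j) = dotv y (nu m).
  by apply/esym/eqP; rewrite -subr_eq0 -dotvBr yE /t divfK ?subrr // gt_eqF.
have mj : m != j.
  apply: contraTneq rj => <-; rewrite -leNgt /r subrr /dotv big1 ?oppr0 // => i _.
  by rewrite [X in _ * X]mxE mulr0.
have Ey := tie_singular mj ty tie.
have : (edistv x E <= (enorm (x - y))%:E)%E by apply: ereal_inf_lbound; exists y.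
move=> /(le_trans lx); rewrite lee_fin => h.
have xy : enorm (x - y) = t * enorm v.
  have -> : x - y = - (t *: v) by rewrite /y opprD addrA subrr sub0r.
  by rewrite -enormZ // /enorm dotvNl dotvC dotvNl opprK.
have tk : t * enorm v ^+ 2 <= g k by rewrite -rk -ler_pdivlMr // Hj.
rewrite xy in h; have s1 := sep_le km; have s0 := sep_gt0.
have tv : 0 <= t * enorm v by rewrite mulr_ge0 // ltW.
apply: le_trans tk; rewrite -/v in s1; rewrite expr2 mulrA.
have [l0|l0] := leP 0 l; first by rewrite ler_pM // ltW.
by apply: (@le_trans _ _ 0); [rewrite mulr_le0_ge0 // ltW|rewrite mulr_ge0 // ltW].
Qed.

(* Moving by [t nu] from a point at which [nu] is a maximizer opens all gaps at speed [1 - nu.mu]. *)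
Lemma far_ball (L : R) : exists2 t : R, 0 <= t & forall x, exists z,
  dotv (x - z) (x - z) = t ^+ 2 /\
  forall y, dotv (y - z) (y - z) <= 1 -> (L%:E <= edistv y E)%E.
Proof.
have s0 := sep_gt0; pose t := 2 * (`|L| + 1) / sep.
have t0 : 0 <= t by rewrite divr_ge0 ?(ltW s0) // mulr_ge0 // addr_ge0.
exists t => // x; have [m tm] := ex_top x; exists (x + t *: nu m); split.
  have -> : x - (x + t *: nu m) = - (t *: nu m) by rewrite opprD addrA subrr sub0r.
  by rewrite dotvNl dotvC dotvNl opprK -enormK enormZ // nu1 mulr1.
set z := x + t *: nu m => y yz; apply: le_ereal_inf_tmp => _ [y' Ey' <-]; rewrite lee_fin.
have [k km tie] := singular_tie m Ey'; pose w := nu m - nu k.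
have w0 : 0 < enorm w by apply: lt_le_trans (sep_le _); rewrite // eq_sym.
have sw : sep <= enorm w by apply: sep_le; rewrite eq_sym.
have ww : enorm w ^+ 2 = 2 * (1 - dotv (nu m) (nu k)).
  rewrite enormK /w dotvBr !(dotvC (_ - _)) !dotvBr -!enormK !nu1 (dotvC (nu k)); ring.
have zw : t * (enorm w ^+ 2 / 2) <= dotv z w.
  rewrite /z dotvDl dotvZl -[X in X <= _]add0r; apply: lerD.
    by rewrite /w dotvBr subr_ge0.
  rewrite ler_wpM2l // /w dotvBr -enormK nu1 ww.
  by move: (dotv _ _) => a; kp; lra.
have yw : - enorm w <= dotv (y - z) w.
  have h : enorm (y - z) <= 1.
    rewrite -(ler_pXn2r (n := 2)) ?nnegrE ?enorm_ge0 // enormK expr1n //.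
  have := cauchy_schwarz (- (y - z)) w; rewrite dotvNl => c1.
  have en : enorm (- (y - z)) = enorm (y - z) by rewrite /enorm dotvNl dotvC dotvNl opprK.
  rewrite en in c1; have : enorm (y - z) * enorm w <= 1 * enorm w by rewrite ler_pM2r.
  by move: c1; move: (dotv _ _) (_ * _) => a b; kp; lra.
have y'w : dotv y' w <= 0 by rewrite /w dotvBr subr_le0.
have yy : dotv (y - y') w <= enorm (y - y') * enorm w := cauchy_schwarz _ _.
rewrite -(ler_pM2r w0); apply: le_trans yy.
have -> : dotv (y - y') w = dotv z w + dotv (y - z) w - dotv y' w by rewrite (dotvDl y (- y')) (dotvDl y (- z)) !dotvNl; ring.
have tw : (`|L| + 1) * 2 * enorm w <= t * enorm w ^+ 2.
  have -> : t * enorm w ^+ 2 = ((`|L| + 1) * 2 * enorm w) * (enorm w / sep) by rewrite /t; field; exact: lt0r_neq0.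
  rewrite ler_peMr //; last by rewrite ler_pdivlMr // mul1r.
  by rewrite !mulr_ge0 ?addr_ge0 // ltW.
have Lw : L * enorm w <= `|L| * enorm w by rewrite ler_pM2r // ler_norm.
rewrite mulrA in zw; move: zw yw y'w tw Lw.
move: (t * enorm w ^+ 2) (dotv z w) (dotv (y - z) w) (dotv y' w) => s a b d.
by kp; lra.
Qed.

End singular_set.

(** * Existence and uniqueness *)

Section entire_solutions.
Context {R : realType} {n : nat}.
Notation V := 'rV[R]_n.

Lemma cvx_concave (f : V -> R) : (forall t x y, 0 <= t <= 1 -> 0 <= cvx f t x y) -> concave f.
Proof.
move=> H t x y _ _; have t01 : 0 <= t%:num <= 1 by rewrite ge0 le1.
rewrite convRE -[X in - f X]/(t%:num *: x + (1 - t%:num) *: y).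
have := H _ x y t01; rewrite /cvx (_ : unstable.onem t%:num = 1 - t%:num) // !mulrN -opprD lerN2.
by move: (f _) (_ * f x) (_ * f y) => a b d; clear - R; lra.
Qed.

Lemma mc_operator_jet (c c0 : R) (Phi : seq 'I_n -> V -> R) x : isjet Phi ->
  mc_operator c c0 (Phi [::]) x = GD c c0 Phi x.
Proof.
move=> jP; rewrite /mc_operator /GD; congr (G0 _ _ _ _).
  apply/funext => j; apply/funext => i.
  by rewrite (jet_partial [::] i jP).2 (jet_partial [:: i] j jP).2.
by apply/funext => i; rewrite (jet_partial [::] i jP).2.
Qed.

Lemma entire_solution (I : finType) (i0 : I) (p : I -> 'I_n -> R) (gam : I -> R) (c0 kap : R) :
  0 < c0 -> 0 <= kap -> (forall m, \sum_i p m i ^+ 2 = kap ^+ 2) ->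
  let c := c0 * Num.sqrt (1 + kap ^+ 2) in
  exists Phi : seq 'I_n -> V -> R, [/\ isjet Phi, forall x, GD c c0 Phi x = 0,
    [/\ smooth (Phi [::]), concave (Phi [::]) & forced_mc_equation c0 c (Phi [::])],
    forall x, softmin p gam (soft_rate c0 kap) x <= Phi [::] x
  & forall m x, Phi [::] x <= plane (p m) (gam m) x].
Proof.
move=> c00 kap0 pk c; have [Phi [jP cP lP uP gP]] := soft_stationary i0 gam c00 kap0 pk.
have sP : smooth (Phi [::]) by exact: jet_smooth.
exists Phi; split=> //; split=> //; first exact: cvx_concave.
by apply/(forced_mcP _ _ (sP 2)) => x; rewrite mc_operator_jet.
Qed.

Lemma cvg0_ereal_lt (F : R -> \bar R) (d : R) : 0 < d -> F l @[l --> (+oo : set_system R)] --> 0%E ->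
  exists L : R, (F L < d%:E)%E.
Proof.
move=> d0 F0; have : nbhs (0 : \bar R)%E [set u : \bar R | (u < d%:E)%E].
  have : \forall r \near (0 : R), r < d by exact: lt_nbhsl.
  by apply: filterS => r; rewrite /= lte_fin.
move=> /F0 [M [_ HM]]; exists (M + 1); apply: (HM (M + 1)).
by rewrite ltrDl.
Qed.

End entire_solutions.

(** * Uniqueness for a positive slope *)

Section uniqueness.
Context {R : realType} {n : nat} {I : finType}.
Notation V := 'rV[R]_n.
Variables (i0 : I) (nu : I -> V) (alpha c c0 D : R) (star : V -> R) (Phi : seq 'I_n -> V -> R).
Hypotheses (nu1 : forall m, enorm (nu m) = 1) (nuI : injective nu) (kap0 : 0 < cot alpha).
Hypotheses (jP : isjet Phi) (GP : forall x, GD c c0 Phi x = 0).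
Local Notation E := (E_infty alpha (range nu)).
Local Notation dist0 phi := (ereal_sup [set `|phi x - star x|%:E
                  | x in [set x | (l%:E <= edistv x E)%E]]
          @[l --> (+oo : set_system R)] --> 0%E).

Local Ltac kp := clear - i0 nu1 nuI kap0 jP GP star D.

Lemma far_close (phi : V -> R) (d : R) : 0 < d -> dist0 phi ->
  exists L : R, forall x, (L%:E <= edistv x E)%E -> `|phi x - star x| <= d.
Proof.
move=> d0 /(cvg0_ereal_lt d0)[L HL]; exists L => x xL.
rewrite -lee_fin; apply: le_trans (ltW HL); apply: ereal_sup_ubound.
by exists x.
Qed.

(** Closeness [M / 4] of each solution to [star] gives the [M / 2] required by [comparison_step].
    Its [eta] is the same for all points and both signs, so the supremum [M] would be at most
    [M - eta]. *)
Lemma solution_unique (psi : V -> R) : smooth psi -> (forall x, mc_operator c c0 psi x = 0) ->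
  (forall x, - D <= psi x - star x <= 0) -> (forall x, - D <= Phi [::] x - star x <= 0) ->
  dist0 psi -> dist0 (Phi [::]) -> psi = Phi [::].
Proof.
move=> psiS psiE psiD PhiD psi0 Phi0; apply/funext => a; apply: contrapT => /eqP na.
pose S := [set r : R | exists x, r = `|psi x - Phi [::] x|].
have Sb : has_ubound S.
  exists D => _ [x ->]; have := psiD x; have := PhiD x; rewrite ler_norml.
  move: (psi x) (Phi [::] x) (star x) => u v w /andP[h1 h2] /andP[h3 h4].
  by apply/andP; split; move: h1 h2 h3 h4; kp; lra.
have Ss : has_sup S by split => //; exists `|psi a - Phi [::] a|; exists a.
pose M := sup S; have le_M x : `|psi x - Phi [::] x| <= M by apply: ub_le_sup => //; exists x.
have M0 : 0 < M by apply: lt_le_trans (le_M a); rewrite normr_gt0 subr_eq0.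
have M4 : 0 < M / 4 by rewrite divr_gt0.
have [L1 H1] := far_close M4 psi0; have [L2 H2] := far_close M4 Phi0.
have [t t0 Ht] := far_ball i0 nu1 nuI kap0 (Num.max L1 L2).
have [k1 k10 P1] := jet_ordb jP (ltn0Sn 0); have [b b0 P2] := jet_ordb jP (ltn0Sn 1).
have [eta eta0 Heta] := comparison_step jP b0 k10 P1 P2 GP psiS psiE M0 t0.
have dec x : `|psi x - Phi [::] x| <= M - eta.
  have [z [xz Hz]] := Ht x.
  have K s : `|s| = 1 -> s * (psi x - Phi [::] x) <= M - eta.
    move=> s1; apply: Heta xz _ => // y => [|yz].
      by apply: (le_trans (ler_norm _)); rewrite normrM s1 mul1r.
    apply: (le_trans (ler_norm _)); rewrite normrM s1 mul1r.
    have Ly := Hz y yz.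
    have y1 : `|psi y - star y| <= M / 4.
      by apply: H1; apply: le_trans Ly; rewrite lee_fin le_max lexx.
    have y2 : `|Phi [::] y - star y| <= M / 4.
      by apply: H2; apply: le_trans Ly; rewrite lee_fin le_max lexx orbT.
    have -> : psi y - Phi [::] y = (psi y - star y) - (Phi [::] y - star y) by ring.
    apply: (le_trans (ler_normB _ _)); move: y1 y2; move: `|_| `|_| => u v; kp; lra.
  have := K 1 (normr1 _); have := K (- 1) (normrN1 _); rewrite mul1r mulN1r ler_norml => h1 h2.
  by rewrite h2 andbT lerNl.
have : M <= M - eta by apply: ge_sup; [exact: Ss.1|move=> _ [x ->]].
by rewrite lerBrDr gerDl leNgt eta0.
Qed.

End uniqueness.

(** * Decay away from the singular set *)

Section envelope.
Context {R : realType} {n : nat} {I : finType}.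
Notation V := 'rV[R]_n.
Variables (i0 : I) (nu : I -> V) (alpha : R) (gamma : V -> R).
Local Notation p := (fun m i => - cot alpha * nu m 0 i).
Local Notation gam := (fun m => gamma (nu m)).
Local Notation star := (phi_star alpha (range nu) gamma).

Lemma planeE m x : plane (p m) (gam m) x = - cot alpha * dotv x (nu m) + gamma (nu m).
Proof.
rewrite /plane /dotv mulr_sumr; congr (_ + _); apply: eq_bigr => i _.
by rewrite -mulrA [nu m 0 i * _]mulrC.
Qed.

Lemma ex_star x : exists m, star x = plane (p m) (gam m) x /\
  forall k, star x <= plane (p k) (gam k) x.
Proof.
have [m _ Hm] := @arg_minP _ R I i0 predT (fun m => plane (p m) (gam m) x) isT.
have E : star x = plane (p m) (gam m) x.
  apply: inf_min; first by exists (nu m); [exists m|rewrite planeE].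
  by move=> _ [_ [k _ <-] <-]; rewrite -planeE; exact: Hm.
by exists m; split=> // k; rewrite E; exact: Hm.
Qed.

Hypotheses (nu1 : forall m, enorm (nu m) = 1) (nuI : injective nu) (kap0 : 0 < cot alpha).
Variables (lam : R) (phi : V -> R).
Hypotheses (lam0 : 0 < lam) (low : forall x, softmin p gam lam x <= phi x)
  (up : forall m x, phi x <= plane (p m) (gam m) x).
Local Notation E := (E_infty alpha (range nu)).

Local Ltac kp := clear - i0 nu1 nuI kap0 lam0 low up.

Definition osc : R := \sum_m `|gam m| + \sum_m `|gam m|.

(** By [dist_gap] the top index [m] leads all others by [cot alpha * l * sep] before the heights
    [gamma] are added, and [osc] bounds the difference of two heights. The plane realizing [star]
    may be another one than that of [m]; only [star <= plane] at [m] enters. *)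
Lemma decay x (l : R) : (l%:E <= edistv x E)%E ->
  `|phi x - star x| <= #|I|%:R / lam * expR (- lam * (cot alpha * (l * sep nu) - osc)).
Proof.
move=> xl; have [m tm] := ex_top i0 nu x; have [j [Ej Hj]] := ex_star x.
have u1 : phi x <= star x by rewrite Ej; exact: up.
rewrite distrC ger0_norm ?subr_ge0 //.
apply: (@le_trans _ _ (plane (p m) (gam m) x - softmin p gam lam x)).
  by apply: lerB; [exact: Hj|exact: low].
apply: (softmin_near i0 lam0) => k km; rewrite !planeE.
have g1 := dist_gap i0 nuI kap0 xl tm km; rewrite dotvBr in g1.
have g2 : `|gamma (nu k)| <= \sum_m `|gam m| by rewrite (bigD1 k) //= lerDl sumr_ge0.
have g3 : `|gamma (nu m)| <= \sum_m `|gam m| by rewrite (bigD1 m) //= lerDl sumr_ge0.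
have g4 : cot alpha * (l * sep nu) <= cot alpha * (dotv x (nu m) - dotv x (nu k)) by rewrite ler_pM2l.
have arith (a K d d' g g' G G1 G2 : R) : a <= K * (d - d') -> G1 <= G -> G2 <= G ->
    - g <= G1 -> g' <= G2 -> a - (G + G) <= - K * d' + g - (- K * d + g') by kp; lra.
by apply: arith g4 g2 g3 _ _; [rewrite -normrN ler_norm|exact: ler_norm].
Qed.

Lemma decay_cvg : ereal_sup [set `|phi x - star x|%:E | x in [set x | (l%:E <= edistv x E)%E]]
  @[l --> (+oo : set_system R)] --> 0%E.
Proof.
pose C := #|I|%:R / lam * expR (lam * osc); pose a := lam * (cot alpha * sep nu).
have s0 := sep_gt0 nuI.
have I0 : 0 < #|I|%:R :> R by rewrite ltr0n; apply/card_gt0P; exists i0.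
have C0 : 0 < C by rewrite /C mulr_gt0 ?divr_gt0 ?expR_gt0.
have a0 : 0 < a by rewrite /a mulr_gt0 // mulr_gt0.
have hE l : #|I|%:R / lam * expR (- lam * (cot alpha * (l * sep nu) - osc)) = C * expR (- (a * l)).
  rewrite /C -[RHS]mulrA -expRD; congr (_ * expR _); rewrite /a; ring.
have h0 : C * expR (- (a * l)) @[l --> (+oo : set_system R)] --> (0 : R).
  apply/cvgrPdist_lt => e e0; exists (C / (e * a)); split; first exact: num_real.
  have ea : 0 < e * a by exact: mulr_gt0.
  move=> l; rewrite ltr_pdivrMr // => hl; have Ce : 0 < C * expR (- (a * l)).
    by rewrite (mulr_gt0 C0) // expR_gt0.
  rewrite sub0r normrN gtr0_norm // expRN ltr_pdivrMr ?expR_gt0 //.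
  have := expR_ge1Dx (a * l); rewrite -(ler_pM2l e0); move: hl e0; move: (expR _) => u.
  by kp; lra.
have hE0 : (C * expR (- (a * l)))%:E @[l --> (+oo : set_system R)] --> (0 : \bar R)%E.
  by move=> B nB; exact: (h0 _ nB).
apply: (@squeeze_cvge _ _ _ _ (fun=> 0%E) _ (fun l => (C * expR (- (a * l)))%:E)).
- apply: filterE => l; apply/andP; split.
    (* The supremum is nonnegative because it runs over a nonempty set: [far_ball] provides a point
       at distance at least [l]. An empty set would give [-oo]. *)
    have [t t0 Ht] := far_ball i0 nu1 nuI kap0 l; have [z [_ Hz]] := Ht 0.
    apply: le_trans (ereal_sup_ubound _); last first.
      by exists z => //; apply: Hz; rewrite subrr /dotv big1 // => i _; rewrite mxE mulr0.
    by rewrite lee_fin.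
  apply: ge_ereal_sup => _ [x xl <-]; rewrite lee_fin -hE; exact: decay.
- exact: cvg_cst.
- exact: hE0.
Qed.

End envelope.

Lemma finite_set_enum {R : realType} {n k : nat} (A : set 'rV[R]_n) : (A #= `I_k)%card ->
  exists2 nu : 'I_k -> 'rV[R]_n, injective nu & A = range nu.
Proof.
move=> /card_esym /card_set_bijP[f [fA fI fS]].
exists (fun i : 'I_k => f i).
  by move=> i j fij; apply: val_inj; apply: fI; rewrite ?inE /= ?ltn_ord.
apply/seteqP; split=> [x /fS[i ik <-]|_ [i _ <-]]; first by exists (Ordinal ik).
by apply: fA; exact: ltn_ord.
Qed.

Lemma sqrt1Dcot2 {R : realType} (alpha : R) : 0 < sin alpha ->
  Num.sqrt (1 + cot alpha ^+ 2) = (sin alpha)^-1.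
Proof.
move=> s0; have -> : 1 + cot alpha ^+ 2 = (sin alpha)^-1 ^+ 2.
  have -> : 1 + cot alpha ^+ 2 = (cos alpha ^+ 2 + sin alpha ^+ 2) / sin alpha ^+ 2.
    by rewrite /cot; field; exact: lt0r_neq0.
  by rewrite cos2Dsin2 mul1r exprVn.
by rewrite sqrtr_sqr gtr0_norm // invr_gt0.
Qed.

(** * The case of zero slope, and the conclusion *)

Section flat_case.
Context {R : realType} {n : nat}.
Notation V := 'rV[R]_n.
Variables (alpha : R) (A : set V) (gamma : V -> R).
Hypothesis cot0 : cot alpha = 0.

Lemma phi_star_flat x : phi_star alpha A gamma x = phi_star alpha A gamma 0.
Proof.
by rewrite /phi_star cot0; congr inf; apply: eq_imagel => nu _; rewrite oppr0 !mul0r.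
Qed.

Lemma E_infty_flat : E_infty alpha A = set0.
Proof.
apply/seteqP; split=> // x; apply.
have -> : phi_infty alpha A = cst (phi_infty alpha A 0).
  apply/funext => y; rewrite /phi_infty cot0 /=; congr inf.
  by apply: eq_imagel => nu _; rewrite oppr0 !mul0r.
apply: (@filterE V (nbhs x) (nbhs_filter x)) => y i; split; first exact: derivable_cst.
have -> : partial i (cst (phi_infty alpha A 0)) = cst 0.
  by apply/funext => z; rewrite /partial derive_cst.
exact: cst_continuous.
Qed.

Lemma edistv_flat x (l : R) : (l%:E <= edistv x (E_infty alpha A))%E.
Proof. by rewrite /edistv E_infty_flat image_set0 ereal_inf0 leey. Qed.
End flat_case.

Theorem theorem1p2 (R : realType) (N : nat) (hN : (2 <= N)%N)
    (alpha c0 c : R)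
    (halpha : 0 < alpha <= pi / 2) (hc0 : 0 < c0) (hc : c = c0 / sin alpha)
    (A : set 'rV[R]_N.-1) (hAS : A `<=` unit_sphere)
    (k : nat) (hk : (1 <= k)%N) (hAk : (A #= `I_k)%card)
    (gamma : 'rV[R]_N.-1 -> R) :
  exists! phi : 'rV[R]_N.-1 -> R,
    [/\ smooth phi,
        concave phi,
        forced_mc_equation c0 c phi,
        forall x : 'rV[R]_N.-1,
          - (2 * ln k%:R / (c0 * sin alpha))
            <= phi x - phi_star alpha A gamma x <= 0
      & ereal_sup [set `|phi x - phi_star alpha A gamma x|%:E
                  | x in [set x | (l%:E <= edistv x (E_infty alpha A))%E]]
          @[l --> (+oo : set_system R)] --> 0%E].
Proof.
have /andP[a0 api] := halpha; have pi0 := pi_gt0 R.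
have s0 : 0 < sin alpha.
  by apply: sin_gt0_pi; rewrite a0 (le_lt_trans api) // ltr_pdivrMr // mulr_natr mulr2n ltrDl.
have cs : 0 <= cos alpha.
  apply: cos_ge0_pihalf; rewrite api andbT; apply: le_trans (ltW a0).
  by rewrite oppr_le0 divr_ge0 // ltW.
have ct0 : 0 <= cot alpha by rewrite divr_ge0 // ltW.
have cE : c = c0 * Num.sqrt (1 + cot alpha ^+ 2) by rewrite sqrt1Dcot2.
have lamE : soft_rate c0 (cot alpha) = c0 * sin alpha / 2.
  by rewrite /soft_rate sqrt1Dcot2 //; field; exact: lt0r_neq0.
have lam0 : 0 < soft_rate c0 (cot alpha) by rewrite lamE divr_gt0 // mulr_gt0.
set D := 2 * ln k%:R / _.
have D0 : 0 <= D by rewrite divr_ge0 ?mulr_ge0 ?(ltW hc0) ?(ltW s0) // ln_ge0 // ler1n.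
have [nu nuI AE] := finite_set_enum hAk.
have nu1 m : enorm (nu m) = 1 by apply: hAS; rewrite AE; exists m.
pose i0 : 'I_k := Ordinal hk.
rewrite {}AE {hAS hAk}.
(* The slope vanishes exactly when [alpha = pi / 2]. *)
have [kap0|kap0] := ltP 0 (cot alpha).
  have pk m : \sum_i (- cot alpha * nu m 0 i) ^+ 2 = cot alpha ^+ 2.
    under eq_bigr do rewrite exprMn sqrrN expr2 [_ 0 _ ^+ 2]expr2.
    by rewrite -mulr_sumr -/(dotv (nu m) (nu m)) -enormK nu1 expr1n mulr1 expr2.
  have [Phi [jP gP [sP cP eP] lP uP]] := entire_solution i0 (fun m => gamma (nu m)) hc0 ct0 pk.
  rewrite -cE in gP eP.
  have bP x : - D <= Phi [::] x - phi_star alpha (range nu) gamma x <= 0.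
    have [m [Em Hm]] := ex_star i0 nu alpha gamma x.
    rewrite subr_le0 [X in _ && (_ <= X)]Em uP andbT lerBrDl; apply: le_trans (lP x).
    have -> : D = ln #|'I_k|%:R / soft_rate c0 (cot alpha).
      by rewrite card_ord lamE /D; field; rewrite !lt0r_neq0.
    exact: softmin_ge.
  have dP := decay_cvg i0 nu1 nuI kap0 lam0 lP uP.
  exists (Phi [::]); split=> // psi [sS _ eS bS dS]; apply/esym.
  apply: (solution_unique i0 nu1 nuI kap0 jP gP sS _ bS bP dS dP).
  exact/(forced_mcP _ _ (sS 2)).
have {kap0}cot0 : cot alpha = 0 by apply/eqP; rewrite eq_le kap0.
pose star := phi_star alpha (range nu) gamma; pose g := star 0.
have starE x : star x = g by exact: phi_star_flat.
have pk (m : unit) : \sum_(i < N.-1) (0 : R) ^+ 2 = 0 ^+ 2.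
  by rewrite expr0n big1.
(* A single horizontal plane at height [g]: since [ln 1 = 0], the soft minimum and the plane
   coincide, and the solution between them is the constant [g]. *)
have [Phi [_ _ [sP cP eP] lP uP]] := entire_solution tt (fun=> g) hc0 (lexx 0) pk.
rewrite cot0 in cE lam0; rewrite -cE in eP.
have plE (x : 'rV[R]_N.-1) : plane (fun=> 0) g x = g.
  by rewrite /plane big1 ?add0r // => i _; rewrite mul0r.
have PhiE x : Phi [::] x = star x.
  apply/eqP; rewrite starE eq_le -{1}(plE x) uP //=; apply: le_trans (lP x).
  rewrite -[X in X <= _]subr0 -[X in _ - X](mul0r (soft_rate c0 0)^-1) -[X in _ - X / _](ln1 R).
  have -> : (1 : R) = #|{: unit}|%:R by rewrite card_unit.
  by apply: (softmin_ge tt lam0) => m; rewrite plE.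
exists (Phi [::]); split.
  split=> // [x|]; first by rewrite -/(star x) PhiE subrr lexx andbT oppr_le0.
  have -> : (fun l : R => ereal_sup [set `|Phi [::] x - star x|%:E
      | x in [set x | (l%:E <= edistv x (E_infty alpha (range nu)))%E]]) = cst 0%E.
    apply/funext => l /=; apply/eqP; rewrite eq_le; apply/andP; split.
      by apply: ge_ereal_sup => _ [x _ <-]; rewrite PhiE subrr normr0.
    apply: ereal_sup_ubound; exists 0; last by rewrite PhiE subrr normr0.
    exact: edistv_flat.
  exact: cvg_cst.
(* The distance to the empty singular set is [+oo], so the limit condition controls every point and
   forces [psi = star]. *)
move=> psi [_ _ _ _ dS]; apply/funext => x; rewrite PhiE; apply/esym/eqP.
rewrite -subr_eq0 -normr_eq0 eq_le normr_ge0 andbT; apply/ler_addgt0Pr => e e0; rewrite add0r.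
have [L HL] := cvg0_ereal_lt e0 dS.
rewrite -lee_fin; apply: le_trans (ltW HL); apply: ereal_sup_ubound; exists x => //.
exact: edistv_flat.
Qed.
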